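(* If $\alpha$ is a Pisot--Vijayaraghavan number, then the sequence $([\![\alpha^n]\!])_{n\in\mathbb{N}}$ is a rigidity sequence in $\mathbb{Z}$, where $[\![\cdot]\!]$ is the nearest integer function.
   Context: A real number $\alpha$ is a Pisot--Vijayaraghavan (PV) number if $\alpha>1$ is an algebraic integer all of whose Galois conjugates (other than $\alpha$ itself) have absolute value less than $1$. A measure-preserving system for $\mathbb{Z}$ is a quadruple $(X, \mathcal{B}, \mu, (T_g)_{g \in \mathbb{Z}})$, where $(X,\mathcal{B},\mu)$ is a non-atomic Lebesgue probability space and $(T_g)_{g\in\mathbb{Z}}$ is an action of $\mathbb{Z}$ by measure-preserving transformations. A sequence $(a_n)_{n\in\mathbb{N}}$ in $\mathbb{Z}$ is a rigidity sequence for the system if $\|f\circ T_{a_n} - f\|_2 \to 0$ for every $f \in L^2(\mu)$. The system is weakly mixing if $\frac{1}{|\Phi_N|}\sum_{g\in\Phi_N} |\mu(A\cap T_gB)-\mu(A)\mu(B)| \to 0$ for all $A,B\in\mathcal{B}$ and every F{\o}lner sequence $(\Phi_N)$ in $\mathbb{Z}$ (finite nonempty sets with $|(\Phi_N+x)\triangle\Phi_N|/|\Phi_N|\to0$ for every $x \in \mathbb{Z}$). The standalone term ''rigidity sequence'' means a sequence that is a rigidity sequence for some weakly mixing system. *)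

(* Defs.v *)
From HB Require Import structures.
From mathcomp Require Import all_boot all_order all_algebra.
From mathcomp Require Import finmap.
From mathcomp Require Import all_classical all_reals all_analysis.
From mathcomp Require Import complex.

Set Implicit Arguments.
Unset Strict Implicit.
Unset Printing Implicit Defensive.
Import Order.TTheory GRing.Theory Num.Theory.
Import numFieldNormedType.Exports.

Local Open Scope classical_set_scope.
Local Open Scope ring_scope.
Local Open Scope complex_scope.

Definition galois_conjugate (R : realType) (a z : R[i]) : Prop :=
  exists p : {poly rat},
    [/\ p \is monic, irreducible_poly p,
        root (map_poly ratr p) a & root (map_poly ratr p) z].

Definition PV_number (R : realType) (alpha : R) : Prop :=
  [/\ 1 < alpha,
      integralOver (intr : int -> R) alpha &
      forall z : R[i], galois_conjugate alpha%:C z -> z <> alpha%:C ->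
        `|z| < 1].

(* Half-integers are rounded up; the convention is immaterial for powers of
   PV numbers, which are never half-integers. *)
Definition nearest_int (R : realType) (x : R) : int := Num.floor (x + 2^-1).

(* Non-atomic Lebesgue space in the sense of Rokhlin: a complete probability
   space isomorphic mod 0 to [0, 1] with the Lebesgue-measurable sets and the
   Lebesgue measure. The type [caratheodory_type _] has carrier R. *)
Definition nonatomic_Lebesgue_space (R : realType) (d : measure_display)
    (X : measurableType d) (mu : probability X R) : Prop :=
  let lambda := @completed_lebesgue_measure R in
  measure_is_complete mu /\
  exists (X0 : set X) (Y0 : set (caratheodory_type (@wlength R idfun)^*%mu))
         (f : X -> caratheodory_type (@wlength R idfun)^*%mu),
    [/\ measurable X0 /\ mu X0 = 1%E,
        [/\ measurable Y0, Y0 `<=` `[(0 : R), 1]%classic & lambda Y0 = 1%E],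
        set_bij X0 Y0 f,
        forall A, A `<=` X0 -> (measurable A <-> measurable (f @` A)) &
        forall A, A `<=` X0 -> measurable A -> lambda (f @` A) = mu A].

Definition measure_preserving_action (R : realType) (d : measure_display)
    (X : measurableType d) (mu : probability X R) (T : int -> X -> X) : Prop :=
  [/\ T 0 = id,
      forall g h, T (g + h) = T g \o T h,
      forall g, measurable_fun setT (T g) &
      forall g A, measurable A -> mu (T g @^-1` A) = mu A].

Definition measure_preserving_system (R : realType) (d : measure_display)
    (X : measurableType d) (mu : probability X R) (T : int -> X -> X) : Prop :=
  nonatomic_Lebesgue_space mu /\ measure_preserving_action mu T.

(* L^2 consists of complex-valued functions. *)
Definition rigidity_sequence_for (R : realType) (d : measure_display)
    (X : measurableType d) (mu : probability X R) (T : int -> X -> X)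
    (a : nat -> int) : Prop :=
  forall f : X -> R[i],
    (fun x => complex.Re (f x)) \in Lfun mu 2%:E ->
    (fun x => complex.Im (f x)) \in Lfun mu 2%:E ->
    ('N[mu]_2%:E[(fun x => (Normc.normc (f (T (a n) x) - f x))%:E)])%E
      @[n --> \oo] --> 0%E.

Local Open Scope fset_scope.

Definition Folner (R : realType) (Phi : nat -> {fset int}) : Prop :=
  (forall N, Phi N != fset0) /\
  forall x : int,
    let shift N := [fset (y + x)%R | y in Phi N] in
    (#|` (shift N `\` Phi N) `|` (Phi N `\` shift N)|%:R / #|` Phi N|%:R : R)
      @[N --> \oo] --> (0 : R).

Definition weakly_mixing (R : realType) (d : measure_display)
    (X : measurableType d) (mu : probability X R) (T : int -> X -> X) : Prop :=
  forall A B : set X, measurable A -> measurable B ->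
  forall Phi : nat -> {fset int}, Folner R Phi ->
    (#|` Phi N|%:R^-1 *
      \sum_(g <- Phi N)
        `|fine (mu (A `&` (T g @` B))%classic) - fine (mu A) * fine (mu B)|)
      @[N --> \oo] --> (0 : R).

Definition rigidity_sequence (R : realType) (a : nat -> int) : Prop :=
  exists (d : measure_display) (X : measurableType d) (mu : probability X R)
         (T : int -> X -> X),
    [/\ measure_preserving_system mu T, weakly_mixing mu T &
        rigidity_sequence_for mu T a].

(* Main.v *)
(** Write [a n] for the nearest integer to [alpha ^ n].  Since [alpha] is a PV
    number, [alpha ^ n] is within [C k ^ n] of an integer, for some [k < 1], and
    therefore [|sin (a n * t m / 2)| <= C' k ^ |n - m|] where
    [t m = 2 pi / alpha ^ m].  With [e j = 1 / (j + 1)] this makes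
    [\sum_j e j * |sin (a n * t j / 2)|] tend to 0 although [\sum_j e j] diverges.

    The rotation by [t j] yields a shift-invariant random subset of the integers
    that contains a given point with probability [1 - e j / 2]; let [S J] be the
    intersection of independent such sets for [j < J].  Its density [q J] tends
    to 0.  The union of about [1 / (2 q J)] independent copies of [S J] has a limit
    law (along an ultrafilter), a shift-invariant process on [{0,1}^Z].  Its
    correlations are controlled by the return rate
    [r J g = P (g \in S J | 0 \in S J)], a product over [j < J].  As [\sum_j e j]
    diverges, [r J] is small on average over Folner sets, which gives weak mixing;
    as the sum of the [e j * |sin (a n * t j / 2)|] is small, [r J (a n)] is close to 1,
    which gives rigidity along [a].

    The law of the process is carried by the numbers
    [v U = P (all coordinates in U are 1)].  The process is realised on [[0, 1[] by
    cutting this interval successively according to the coordinates. *)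

From HB Require Import structures.
Require Import Defs.
From mathcomp Require Import all_boot all_order all_algebra separable.
From mathcomp Require Import finmap.
From mathcomp Require Import all_classical all_reals all_analysis.
From mathcomp Require Import measurable_realfun complex ring lra zify.

Set Implicit Arguments.
Unset Strict Implicit.
Unset Printing Implicit Defensive.
Import Order.TTheory GRing.Theory Num.Theory.
Import numFieldNormedType.Exports.

Local Open Scope classical_set_scope.
Local Open Scope fset_scope.
Local Open Scope ring_scope.

(** * Completely monotone functions of finite sets of integers *)

Section CompleteMonotonicity.
Variable (R : realFieldType).
Implicit Types (v w q : {fset int} -> R) (U V A : {fset int}).

(** The sets [S J] degenerate as [J] grows, since the divergence of [\sum_j e j] makes them vanish;
    only their return rates survive. Superposing copies is a finite form of the Poisson suspension
    of an infinite measure-preserving system: it restores a density away from 0 and 1 and turns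
    return rates into correlations. The two demands on [e] are compatible because the kernel
    [k ^ |n - m|] has sums over [m] that are bounded uniformly in [n]: weights that tend to 0,
    summable or not, still tend to 0 when averaged against it. Since the system must be a complete
    Lebesgue space, the process lives on an interval; its dynamics are first studied on the product
    sigma-algebra and then extended modulo null sets. *)

Definition nab A v U : R := v U - v (A `|` U).

Fixpoint nabs (As : seq {fset int}) v : {fset int} -> R :=
  if As is A :: As' then nabs As' (nab A v) else v.

(* By inclusion-exclusion, these are, up to normalization, the functions
   [v U = P (U `<=` y)] of random sets [y]. *)
Definition completely_monotone v := forall As U, 0 <= nabs As v U.

Lemma eq_nabs As v w U : v =1 w -> nabs As v U = nabs As w U.
Proof.
elim: As v w => [|A As IH] v w vw /=; first exact: vw.
by apply: IH => V; rewrite /nab !vw.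
Qed.

Lemma nabsD As v w U : nabs As (fun V => v V + w V) U = nabs As v U + nabs As w U.
Proof.
elim: As v w => [|A As IH] v w //=; rewrite -IH; apply: eq_nabs => V.
by rewrite /nab; ring.
Qed.

Lemma nabsZ As c v U : nabs As (fun V => c * v V) U = c * nabs As v U.
Proof.
elim: As v => [|A As IH] v //=; rewrite -IH; apply: eq_nabs => V.
by rewrite /nab; ring.
Qed.

Lemma nabsB As v w U : nabs As (fun V => v V - w V) U = nabs As v U - nabs As w U.
Proof.
rewrite -[in RHS]mulN1r -nabsZ -nabsD; apply: eq_nabs => V; ring.
Qed.

Lemma nabs_sum As (I : Type) (s : seq I) (F : I -> {fset int} -> R) U :
  nabs As (fun V => \sum_(i <- s) F i V) U = \sum_(i <- s) nabs As (F i) U.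
Proof.
elim: s => [|i s IH].
  rewrite big_nil (@eq_nabs _ _ (fun V => 0 * 0)) ?nabsZ ?mul0r// => V.
  by rewrite big_nil.
rewrite big_cons -IH -nabsD; apply: eq_nabs => V; exact: big_cons.
Qed.

Lemma nabs_setU As A v U : nabs As (fun V => v (A `|` V)) U = nabs As v (A `|` U).
Proof.
elim: As v => [|B As IH] v //=; rewrite -IH; apply: eq_nabs => V.
by rewrite /nab fsetUCA.
Qed.

Lemma nabs_nab As A v U : nabs As (nab A v) U = nabs As v U - nabs As v (A `|` U).
Proof. by rewrite /nab nabsB nabs_setU. Qed.

Lemma nabs_cat As Bs v U : nabs (As ++ Bs) v U = nabs Bs (nabs As v) U.
Proof. by elim: As v => //= A As IH v; rewrite IH. Qed.

Lemma nabsC As Bs v U : nabs As (nabs Bs v) U = nabs Bs (nabs As v) U.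
Proof.
elim: Bs v => //= B Bs IH v; rewrite IH; apply: eq_nabs => V.
exact: nabs_nab.
Qed.

(** [nab A] is idempotent, because [A] united with itself is [A], and differences commute. Hence
    [nabs As] depends only on the set of members of [As], which makes [dual] insensitive to the
    enumeration of its argument. *)
Lemma nabs_absorb As A v U : A \in As -> nabs As (nab A v) U = nabs As v U.
Proof.
elim: As v => //= B As IH v; rewrite inE => /orP[/eqP <-|AAs].
  by apply: eq_nabs => V; rewrite /nab fsetUA fsetUid; ring.
rewrite -(IH (nab B v))//; apply: eq_nabs => V.
by rewrite /nab (fsetUCA A B); ring.
Qed.

Lemma nabs_absorbs As Bs v U : {subset Bs <= As} ->
  nabs As (nabs Bs v) U = nabs As v U.
Proof.
elim: Bs v => //= B Bs IH v sBA; rewrite IH; last first.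
  by move=> C CB; apply: sBA; rewrite inE CB orbT.
by apply: nabs_absorb; apply: sBA; rewrite inE eqxx.
Qed.

Lemma eq_mem_nabs As Bs v U : As =i Bs -> nabs As v U = nabs Bs v U.
Proof.
move=> AB; rewrite -(@nabs_absorbs As Bs); last by move=> C; rewrite AB.
by rewrite nabsC nabs_absorbs// => C; rewrite AB.
Qed.

(** No set contains [U] without containing its subset [A]. *)
Lemma nabs_vanish As A v U : A \in As -> A `<=` U -> nabs As v U = 0.
Proof.
move=> AAs AU; rewrite -(nabs_absorb _ _ AAs) nabs_nab.
by move/fsetUidPr: AU => ->; rewrite subrr.
Qed.

Lemma cm_ge0 v U : completely_monotone v -> 0 <= v U.
Proof. by move/(_ [::] U). Qed.

Lemma cm_ext v w : v =1 w -> completely_monotone v -> completely_monotone w.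
Proof. by move=> vw cv As U; rewrite -(eq_nabs _ _ vw). Qed.

Lemma cm_nab A v : completely_monotone v -> completely_monotone (nab A v).
Proof. by move=> cv As U; exact: (cv (A :: As) U). Qed.

Lemma cm_setU A v : completely_monotone v -> completely_monotone (fun U => v (A `|` U)).
Proof. by move=> cv As U; rewrite nabs_setU. Qed.

Lemma cmD v w : completely_monotone v -> completely_monotone w ->
  completely_monotone (fun U => v U + w U).
Proof. by move=> cv cw As U; rewrite nabsD addr_ge0. Qed.

Lemma cmZ c v : 0 <= c -> completely_monotone v ->
  completely_monotone (fun U => c * v U).
Proof. by move=> c0 cv As U; rewrite nabsZ mulr_ge0. Qed.

Lemma cm_sum (I : Type) (s : seq I) (F : I -> {fset int} -> R) :
  (forall i, completely_monotone (F i)) ->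
  completely_monotone (fun U => \sum_(i <- s) F i U).
Proof. by move=> cF As U; rewrite nabs_sum sumr_ge0// => i _; exact: cF. Qed.

Lemma cm1 : completely_monotone (fun=> 1).
Proof.
case=> [|A As] U //=; rewrite (@eq_nabs _ _ (fun V => 0 * 0)) ?nabsZ ?mul0r//.
by move=> V; rewrite /nab subrr.
Qed.

(* Leibniz rule: [nab A (v w) = nab A v * w + v (A `|` _) * nab A w]. *)
Lemma cmM v w : completely_monotone v -> completely_monotone w ->
  completely_monotone (fun U => v U * w U).
Proof.
move=> cv cw As; elim: As v w cv cw => [|A As IH] v w cv cw U /=.
  by rewrite mulr_ge0 ?cm_ge0.
rewrite (@eq_nabs _ _ (fun V => nab A v V * w V + v (A `|` V) * nab A w V)).
  by rewrite nabsD addr_ge0// IH//; [exact: cm_nab|exact: cm_setU|exact: cm_nab].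
by move=> V; rewrite /nab; ring.
Qed.

Lemma cmX v K : completely_monotone v -> completely_monotone (fun U => v U ^+ K).
Proof.
move=> cv; elim: K => [|K IH]; first exact: cm1.
by apply: (@cm_ext (fun U => v U * v U ^+ K)); [move=> U; rewrite exprS|exact: cmM].
Qed.

Lemma cm_prod (I : Type) (s : seq I) (F : I -> {fset int} -> R) :
  (forall i, completely_monotone (F i)) ->
  completely_monotone (fun U => \prod_(i <- s) F i U).
Proof.
move=> cF; elim: s => [|i s IH].
  by apply: cm_ext cm1 => U; rewrite big_nil.
by apply: cm_ext (cmM (cF i) IH) => U; rewrite big_cons.
Qed.

Lemma cm_le v A U : completely_monotone v -> v (A `|` U) <= v U.
Proof. by move=> /(_ [:: A] U); rewrite /= /nab subr_ge0. Qed.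

(** For [a] with values in [0, 1] and [u] uniform on [0, 1], this is the probability that [u <= a g]
    for all [g] in [U]; hence the default value 1. *)
Definition fsetmin (a : int -> R) U := \big[Num.min/1]_(g <- U) a g.

Lemma le_fsetminP (a : int -> R) U t :
  reflect (t <= 1 /\ forall g, g \in U -> t <= a g) (t <= fsetmin a U).
Proof.
rewrite /fsetmin; have -> : (forall g, g \in U -> t <= a g) =
  (forall g, g \in enum_fset U -> t <= a g) by [].
elim: (enum_fset U) => [|g s IH].
  by rewrite big_nil; apply: (iffP idP) => [|[]//].
rewrite big_cons le_min; apply: (iffP andP).
  move=> [tg /IH[t1 ts]]; split => // h; rewrite inE => /orP[/eqP->//|]; exact: ts.
move=> [t1 ts]; split; first by apply: ts; rewrite inE eqxx.
by apply/IH; split => // h hs; apply: ts; rewrite inE hs orbT.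
Qed.

Lemma eq_le_all (x y : R) : (forall t, (t <= x) = (t <= y)) -> x = y.
Proof. by move=> h; apply/eqP; rewrite eq_le -h lexx h lexx. Qed.

Lemma fsetminU (a : int -> R) U V :
  fsetmin a (U `|` V) = Num.min (fsetmin a U) (fsetmin a V).
Proof.
apply: eq_le_all => t; rewrite le_min; apply/le_fsetminP/andP.
  by move=> [t1 h]; split; apply/le_fsetminP; split => // g gU; apply: h;
    rewrite inE gU ?orbT.
move=> [/le_fsetminP[t1 hU] /le_fsetminP[_ hV]]; split => // g.
by rewrite inE => /orP[/hU|/hV].
Qed.

Lemma fsetmin1 (a : int -> R) g : a g <= 1 -> fsetmin a [fset g] = a g.
Proof.
move=> ag; apply: eq_le_all => t; apply/le_fsetminP/idP => [[_]|tg].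
  by apply; rewrite inE.
by split => [|h]; [exact: le_trans ag|rewrite inE => /eqP->].
Qed.

Lemma fsetmin_le1 (a : int -> R) U : fsetmin a U <= 1.
Proof. by have /le_fsetminP[] := lexx (fsetmin a U). Qed.

Lemma fsetmin0 (a : int -> R) : fsetmin a fset0 = 1.
Proof.
by apply: eq_le_all => t; apply/le_fsetminP/idP => [[]//|t1]; split => // g; rewrite inE.
Qed.

Lemma fsetmin_ge0 (a : int -> R) U : (forall g, 0 <= a g) -> 0 <= fsetmin a U.
Proof. by move=> a0; apply/le_fsetminP; split. Qed.

Lemma fsetmin_shift (a : int -> R) U x :
  fsetmin a [fset g + x | g in U] = fsetmin (fun g => a (g + x)) U.
Proof.
apply: eq_le_all => t; apply/le_fsetminP/le_fsetminP => -[t1 h]; split => // g.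
  by move=> gU; apply: h; apply/imfsetP; exists g.
by move=> /imfsetP[/= h' hU ->]; exact: h.
Qed.

(* [nab A] maps [max (min a - s) 0] to the function of the same form with [s]
   replaced by [max s (min_A a)]. *)
Lemma cm_fsetmin (a : int -> R) : (forall g, 0 <= a g) ->
  completely_monotone (fsetmin a).
Proof.
move=> a0.
suff gen : forall As s U, 0 <= nabs As (fun V => Num.max (fsetmin a V - s) 0) U.
  move=> As U; rewrite (@eq_nabs _ _ (fun V => Num.max (fsetmin a V - 0) 0)) => // V.
  by rewrite subr0; apply/esym/max_idPl; exact: fsetmin_ge0.
elim=> [|A As IH] s U /=; first by rewrite le_max lexx orbT.
have := IH (Num.max s (fsetmin a A)) U.
congr (0 <= _); apply: eq_nabs => V; rewrite /nab fsetminU.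
move: (fsetmin a A) (fsetmin a V) => x y.
rewrite /Num.max /Num.min.
by case: (ltP s x) => ?; case: (ltP x y) => ?; repeat (case: ltP => ?); lra.
Qed.

(** * Shifts and complements of random sets *)

Definition fshift (x : int) U := [fset (g + x)%R | g in U].

Lemma fshift0 x : fshift x fset0 = fset0.
Proof. by apply/fsetP => g; rewrite inE; apply/imfsetP => -[/= h]; rewrite inE. Qed.

Lemma fshift1 x g : fshift x [fset g] = [fset g + x].
Proof.
apply/fsetP => h; rewrite inE; apply/imfsetP/eqP => [[/= k]|->].
  by rewrite inE => /eqP->.
by exists g; rewrite ?inE.
Qed.

Lemma fshiftU x U V : fshift x (U `|` V) = fshift x U `|` fshift x V.
Proof. exact: imfsetU. Qed.

Lemma mem_fshift x U g : (g \in fshift x U) = (g - x \in U).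
Proof.
apply/imfsetP/idP => [[/= h hU ->]|gU]; first by rewrite addrK.
by exists (g - x); rewrite ?subrK.
Qed.

Definition shift_invariant v := forall x U, v (fshift x U) = v U.

Lemma nabs_fshift As v x U :
  nabs (map (fshift x) As) v (fshift x U) = nabs As (fun V => v (fshift x V)) U.
Proof.
elim: As v => //= A As IH v; rewrite IH; apply: eq_nabs => V.
by rewrite /nab fshiftU.
Qed.

(* If [q U] is the measure of [{y | U `<=` y}] for a random set [y], then
   [dual q U] is the measure of the [y] that are disjoint from [U]. *)
Definition dual q U := nabs [seq [fset g] | g <- enum_fset U] q fset0.

Lemma dual_nabs q U s : enum_fset U =i s ->
  dual q U = nabs [seq [fset g] | g <- s] q fset0.
Proof. by move=> Us; apply: eq_mem_nabs; exact: eq_mem_map. Qed.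

Lemma dual0 q : dual q fset0 = q fset0.
Proof. exact: (@dual_nabs _ _ [::]). Qed.

Lemma dual1 q g : dual q [fset g] = q fset0 - q [fset g].
Proof.
rewrite (@dual_nabs _ _ [:: g]) /= /nab ?fsetU0// => h.
by rewrite !inE.
Qed.

Lemma dual2 q g h : dual q [fset g; h] =
  q fset0 - q [fset g] - q [fset h] + q [fset g; h].
Proof.
rewrite (@dual_nabs _ _ [:: h; g]); last by move=> k; rewrite !inE orbC.
by rewrite /= /nab !fsetU0 (fsetUC [fset h]); ring.
Qed.

Lemma dualU q A U : dual q (A `|` U) =
  nabs [seq [fset g] | g <- enum_fset U] (nabs [seq [fset g] | g <- enum_fset A] q) fset0.
Proof.
rewrite (@dual_nabs _ _ (enum_fset A ++ enum_fset U)); last first.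
  by move=> g; rewrite mem_cat; exact: in_fsetU.
by rewrite map_cat nabs_cat.
Qed.

Lemma dual_fshift q x U : shift_invariant q -> dual q (fshift x U) = dual q U.
Proof.
move=> qx; rewrite (@dual_nabs _ _ [seq g + x | g <- enum_fset U]); last first.
  move=> g; transitivity (g - x \in U); first exact: mem_fshift.
  apply/idP/mapP => [gU|[h hU ->]]; last by rewrite addrK.
  by exists (g - x); rewrite ?subrK.
rewrite -[in LHS](fshift0 x) -map_comp.
rewrite (eq_map (g := fshift x \o (fun g => [fset g]))); last first.
  by move=> g /=; rewrite fshift1.
by rewrite map_comp nabs_fshift; apply: eq_nabs => V.
Qed.

Lemma cm_dual q : completely_monotone q -> completely_monotone (dual q).
Proof.
(* This is the law of containing [U] and at least one member of [As]: either [A] is contained, or it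
   is not and a later member is. *)
have hd As w : completely_monotone w ->
    completely_monotone (fun U => w U - nabs As w U).
  elim: As w => [|A As IH] w cw /=.
    by apply: cm_ext (cmZ (lexx 0) cm1) => U; rewrite mul0r subrr.
  have := cmD (cm_setU A cw) (IH _ (cm_nab A cw)).
  by apply: cm_ext => U; rewrite /nab; ring.
(* By [dualU], [nab A (dual q)] is the dual of [q] minus its difference along the singletons of [A].
   That function is completely monotone by [hd], so the induction hypothesis applies to it. *)
move=> + As; elim: As q => [|A As IH] q cq U /=; first exact: cq.
have /IH/(_ U) := hd [seq [fset g] | g <- enum_fset A] q cq.
by congr (0 <= _); apply: eq_nabs => V; rewrite /nab dualU -nabsB.
Qed.

(** * Union bounds for hitting probabilities *)

Section Normalized.
Variable v : {fset int} -> R.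
Hypotheses (cv : completely_monotone v) (v0 : v fset0 = 1).

Lemma cm_le1 U : v U <= 1.
Proof. by rewrite -v0 -[U]fsetU0; exact: cm_le. Qed.

(* If a random set is disjoint from [U] with probability [v U], then it meets
   both [U] and [V] with this probability. *)
Definition hit2 U V := 1 - v U - v V + v (U `|` V).

Lemma hit2C U V : hit2 U V = hit2 V U.
Proof. by rewrite /hit2 fsetUC; ring. Qed.

Lemma hit2_ge0 U V : 0 <= hit2 U V.
Proof.
have := cv [:: U; V] fset0.
by rewrite /= /nab !fsetU0 v0 /hit2; congr (0 <= _); ring.
Qed.

Lemma hit2_fset0 V : hit2 fset0 V = 0.
Proof. by rewrite /hit2 v0 fset0U; ring. Qed.

(** The defect is a third difference at [fset0], the probability of meeting all of [A], [U] and
    [V]. *)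
Lemma hit2Ul A U V : hit2 (A `|` U) V <= hit2 A V + hit2 U V.
Proof.
rewrite -subr_ge0; have := cv [:: A; U; V] fset0.
rewrite /= /nab !fsetU0 v0 /hit2 -fsetUA; congr (0 <= _).
ring.
Qed.

Lemma fset_ind (P : {fset int} -> Prop) : P fset0 ->
  (forall g U, g \notin U -> P U -> P (g |` U)) -> forall U, P U.
Proof.
move=> P0 PU U; have [n] := ubnP #|` U|; elim: n U => // n IH U.
have [->//|[g gU]] := fset_0Vmem U; rewrite (cardfsD1 g) gU ltnS => Un.
rewrite -(fsetD1K gU); apply: PU; last exact: IH.
by rewrite !inE eqxx.
Qed.

Lemma hit2_sum U V :
  hit2 U V <= \sum_(g <- U) \sum_(h <- V) hit2 [fset g] [fset h].
Proof.
have sub1 W g : hit2 [fset g] W <= \sum_(h <- W) hit2 [fset g] [fset h].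
  elim/fset_ind: W => [|h W hW IH]; first by rewrite hit2C hit2_fset0 sumr_ge0// => *; exact: hit2_ge0.
  rewrite big_fsetU1//= hit2C (le_trans (hit2Ul _ _ _))// lerD//; first by rewrite hit2C.
  by rewrite hit2C.
elim/fset_ind: U => [|g U gU IH].
  by rewrite hit2_fset0 sumr_ge0// => g _; rewrite sumr_ge0// => *; exact: hit2_ge0.
by rewrite big_fsetU1//= (le_trans (hit2Ul _ _ _))// lerD.
Qed.

Lemma hit1_sum U : 1 - v U <= \sum_(g <- U) (1 - v [fset g]).
Proof.
elim/fset_ind: U => [|g U gU IH].
  by rewrite v0 subrr sumr_ge0// => g _; rewrite subr_ge0 cm_le1.
rewrite big_fsetU1//=; have := hit2_ge0 [fset g] U; rewrite /hit2; lra.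
Qed.

(** Two events have the same covariance as their complements, here the events of meeting [U] and of
    meeting [V]; these are rare when the random set is sparse. *)
Lemma decorrelation U V :
  `|v (U `|` V) - v U * v V| <= hit2 U V + (1 - v U) * (1 - v V).
Proof.
have -> : v (U `|` V) - v U * v V = hit2 U V - (1 - v U) * (1 - v V).
  by rewrite /hit2; ring.
rewrite (le_trans (ler_normB _ _))// !ger0_norm ?hit2_ge0//.
by rewrite mulr_ge0// subr_ge0 cm_le1.
Qed.

End Normalized.

(** [K] will be the number of copies; it is balanced by a difference of the order of the density of
    one copy. *)
Lemma ler_normX_B (a b : R) K : 0 <= a <= 1 -> 0 <= b <= 1 ->
  `|a ^+ K - b ^+ K| <= K%:R * `|a - b|.
Proof.
move=> a01 b01; elim: K => [|K IH]; first by rewrite !expr0 subrr normr0 mul0r.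
have -> : a ^+ K.+1 - b ^+ K.+1 = a * (a ^+ K - b ^+ K) + (a - b) * b ^+ K.
  by rewrite !exprS; ring.
rewrite -natr1 [(_ + 1) * _]mulrDl mul1r (le_trans (ler_normD _ _))//.
rewrite lerD// normrM.
  rewrite (le_trans _ IH)// ler_piMl// ger0_norm; by case/andP: a01.
rewrite ler_piMr// ger0_norm ?exprn_ge0 ?exprn_ile1//; by case/andP: b01.
Qed.

End CompleteMonotonicity.

(** * Ultrafilter limits and averages over the integers *)

Section UltraLimit.
Variable (R : realType).

(** Limits along [G] exist for all bounded sequences at once and respect sums, products and order.
    They replace the weak compactness of the space of laws, and also provide an invariant mean. *)
Lemma nat_ultrafilter : exists G : set_system nat, UltraFilter G /\ (\oo `<=` G)%classic.
Proof. exact: ultraFilterLemma. Qed.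

Variables (G : set_system nat) (UG : UltraFilter G) (ooG : (\oo `<=` G)%classic).
Let PG : ProperFilter G. Proof. exact: ultra_proper. Qed.
#[local] Existing Instance PG.

Definition bounded_seq (I : Type) (u : I -> R) := exists B : R, forall n, `|u n| <= B.

Definition ulim (u : nat -> R) : R := lim (u @ G).

Lemma ulimP (u : nat -> R) : bounded_seq u -> u @ G --> ulim u.
Proof.
move=> [B uB].
suff : exists l : R, u @ G --> l by move=> [l ul]; exact: cvgP ul.
have GB : (u @ G) [set` `[- B, B]].
  by apply: (@filterS _ G _ setT) filterT => n _; rewrite /= in_itv/= -ler_norml.
(* A cluster point of an ultrafilter is a limit: otherwise the complement of some ball around it
   would belong to the ultrafilter. *)
have [l [_ cl]] := @segment_compact R (- B) B (u @ G) _ GB.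
exists l; apply/cvgrPdist_lt => e e0.
have [//|Gc] := in_ultra_setVsetC [set n | `|l - u n| < e] UG.
have FA : (u @ G) (u @` ~` [set n | `|l - u n| < e])%classic.
  by apply: (@filterS _ G) Gc => n ne; exists n.
have [x [[n /= nlt <-] xl]] := cl _ _ FA (nbhsx_ballx l e e0).
by case: (nlt xl).
Qed.

Lemma cvg_ulim (u : nat -> R) l : u @ \oo --> l -> ulim u = l.
Proof. by move=> ul; apply/cvg_lim => //; apply: cvg_trans ul; apply: cvg_app. Qed.

Lemma ulim_cst (c : R) : ulim (fun=> c) = c.
Proof. by apply: cvg_ulim; exact: cvg_cst. Qed.

Lemma ulimD u w : bounded_seq u -> bounded_seq w ->
  ulim (fun n => u n + w n) = ulim u + ulim w.
Proof. by move=> /ulimP bu /ulimP bw; apply/cvg_lim => //; exact: cvgD. Qed.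

Lemma ulimZ c u : bounded_seq u -> ulim (fun n => c * u n) = c * ulim u.
Proof. by move=> /ulimP bu; apply/cvg_lim => //; exact: cvgMl_tmp. Qed.

Lemma ulimM u w : bounded_seq u -> bounded_seq w ->
  ulim (fun n => u n * w n) = ulim u * ulim w.
Proof. by move=> /ulimP bu /ulimP bw; apply/cvg_lim => //; exact: cvgM. Qed.

Lemma ulim_norm u : bounded_seq u -> ulim (fun n => `|u n|) = `|ulim u|.
Proof. by move=> /ulimP bu; apply/cvg_lim => //; exact: cvg_norm. Qed.

Lemma ulim_le u w : bounded_seq u -> bounded_seq w -> (\forall n \near \oo, u n <= w n) ->
  ulim u <= ulim w.
Proof.
move=> /ulimP bu /ulimP bw uw; apply: ler_lim; [exact: cvgP bu|exact: cvgP bw|].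
exact: ooG.
Qed.

End UltraLimit.

Section Boundedness.
Variable (R : realType) (I : Type).
Implicit Types u w : I -> R.

Lemma bseq_cst (c : R) : bounded_seq (fun _ : I => c).
Proof. by exists `|c|. Qed.

Lemma bseqD u w : bounded_seq u -> bounded_seq w -> bounded_seq (fun n => u n + w n).
Proof.
move=> [B uB] [C wC]; exists (B + C) => n.
by rewrite (le_trans (ler_normD _ _))// lerD.
Qed.

Lemma bseqM u w : bounded_seq u -> bounded_seq w -> bounded_seq (fun n => u n * w n).
Proof. by move=> [B uB] [C wC]; exists (B * C) => n; rewrite normrM ler_pM. Qed.

Lemma bseqZ c u : bounded_seq u -> bounded_seq (fun n => c * u n).
Proof. by move=> [B uB]; exists (`|c| * B) => n; rewrite normrM ler_wpM2l. Qed.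

Lemma bseqB u w : bounded_seq u -> bounded_seq w -> bounded_seq (fun n => u n - w n).
Proof.
move=> [B uB] [C wC]; exists (B + C) => n.
by rewrite (le_trans (ler_normB _ _))// lerD.
Qed.

Lemma bseq01 u : (forall n, 0 <= u n <= 1) -> bounded_seq u.
Proof. by move=> u01; exists 1 => n; case/andP: (u01 n) => ? ?; rewrite ger0_norm. Qed.

Lemma bseq_norm u : bounded_seq u -> bounded_seq (fun n => `|u n|).
Proof. by move=> [B uB]; exists B => n; rewrite normr_id. Qed.

Lemma bseq_comp (J : Type) (f : J -> I) u : bounded_seq u -> bounded_seq (u \o f).
Proof. by move=> [B uB]; exists B => n /=. Qed.

End Boundedness.

(** * Averages over Folner sets and their asymptotic invariance *)

Section FolnerAverage.
Variable (R : realType).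
Implicit Types (u : int -> R) (P : {fset int}).

Definition favg P u : R := #|` P|%:R^-1 * \sum_(g <- P) u g.

Lemma favgD P u w : favg P (fun g => u g + w g) = favg P u + favg P w.
Proof. by rewrite /favg big_split/= mulrDr. Qed.

Lemma favgZ P c u : favg P (fun g => c * u g) = c * favg P u.
Proof. by rewrite /favg -mulr_sumr mulrCA. Qed.

Lemma favg_sum P (J : Type) (s : seq J) (F : J -> int -> R) :
  favg P (fun g => \sum_(j <- s) F j g) = \sum_(j <- s) favg P (F j).
Proof. by rewrite /favg exchange_big/= mulr_sumr. Qed.

Lemma le_favg P u w : (forall g, u g <= w g) -> favg P u <= favg P w.
Proof. by move=> uw; rewrite /favg ler_wpM2l ?invr_ge0// ler_sum. Qed.

Lemma favg_cst P c : P != fset0 -> favg P (fun=> c) = c.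
Proof.
move=> P0; rewrite /favg big_const_seq count_predT iter_addr_0 -[c *+ _]mulr_natl mulrA.
by rewrite mulVf ?mul1r// pnatr_eq0 cardfs_eq0.
Qed.

Lemma favg_ge0 P u : (forall g, 0 <= u g) -> 0 <= favg P u.
Proof. by move=> u0; rewrite /favg mulr_ge0 ?invr_ge0 ?sumr_ge0. Qed.

Lemma favg_norm P u B : P != fset0 -> (forall g, `|u g| <= B) -> `|favg P u| <= B.
Proof.
move=> P0 uB; rewrite -(favg_cst B P0) /favg normrM ger0_norm ?invr_ge0//.
by rewrite ler_wpM2l ?invr_ge0// (le_trans (ler_norm_sum _ _ _))// ler_sum.
Qed.

Lemma favg_fshift P u x :
  favg P (fun g => u (g + x)) = #|` P|%:R^-1 * \sum_(g <- fshift x P) u g.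
Proof.
rewrite /favg; congr (_ * _).
by rewrite /fshift big_imfset//= => g h _ _; apply: addIr.
Qed.

Lemma sum_fset_indic (W D : {fset int}) u : (D `<=` W)%fset ->
  \sum_(g <- D) u g = \sum_(g <- W) (g \in D)%:R * u g.
Proof.
move=> DW; rewrite -(big_fset_incl _ DW) => [|g _ gD]; last first.
  by rewrite (negbTE gD) mul0r.
by apply: eq_big_seq => g gD; rewrite gD mul1r.
Qed.

Lemma sum_symdiff (S P : {fset int}) u B : (forall g, `|u g| <= B) ->
  `|\sum_(g <- S) u g - \sum_(g <- P) u g| <=
  B * #|` (S `\` P) `|` (P `\` S)|%:R.
Proof.
move=> uB; set D := (S `\` P) `|` _; set W := (S `|` P)%fset.
have -> : B * #|` D|%:R = \sum_(g <- D) B.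
  by rewrite big_const_seq count_predT iter_addr_0 mulr_natr.
rewrite (@sum_fset_indic W S) ?fsubsetUl// (@sum_fset_indic W P) ?fsubsetUr//.
rewrite (@sum_fset_indic W D); last first.
  by apply/fsubsetP => g; rewrite !inE => /orP[] /andP[_ ->]; rewrite ?orbT.
rewrite -sumrB (le_trans (ler_norm_sum _ _ _))// ler_sum// => g _.
rewrite -mulrBl normrM !inE; case: (g \in S); case: (g \in P) => /=;
  rewrite ?subrr ?subr0 ?sub0r ?normrN ?normr0 ?normr1 ?mul0r ?mul1r//.
Qed.

Lemma favg_shift_cvg (Phi : nat -> {fset int}) u x : Folner R Phi -> bounded_seq u ->
  (favg (Phi N) (fun g => u (g + x)) - favg (Phi N) u) @[N --> \oo] --> (0 : R).
Proof.
move=> [Phi0 /(_ x)/= PhiF] [B uB].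
apply: norm_cvg0.
apply: (@squeeze_cvgr _ _ _ _ (fun=> 0)); [|exact: cvg_cst|]; last first.
  by rewrite -(mulr0 B); apply: cvgMl_tmp; exact: PhiF.
apply: nearW => N; rewrite normr_ge0/= favg_fshift {1}/favg -mulrBr normrM.
rewrite ger0_norm ?invr_ge0// [leRHS]mulrA [leRHS]mulrC ler_wpM2l ?invr_ge0//.
exact: sum_symdiff.
Qed.

Definition fitv (N : nat) : {fset int} := [fset Posz k | k in iota 0 N.+1].

Lemma mem_fitv N g : (g \in fitv N) = (0 <= g <= N%:Z)%R.
Proof.
apply/imfsetP/idP => [[/= k + ->]|]; first by rewrite -[_ :: _]/(iota 0 N.+1) mem_iota; lia.
by case: g => // k kN; exists k => //=; rewrite -[_ :: _]/(iota 0 N.+1) mem_iota; lia.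
Qed.

Lemma card_fitv N : #|` fitv N| = N.+1.
Proof.
rewrite card_imfset; last by move=> ? ? [].
by rewrite -[enum_finmem _]/(undup (iota 0 N.+1)) undup_id ?iota_uniq ?size_iota.
Qed.

Lemma fset_itv_card (a : int) (n : nat) (D : {fset int}) :
  (forall g, g \in D -> (a <= g < a + n%:Z)%R) -> (#|` D| <= n)%N.
Proof.
move=> Da; pose f (g : int) := `|g - a|%N.
have <- : size [seq f g | g <- enum_fset D] = #|` D| by rewrite size_map.
rewrite -[n in (_ <= n)%N](size_iota 0); apply: uniq_leq_size.
  rewrite map_inj_in_uniq ?fset_uniq// => g h /Da gD /Da hD; rewrite /f; lia.
move=> k /mapP[g /Da gD ->]; rewrite mem_iota /f; lia.
Qed.

Lemma Folner_fitv : Folner R fitv.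
Proof.
split=> [N|x]; first by rewrite -cardfs_eq0 card_fitv.
(* Each half of the symmetric difference lies in an interval of [|x|] consecutive integers. *)
pose c := (`|x| + `|x|)%N.
apply: (@squeeze_cvgr _ _ _ _ (fun=> 0) (fun N => c%:R * N.+1%:R^-1)).
- apply: nearW => N; rewrite card_fitv divr_ge0//= ler_wpM2r ?invr_ge0// ler_nat.
  rewrite (leq_trans (leq_card_fsetU _ _))// leq_add//.
    have [x0|x0] := leP 0%R x.
      apply: (@fset_itv_card N.+1%:Z) => g; rewrite !inE mem_fshift !mem_fitv; lia.
    apply: (@fset_itv_card x) => g; rewrite !inE mem_fshift !mem_fitv; lia.
  have [x0|x0] := leP 0%R x.
    apply: (@fset_itv_card 0) => g; rewrite !inE mem_fshift !mem_fitv; lia.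
  apply: (@fset_itv_card (N.+1%:Z + x)%R) => g; rewrite !inE mem_fshift !mem_fitv; lia.
- exact: cvg_cst.
- rewrite -[X in _ --> X](mulr0 c%:R); apply: cvgMl_tmp.
  exact: (@cvg_harmonic R).
Qed.

(* A sequence with [x (g + 1) + x (g - 1) = 2 c x g] and [c != 1], for instance
   [x g = cos (g t)], has mean zero. *)
Lemma favg_cos_cvg (Phi : nat -> {fset int}) u c : Folner R Phi -> bounded_seq u ->
  c != 1 -> (forall g, u (g + 1) + u (g - 1) = 2 * c * u g) ->
  favg (Phi N) u @[N --> \oo] --> (0 : R).
Proof.
move=> FPhi bu c1 uc.
have h1 := favg_shift_cvg 1 FPhi bu; have h2 := favg_shift_cvg (-1) FPhi bu.
set d1 := (fun N => _) in h1; set d2 := (fun N => _) in h2.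
have : (2 * c - 2)^-1 * (d1 N + d2 N) @[N --> \oo] --> (2 * c - 2)^-1 * (0 + 0).
  by apply: cvgMl_tmp; exact: cvgD.
rewrite addr0 mulr0; suff -> : (fun N => favg (Phi N) u) =
  (fun N => (2 * c - 2)^-1 * (d1 N + d2 N)) by [].
apply/funext => N; rewrite /d1 /d2.
rewrite addrACA -favgD (_ : (fun g => _) = fun g => 2 * c * u g); last exact/funext.
rewrite favgZ; field.
by rewrite -[X in _ - X]mulr1 -mulrBr mulf_neq0// subr_eq0.
Qed.
End FolnerAverage.

(** * A shift-invariant mean on bounded functions of an integer *)

Section InvariantMean.
Variables (R : realType) (G : set_system nat) (UG : UltraFilter G).
Hypothesis ooG : (\oo `<=` G)%classic.
Implicit Types u w : int -> R.

Lemma nab_bounded (I : Type) (F : I -> {fset int} -> R) A :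
  (forall U, bounded_seq (F^~ U)) -> forall U, bounded_seq (fun n => nab A (F n) U).
Proof.
by move=> bF U; exact: bseqB (bF U) (bF _).
Qed.

Lemma ulimB (u w : nat -> R) : bounded_seq u -> bounded_seq w ->
  ulim G (fun n => u n - w n) = ulim G u - ulim G w.
Proof.
move=> bu bw; rewrite -[in RHS]mulN1r -ulimZ// -ulimD//; last first.
  exact: bseqZ.
by congr ulim; apply/funext => n; rewrite mulN1r.
Qed.

Lemma cm_ulim (F : nat -> {fset int} -> R) : (forall n, completely_monotone (F n)) ->
  (forall U, bounded_seq (F^~ U)) ->
  completely_monotone (fun U => ulim G (F^~ U)).
Proof.
move=> cF bF As U; elim: As F cF bF U => [|A As IH] F cF bF U /=.
  rewrite -(ulim_cst UG ooG 0); apply: ulim_le => //; first exact: bseq_cst.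
  by apply: nearW => n; exact: cm_ge0.
have := IH (fun n => nab A (F n)) (fun n => cm_nab A (cF n)) (nab_bounded A bF) U.
by congr (0 <= _); apply: eq_nabs => V; rewrite /nab ulimB.
Qed.

(** This mean takes the place of the integral over a uniformly distributed starting point of the
    rotation. *)
Definition zmean u := ulim G (fun N => favg (fitv N) u).

Lemma fitv_neq0 N : fitv N != fset0.
Proof. by case: (Folner_fitv R). Qed.

Lemma favg_bounded u : bounded_seq u -> bounded_seq (fun N => favg (fitv N) u).
Proof. by move=> [B uB]; exists B => N; apply: favg_norm => //; exact: fitv_neq0. Qed.

Lemma zmean_cst c : zmean (fun=> c) = c.
Proof.
rewrite -[RHS](ulim_cst UG ooG); congr ulim; apply/funext => N.
exact: favg_cst (fitv_neq0 N).
Qed.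

Lemma zmeanD u w : bounded_seq u -> bounded_seq w ->
  zmean (fun n => u n + w n) = zmean u + zmean w.
Proof.
move=> bu bw; rewrite -ulimD//; try exact: favg_bounded.
by congr ulim; apply/funext => N; rewrite favgD.
Qed.

Lemma zmeanZ c u : bounded_seq u -> zmean (fun n => c * u n) = c * zmean u.
Proof.
move=> bu; rewrite -ulimZ//; last exact: favg_bounded.
by congr ulim; apply/funext => N; rewrite favgZ.
Qed.

Lemma le_zmean u w : bounded_seq u -> bounded_seq w -> (forall g, u g <= w g) ->
  zmean u <= zmean w.
Proof.
move=> bu bw uw; apply: ulim_le => //; try exact: favg_bounded.
by apply: nearW => N; exact: le_favg.
Qed.

Lemma zmean_shift u x : bounded_seq u -> zmean (fun g => u (g + x)) = zmean u.
Proof.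
move=> bu; apply/eqP; rewrite -subr_eq0 -ulimB//; try exact: favg_bounded.
  apply/eqP; apply: cvg_ulim => //; exact: favg_shift_cvg (Folner_fitv R) bu.
by apply: favg_bounded; exact: bseq_comp bu.
Qed.

Lemma zmean0 u : favg (fitv N) u @[N --> \oo] --> (0 : R) -> zmean u = 0.
Proof. exact: cvg_ulim. Qed.

Lemma cm_zmean (F : int -> {fset int} -> R) : (forall k, completely_monotone (F k)) ->
  (forall U, bounded_seq (F^~ U)) -> completely_monotone (fun U => zmean (F^~ U)).
Proof.
move=> cF bF; apply: (@cm_ulim (fun N U => favg (fitv N) (F^~ U))).
  by move=> N; apply: cmZ; [rewrite invr_ge0|exact: cm_sum].
by move=> U; exact: favg_bounded.
Qed.

End InvariantMean.

(** * The random set of a rotation *)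

Section CosineMean.
Variable R : realType.

Lemma bseq_cos (I : Type) (f : I -> R) : bounded_seq (fun i => cos (f i)).
Proof. by exists 1 => i; exact: cos_max. Qed.

Lemma cos_favg_cvg (Phi : nat -> {fset int}) (t s : R) : Folner R Phi -> cos t != 1 ->
  favg (Phi N) (fun g => cos (g%:~R * t + s)) @[N --> \oo] --> (0 : R).
Proof.
move=> FPhi t1; apply: (favg_cos_cvg FPhi (bseq_cos _) t1) => g.
have -> : (g + 1)%:~R * t + s = g%:~R * t + s + t by rewrite rmorphD/=; ring.
have -> : (g - 1)%:~R * t + s = g%:~R * t + s - t by rewrite rmorphB/=; ring.
by rewrite cosD cosB; ring.
Qed.

Lemma cosB_sin (a b : R) : cos (a - b) - cos (a + b) = 2 * sin a * sin b.
Proof. by rewrite cosB cosD; ring. Qed.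

Lemma cos_half (x : R) : cos x = 1 - 2 * sin (x / 2) ^+ 2.
Proof.
rewrite -[in LHS](_ : (x / 2) *+ 2 = x); last by field.
by rewrite cos_mulr2n cos2sin2; ring.
Qed.

Section Factor.
Variables (G : set_system nat) (UG : UltraFilter G).
Hypothesis ooG : (\oo `<=` G)%classic.
Variables (e t : R).
Hypotheses (e01 : 0 <= e <= 1) (t1 : cos t != 1) (t2 : cos (t *+ 2) != 1).

Definition dip (k : int) : R := 1 - e * ((1 - cos (k%:~R * t)) / 2).

Lemma dip01 k : 0 <= dip k <= 1.
Proof.
have := cos_le1 (k%:~R * t); have := cos_geN1 (k%:~R * t).
move: e01 => /andP[? ?] ? ?; rewrite /dip; apply/andP; split; nra.
Qed.

(* The probability that [U] is contained in the random set of the [g] with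
   [u <= dip (g + k)], where [u] is uniform on [[0, 1]] and [k] is a random integer. *)
Definition dip_law (U : {fset int}) : R :=
  zmean G (fun k => fsetmin (fun g => dip (g + k)) U).

Lemma fsetmin_dip01 k U : 0 <= fsetmin (fun g => dip (g + k)) U <= 1.
Proof.
by rewrite fsetmin_le1 fsetmin_ge0// => g; case/andP: (dip01 (g + k)).
Qed.

Lemma cm_dip_law : completely_monotone dip_law.
Proof.
apply: (@cm_zmean _ _ _ _ (fun k => fsetmin (fun g => dip (g + k)))) => //.
  by move=> k; apply: cm_fsetmin => g; case/andP: (dip01 (g + k)).
by move=> U; apply: bseq01 => k; exact: fsetmin_dip01.
Qed.

Lemma dip_law0 : dip_law fset0 = 1.
Proof.
rewrite -[RHS](zmean_cst UG ooG); congr zmean; apply/funext => k.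
by rewrite fsetmin0.
Qed.

Lemma dip_law_shift : shift_invariant dip_law.
Proof.
move=> x U; rewrite -[RHS](@zmean_shift _ _ UG _ _ x)//.
  congr zmean; apply/funext => k; rewrite fsetmin_shift; congr fsetmin.
  by apply/funext => g; rewrite -addrA [x + k]addrC.
by apply: bseq01 => k; exact: fsetmin_dip01.
Qed.

Lemma zmean_dip : zmean G dip = 1 - e / 2.
Proof.
have -> : dip = fun k => (1 - e / 2) + e / 2 * cos (k%:~R * t + 0).
  by apply/funext => k; rewrite /dip addr0; field.
rewrite zmeanD//; [|exact: bseq_cst|exact: bseqZ (bseq_cos _)].
rewrite zmeanZ ?zmean_cst//; last exact: bseq_cos.
rewrite zmean0// ?mulr0 ?addr0//; apply: cos_favg_cvg => //; exact: Folner_fitv.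
Qed.

Lemma dip_law1 : dip_law [fset 0] = 1 - e / 2.
Proof.
rewrite -zmean_dip; congr zmean; apply/funext => k.
rewrite fsetmin1 ?add0r//; by case/andP: (dip01 k).
Qed.

Let bseq_dip : bounded_seq dip.
Proof. apply: bseq01; exact: dip01. Qed.

Let bseq_dipD g : bounded_seq (fun k => dip (k + g)).
Proof. exact: (bseq_comp (fun k => k + g) bseq_dip). Qed.

(** This is [min x y = (x + y) / 2 - |x - y| / 2], together with the invariance of the mean. *)
Lemma dip_law2E g :
  dip_law [fset 0; g] = 1 - e / 2 - zmean G (fun k => `|dip k - dip (k + g)|) / 2.
Proof.
have bn : bounded_seq (fun k => `|dip k - dip (k + g)|).
  apply: bseq_norm; apply: bseqD => //.
  by have [B hB] := bseq_dipD g; exists B => k; rewrite normrN.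
have {1}-> : 1 - e / 2 = 2^-1 * (zmean G dip + zmean G (fun k => dip (k + g))).
  by rewrite zmean_shift// zmean_dip; field.
rewrite [X in _ - X](_ : _ = - (- 2^-1 * zmean G (fun k => `|dip k - dip (k + g)|))); last ring.
rewrite opprK -zmeanD// -!zmeanZ//; last exact: bseqD.
rewrite -zmeanD//; last 2 first.
- exact/bseqZ/bseqD.
- exact: bseqZ.
congr zmean; apply/funext => k.
have dip_le1 h : dip h <= 1 by case/andP: (dip01 h).
rewrite fsetminU !fsetmin1 ?add0r//.
rewrite (addrC g k); case: leP => [h|h]; first by rewrite ler0_norm; [field|lra].
by rewrite ger0_norm; [field|lra].
Qed.

Lemma dipB k g : dip k - dip (k + g) =
  e * sin (k%:~R * t + g%:~R * t / 2) * sin (g%:~R * t / 2).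
Proof.
set b := g%:~R * t / 2; set a := k%:~R * t + b.
have -> : dip k - dip (k + g) = e / 2 * (cos (k%:~R * t) - cos ((k + g)%:~R * t)).
  by rewrite /dip; field.
have -> : k%:~R * t = a - b by rewrite /a addrK.
have -> : (k + g)%:~R * t = a + b by rewrite /a /b rmorphD/=; field.
by rewrite cosB_sin; field.
Qed.

Let bseq_dipB g : bounded_seq (fun k => `|dip k - dip (k + g)|).
Proof. exact/bseq_norm/bseqB. Qed.

Lemma dip_law2_ge g : (1 - e / 2) * (1 - e * `|sin (g%:~R * t / 2)|) <= dip_law [fset 0; g].
Proof.
rewrite dip_law2E; set S := `|sin _|.
have : zmean G (fun k => `|dip k - dip (k + g)|) <= e * S.
  rewrite -(zmean_cst UG ooG (e * S)); apply: le_zmean => //; first exact: bseq_cst.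
  move=> k; rewrite dipB !normrM ler_wpM2r// ger0_norm; last by case/andP: e01.
  by rewrite ler_piMr ?sin_max//; case/andP: e01.
(* As [e <= 1], the factor 1/2 of [dip_law2E] is at most [1 - e / 2], which lets the bound
   factor. *)
have : 0 <= e * S * (1 - e).
  by move: e01 => /andP[? ?]; rewrite !mulr_ge0 ?normr_ge0// subr_ge0.
nra.
Qed.

(** Since [|sin|] is at least its square, [dipB] reduces the bound to the mean of a squared sine,
    which is 1/2 because [cos (t *+ 2) != 1]. The resulting [1 - cos] has an explicit second moment
    over Folner sets, as [return_rate_folner] requires. *)
Lemma dip_law2_le g :
  dip_law [fset 0; g] <= (1 - e / 2) * (1 - e / 8 * (1 - cos (g%:~R * t))).
Proof.
rewrite dip_law2E.
have : e / 4 * (1 - cos (g%:~R * t)) <= zmean G (fun k => `|dip k - dip (k + g)|).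
  have -> : e / 4 * (1 - cos (g%:~R * t)) = zmean G (fun k =>
      e / 4 * (1 - cos (g%:~R * t)) + - (e / 4 * (1 - cos (g%:~R * t))) *
        cos (k%:~R * (t *+ 2) + g%:~R * t)).
    rewrite zmeanD//; [|exact: bseq_cst|exact: bseqZ (bseq_cos _)].
    rewrite zmean_cst// zmeanZ//; last exact: bseq_cos.
    rewrite zmean0// ?mulr0 ?addr0//; apply: cos_favg_cvg => //; exact: Folner_fitv.
  apply: le_zmean => //.
    by apply: bseqD; [exact: bseq_cst|exact: bseqZ (bseq_cos _)].
  move=> k; rewrite dipB; set a := k%:~R * t + _; set b := g%:~R * t / 2.
  have -> : k%:~R * (t *+ 2) + g%:~R * t = a *+ 2 by rewrite /a /b; field.
  rewrite (cos_half (g%:~R * t)) -/b cos_mulr2n cos2sin2 !normrM.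
  have -> : e / 4 * (1 - (1 - 2 * sin b ^+ 2)) + - (e / 4 * (1 - (1 - 2 * sin b ^+ 2))) *
     ((1 - sin a ^+ 2) *+ 2 - 1) = e * (`|sin a| ^+ 2 * `|sin b| ^+ 2).
    by rewrite !real_normK ?num_real//; field.
  have e0 : 0 <= e by case/andP: e01.
  rewrite [X in _ <= X * _ * _]ger0_norm// -mulrA ler_wpM2l//.
  by rewrite !expr2; apply: ler_pM; rewrite ?mulr_ge0// ler_piMr ?sin_max.
have : 0 <= e * (1 - cos (g%:~R * t)) * e.
  by move: e01 => /andP[? ?]; rewrite !mulr_ge0// subr_ge0 cos_le1.
nra.
Qed.

End Factor.
End CosineMean.

(** * The limit process *)

Section ProductBounds.
Variables (R : realFieldType) (I : Type).
Implicit Types (s : seq I) (x : I -> R).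

Lemma prod_itv01 s x : (forall i, 0 <= x i <= 1) -> 0 <= \prod_(i <- s) x i <= 1.
Proof.
move=> x01; elim: s => [|i s /andP[? ?]]; first by rewrite big_nil ler01 lexx.
by rewrite big_cons; case/andP: (x01 i) => ? ?; rewrite mulr_ge0// mulr_ile1.
Qed.

Lemma prod_1B_le s x : (forall i, 0 <= x i <= 1) ->
  (\prod_(i <- s) (1 - x i)) * (1 + \sum_(i <- s) x i) <= 1.
Proof.
move=> x01; elim: s => [|i s IH]; first by rewrite !big_nil mul1r addr0.
rewrite !big_cons.
have /andP[p0 p1] : 0 <= \prod_(i <- s) (1 - x i) <= 1.
  by apply: prod_itv01 => j; case/andP: (x01 j) => ? ?; apply/andP; split; lra.
have S0 : 0 <= \sum_(i <- s) x i by apply: sumr_ge0 => j _; case/andP: (x01 j).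
case/andP: (x01 i) => xi0 xi1.
set p := \prod_(i <- s) _ in p0 p1 IH *; set S := \sum_(i <- s) _ in S0 IH *.
have : 0 <= p * x i * (x i + S) by rewrite !mulr_ge0// addr_ge0.
nra.
Qed.

Lemma prod_1B_ge s x : (forall i, 0 <= x i <= 1) ->
  1 - \sum_(i <- s) x i <= \prod_(i <- s) (1 - x i).
Proof.
move=> x01; elim: s => [|i s IH]; first by rewrite !big_nil subr0.
rewrite !big_cons.
have /andP[p0 p1] : 0 <= \prod_(i <- s) (1 - x i) <= 1.
  by apply: prod_itv01 => j; case/andP: (x01 j) => ? ?; apply/andP; split; lra.
case/andP: (x01 i) => xi0 xi1; nra.
Qed.

End ProductBounds.

Section Bernoulli.
Variable (R : realFieldType).

Lemma bernoulli_ge (x : R) K : 0 <= x <= 1 -> 1 - K%:R * x <= (1 - x) ^+ K.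
Proof.
move=> x01; have := @prod_1B_ge R _ (nseq K tt) (fun=> x) (fun=> x01).
by rewrite !big_const_seq count_predT size_nseq iter_addr_0 iter_mulr_1 mulr_natl.
Qed.

Lemma bernoulli_le (x : R) K : 0 <= x <= 1 -> (1 - x) ^+ K * (1 + K%:R * x) <= 1.
Proof.
move=> x01; have := @prod_1B_le R _ (nseq K tt) (fun=> x) (fun=> x01).
by rewrite !big_const_seq count_predT size_nseq iter_addr_0 iter_mulr_1 mulr_natl.
Qed.

End Bernoulli.

(** * The approximating random sets, their superposition and the limit law *)

Section Process.
Variables (R : realType) (e t : nat -> R).
Hypotheses (e01 : forall j, 0 <= e j <= 1)
  (e_div : forall M, exists J, M <= \sum_(j <- iota 0 J) e j)
  (tD : forall i j, cos (t i + t j) != 1)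
  (tB : forall i j, i != j -> cos (t i - t j) != 1).
Variables (G : set_system nat) (UG : UltraFilter G).
Hypothesis ooG : (\oo `<=` G)%classic.

Let t2 j : cos (t j *+ 2) != 1. Proof. by rewrite mulr2n. Qed.

Let t1 j : cos (t j) != 1.
Proof.
apply: contra_neq (t2 j) => tj; rewrite cos_mulr2n tj; ring.
Qed.

Let fac j := dip_law G (e j) (t j).

Definition joint J (U : {fset int}) := \prod_(j <- iota 0 J) fac j U.

(* The probability that [g] belongs to the random set of law [joint J], given that
   [0] does. *)
Definition return_rate J g := \prod_(j <- iota 0 J) (fac j [fset 0; g] / fac j [fset 0]).

Let fac1 j : fac j [fset 0] = 1 - e j / 2.
Proof. exact: dip_law1. Qed.

Let cm_fac j : completely_monotone (fac j).
Proof. exact: cm_dip_law. Qed.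

Let fac1_gt0 j : 0 < 1 - e j / 2.
Proof. by case/andP: (e01 j) => ? ?; lra. Qed.

Lemma cm_joint J : completely_monotone (joint J).
Proof. by apply: cm_prod => j; exact: cm_dip_law. Qed.

Lemma joint0 J : joint J fset0 = 1.
Proof. by rewrite /joint big1// => j _; exact: dip_law0. Qed.

Lemma joint_shift J : shift_invariant (joint J).
Proof. by move=> x U; apply: eq_bigr => j _; exact: dip_law_shift. Qed.

Lemma joint1 J g : joint J [fset g] = joint J [fset 0].
Proof. by rewrite -(joint_shift J g [fset 0]) fshift1 add0r. Qed.

Lemma joint1_gt0 J : 0 < joint J [fset 0].
Proof. by apply: prodr_gt0 => j _; rewrite fac1. Qed.

Lemma joint2 J g h : joint J [fset g; h] = joint J [fset 0] * return_rate J (h - g).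
Proof.
rewrite -(joint_shift J (- g)) fshiftU !fshift1 subrr /joint /return_rate -big_split/=.
by apply: eq_bigr => j _; rewrite mulrC divfK// fac1 gt_eqF.
Qed.

Lemma return_rate_factor01 j g : 0 <= fac j [fset 0; g] / fac j [fset 0] <= 1.
Proof.
rewrite fac1 divr_ge0 ?(cm_ge0 _ (cm_fac j)) ?(ltW (fac1_gt0 j))//=.
by rewrite ler_pdivrMr// mul1r -fac1 fsetUC; exact/cm_le.
Qed.

Lemma return_rate01 J g : 0 <= return_rate J g <= 1.
Proof. by apply: prod_itv01 => j; exact: return_rate_factor01. Qed.

Lemma return_rate_decr J J' g : (J <= J')%N -> return_rate J' g <= return_rate J g.
Proof.
move=> /subnKC <-; rewrite /return_rate iotaD big_cat/= ler_piMr//.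
  by case/andP: (return_rate01 J g).
by case/andP: (prod_itv01 (iota (0 + J) (J' - J)) (return_rate_factor01^~ g)).
Qed.

Lemma return_rate_ge J g :
  1 - \sum_(j <- iota 0 J) e j * `|sin (g%:~R * t j / 2)| <= return_rate J g.
Proof.
have x01 j : 0 <= e j * `|sin (g%:~R * t j / 2)| <= 1.
  case/andP: (e01 j) => ? ?.
  by rewrite mulr_ge0//= -[leRHS]mulr1 ler_pM// sin_max.
apply: le_trans (prod_1B_ge _ x01) _; apply: ler_prod => j _.
rewrite subr_ge0; case/andP: (x01 j) => _ -> /=.
by rewrite ler_pdivlMr fac1// mulrC dip_law2_ge.
Qed.

Let cosum J g := \sum_(j <- iota 0 J) e j / 8 * (1 - cos (g%:~R * t j)).

Lemma return_rate_le J g : return_rate J g * (1 + cosum J g) <= 1.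
Proof.
have x01 j : 0 <= e j / 8 * (1 - cos (g%:~R * t j)) <= 1.
  case/andP: (e01 j) => ? ?; have := cos_le1 (g%:~R * t j).
  have := cos_geN1 (g%:~R * t j); move=> ? ?; apply/andP; split; nra.
apply: le_trans (prod_1B_le (iota 0 J) x01); rewrite ler_wpM2r//.
  by rewrite addr_ge0// sumr_ge0// => j _; case/andP: (x01 j).
apply: ler_prod => j _; case/andP: (return_rate_factor01 j g) => -> _ /=.
by rewrite ler_pdivrMr fac1// mulrC dip_law2_le.
Qed.

(* Chebyshev: [cosum J] has mean [E := \sum_j e j / 8] and variance at most [E / 16]. *)
Lemma return_rate_chebyshev J g (E := \sum_(j <- iota 0 J) e j / 8) : 0 < E ->
  return_rate J g <= 4 / E ^+ 2 *
    (\sum_(j <- iota 0 J) e j / 8 * cos (g%:~R * t j)) ^+ 2 + 2 / E.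
Proof.
move=> E0; set C := \sum_(j <- iota 0 J) _ * cos _.
have cE : cosum J g = E - C.
  by rewrite /cosum /E /C -sumrB; apply: eq_bigr => j _; rewrite mulrBr mulr1.
have := return_rate_le J g; rewrite cE => h.
case/andP: (return_rate01 J g); move: (return_rate J g) h => r h r0 r1.
(* If [C] is at least half of [E], the quadratic term alone exceeds 1; otherwise [cosum J g] is at
   least [E / 2] and [return_rate_le] gives [2 / E]. *)
have [CE|CE] := leP (E / 2) C.
  apply: le_trans r1 _; rewrite -[leLHS]addr0 lerD//; last by rewrite divr_ge0// ltW.
  rewrite mulrAC ler_pdivlMr ?exprn_gt0// mul1r; nra.
apply: (@le_trans _ _ (2 / E)).
  rewrite ler_pdivlMr//; nra.
by rewrite lerDr mulr_ge0 ?sqr_ge0// divr_ge0// sqr_ge0.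
Qed.

Lemma cvg_sum_seq (I : eqType) (s : seq I) (f : I -> nat -> R) (l : I -> R) :
  (forall i, f i N @[N --> \oo] --> l i) ->
  (\sum_(i <- s) f i N) @[N --> \oo] --> \sum_(i <- s) l i.
Proof.
move=> fl; elim: s => [|i s IH].
  rewrite big_nil (_ : (fun _ => _) = fun=> 0); first exact: cvg_cst.
  by apply/funext => N; rewrite big_nil.
rewrite big_cons (_ : (fun _ => _) = fun N => f i N + \sum_(j <- s) f j N).
  by apply: cvgD.
by apply/funext => N; rewrite big_cons.
Qed.

(** Products of cosines are half sums of cosines at the frequencies [t i + t j] and [t i - t j]. By
    [tD] and [tB] all of them average to 0 except the differences with [i = j]. *)
Lemma favg_cosum2_cvg (Phi : nat -> {fset int}) c J : Folner R Phi ->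
  favg (Phi N) (fun g => (\sum_(j <- iota 0 J) e j / 8 * cos ((g + c)%:~R * t j)) ^+ 2)
    @[N --> \oo] --> \sum_(j <- iota 0 J) (e j / 8) ^+ 2 / 2.
Proof.
move=> FPhi.
pose f i j N : R := e i / 8 * (e j / 8) / 2 *
  (favg (Phi N) (fun g => cos (g%:~R * (t i + t j) + c%:~R * (t i + t j))) +
   favg (Phi N) (fun g => cos (g%:~R * (t i - t j) + c%:~R * (t i - t j)))).
have -> : (fun N => favg (Phi N) (fun g =>
      (\sum_(j <- iota 0 J) e j / 8 * cos ((g + c)%:~R * t j)) ^+ 2)) =
    fun N => \sum_(i <- iota 0 J) \sum_(j <- iota 0 J) f i j N.
  apply/funext => N; rewrite /f.
  under eq_bigr => i _ do under eq_bigr => j _ do rewrite -favgD -favgZ.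
  under eq_bigr => i _ do rewrite -favg_sum.
  rewrite -favg_sum; congr favg; apply/funext => g.
  rewrite expr2 mulr_suml; apply: eq_bigr => i _.
  rewrite mulr_sumr; apply: eq_bigr => j _.
  rewrite -!mulrDl -rmorphD/=; set x := (g + c)%:~R.
  have -> : x * (t i + t j) = x * t i + x * t j by rewrite mulrDr.
  have -> : x * (t i - t j) = x * t i - x * t j by rewrite mulrBr.
  by rewrite cosD cosB; field.
have -> : \sum_(j <- iota 0 J) (e j / 8) ^+ 2 / 2 = \sum_(i <- iota 0 J)
    \sum_(j <- iota 0 J) e i / 8 * (e j / 8) / 2 * (0 + (i == j)%:R).
  apply: eq_big_seq => i iJ; rewrite (bigD1_seq i) ?iota_uniq//= eqxx big1.
    by rewrite addr0 add0r mulr1 expr2.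
  by move=> j /negbTE; rewrite eq_sym => ->; rewrite addr0 mulr0.
apply: cvg_sum_seq => i; apply: cvg_sum_seq => j; apply: cvgMl_tmp.
apply: cvgD; first exact: cos_favg_cvg.
have [<-|ij] := eqVneq i j; last exact/cos_favg_cvg/tB.
rewrite subrr (_ : (fun N => _) = fun=> 1); first exact: cvg_cst.
apply/funext => N; rewrite -[RHS](favg_cst 1 (FPhi.1 N)); congr favg.
by apply/funext => g; rewrite !mulr0 addr0 cos0.
Qed.

(** [J] can be chosen before [c] because the limit in [favg_cosum2_cvg] does not depend on [c];
    mixing uses several [c] with the same [J]. *)
Lemma return_rate_folner (Phi : nat -> {fset int}) (eps : R) : Folner R Phi -> 0 < eps ->
  exists J, forall c, \forall N \near \oo,
    favg (Phi N) (fun g => return_rate J (g + c)) <= eps.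
Proof.
(* Once the average of the square is below [E / 2], the Chebyshev bound is [4 / E], so [E] has to
   reach [4 / eps]. *)
move=> FPhi eps0; have [J JE] := e_div (8 * (4 / eps)).
exists J => c; pose E := \sum_(j <- iota 0 J) e j / 8.
have EJ : 4 / eps <= E.
  by rewrite /E -mulr_suml ler_pdivlMr// mulrC.
have E0 : 0 < E by apply: lt_le_trans EJ; rewrite divr_gt0.
have lE : \sum_(j <- iota 0 J) (e j / 8) ^+ 2 / 2 < E / 2.
  apply: (@le_lt_trans _ _ (E / 16)); last by lra.
  rewrite /E mulr_suml ler_sum// => j _; case/andP: (e01 j) => ? ?; nra.
have /cvgr_lt/(_ _ lE) := @favg_cosum2_cvg Phi c J FPhi.
apply: filterS => N hN.
have := le_favg (Phi N) (fun g => return_rate_chebyshev (g + c) E0).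
rewrite favgD favgZ (favg_cst _ (FPhi.1 N)) -/E => /le_trans; apply.
apply: (@le_trans _ _ (4 / E ^+ 2 * (E / 2) + 2 / E)).
  by rewrite lerD2r ler_wpM2l ?ltW// divr_gt0// exprn_gt0.
have -> : 4 / E ^+ 2 * (E / 2) + 2 / E = 4 / E by field; rewrite gt_eqF.
by rewrite ler_pdivrMr// mulrC -ler_pdivrMr.
Qed.

Lemma joint1_cvg : joint J [fset 0] @[J --> \oo] --> (0 : R).
Proof.
apply/cvgrPdist_le => eps eps0; have [J0 hJ0] := e_div (2 / eps).
near=> J; rewrite sub0r normrN gtr0_norm ?joint1_gt0//.
have x01 j : 0 <= e j / 2 <= 1 by case/andP: (e01 j) => ? ?; apply/andP; split; lra.
have := prod_1B_le (iota 0 J) x01.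
rewrite -(eq_bigr _ (fun j _ => fac1 j)) -/(joint J _) -mulr_suml.
have : 2 / eps <= \sum_(j <- iota 0 J) e j.
  apply: le_trans hJ0 _.
  have J0J : (J0 <= J)%N by near: J; exact: nbhs_infty_ge.
  rewrite -(subnKC J0J) iotaD big_cat/= lerDl sumr_ge0// => j _.
  by case/andP: (e01 j).
have := joint1_gt0 J; move: (joint J _) => q q0 h1 h2.
have : q / eps <= 1 by apply: le_trans h2; rewrite ler_pM2l//; lra.
by rewrite ler_pdivrMr// mul1r.
Unshelve. all: by end_near. Qed.

(* [copies J] independent copies of the random set at stage [J] together hit [0]
   about half a time on average. *)
Let copies J := Num.truncn (2 * joint J [fset 0])^-1.

Lemma copies_le J : (copies J)%:R * joint J [fset 0] <= 1 / 2.
Proof.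
have q0 := joint1_gt0 J.
have : (copies J)%:R <= (2 * joint J [fset 0])^-1 by rewrite truncn_le invr_ge0 mulr_ge0// ltW.
rewrite -(ler_pM2r q0) => /le_trans; apply.
by rewrite invfM mulfVK ?gt_eqF// div1r.
Qed.

Lemma copies_ge J : 1 / 2 - joint J [fset 0] <= (copies J)%:R * joint J [fset 0].
Proof.
have q0 := joint1_gt0 J.
have /truncn_itv/andP[_] : 0 <= (2 * joint J [fset 0])^-1 by rewrite invr_ge0 mulr_ge0// ltW.
rewrite -(ltr_pM2r q0) -/(copies J) -[(copies J).+1%:R]natr1 [ltRHS]mulrDl mul1r invfM mulfVK ?gt_eqF//; lra.
Qed.

(* The complement of the union of these copies; it has the same dynamics as the
   union, and its inclusion probabilities are products. *)
Definition stage J U := dual (joint J) U ^+ copies J.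

Definition law U := ulim G (stage^~ U).

Lemma dual_joint0 J : dual (joint J) fset0 = 1.
Proof. by rewrite dual0 joint0. Qed.

Lemma dual_joint01 J U : 0 <= dual (joint J) U <= 1.
Proof.
have cn := cm_dual (cm_joint J).
by rewrite (cm_ge0 _ cn) (cm_le1 cn (dual_joint0 J)).
Qed.

Lemma stage01 J U : 0 <= stage J U <= 1.
Proof. by case/andP: (dual_joint01 J U) => ? ?; rewrite exprn_ge0//= exprn_ile1. Qed.

Lemma bseq_stage U : bounded_seq (stage^~ U).
Proof. by apply: bseq01 => J; exact: stage01. Qed.

Lemma cm_law : completely_monotone law.
Proof. by apply: cm_ulim bseq_stage => // J; exact/cmX/cm_dual/cm_joint. Qed.

Lemma law0 : law fset0 = 1.
Proof.
rewrite -[RHS](ulim_cst UG ooG); congr ulim; apply/funext => J.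
by rewrite /stage dual_joint0 expr1n.
Qed.

Lemma law_shift : shift_invariant law.
Proof.
move=> x U; congr ulim; apply/funext => J; congr (_ ^+ _).
by apply: dual_fshift; exact: joint_shift.
Qed.

Lemma hit2_joint J g h :
  hit2 (dual (joint J)) [fset g] [fset h] = joint J [fset 0] * return_rate J (h - g).
Proof.
by rewrite /hit2 dual2 !dual1 joint0 -joint2; ring.
Qed.

Lemma hit1_joint J g : 1 - dual (joint J) [fset g] = joint J [fset 0].
Proof. by rewrite dual1 joint0 joint1; ring. Qed.

Lemma joint1_01 J : 0 <= joint J [fset 0] <= 1.
Proof. by have := dual_joint01 J [fset 0]; have := hit1_joint J 0; lra. Qed.

(** Write [q] for [joint J [fset 0]]. For one copy, [decorrelation] and the union bounds give [q]
    times the sum of return rates, plus [|U| |V| q ^ 2]. Taking powers multiplies this by the number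
    of copies, and [copies J * q <= 1 / 2]. *)
Lemma stage_decorrelation J U V :
  `|stage J (U `|` V) - stage J U * stage J V| <=
    1 / 2 * (\sum_(g <- U) \sum_(h <- V) return_rate J (h - g)
      + (#|` U| * #|` V|)%:R * joint J [fset 0]).
Proof.
have cn := cm_dual (cm_joint J); have n0 := dual_joint0 J.
have q0 := joint1_gt0 J.
have n01 := dual_joint01 J.
have nn01 : 0 <= dual (joint J) U * dual (joint J) V <= 1.
  case/andP: (n01 U) => ? ?; case/andP: (n01 V) => ? ?.
  by rewrite mulr_ge0//= mulr_ile1.
rewrite /stage -exprMn (le_trans (ler_normX_B _ (n01 _) nn01))//.
have h1 W : 1 - dual (joint J) W <= #|` W|%:R * joint J [fset 0].
  rewrite (le_trans (hit1_sum cn n0 W))// (eq_bigr _ (fun g _ => hit1_joint J g)).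
  by rewrite big_const_seq count_predT iter_addr_0 mulr_natl.
apply: le_trans (ler_wpM2l (ler0n _ _) (decorrelation cn n0 U V)) _.
apply: (@le_trans _ _ ((copies J)%:R * joint J [fset 0] *
  (\sum_(g <- U) \sum_(h <- V) return_rate J (h - g)
      + (#|` U| * #|` V|)%:R * joint J [fset 0]))); last first.
  apply: ler_wpM2r (copies_le J); rewrite addr_ge0 ?mulr_ge0 ?(ltW q0)//.
  by rewrite sumr_ge0// => g _; rewrite sumr_ge0// => h _; case/andP: (return_rate01 J (h - g)).
rewrite -mulrA ler_wpM2l// [leRHS]mulrDr lerD//.
  apply: le_trans (hit2_sum cn n0 U V) _; rewrite mulr_sumr ler_sum// => g _.
  by rewrite mulr_sumr ler_sum// => h _; rewrite hit2_joint.
have -> : joint J [fset 0] * ((#|` U| * #|` V|)%:R * joint J [fset 0]) =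
  (#|` U|%:R * joint J [fset 0]) * (#|` V|%:R * joint J [fset 0]) by rewrite natrM; ring.
case/andP: (n01 U) => ? ?; case/andP: (n01 V) => ? ?.
by rewrite ler_pM ?subr_ge0.
Qed.

(** In the limit the density term disappears, and the return rates at stages beyond [J0] are at most
    those at stage [J0], since each further factor is at most 1. *)
Lemma law_decorrelation J0 U V : `|law (U `|` V) - law U * law V| <=
  \sum_(g <- U) \sum_(h <- V) return_rate J0 (h - g).
Proof.
set S := \sum_(g <- U) _.
have S0 : 0 <= S.
  by apply: sumr_ge0 => g _; rewrite sumr_ge0// => h _; case/andP: (return_rate01 J0 (h - g)).
have bUV : bounded_seq (fun J => stage J (U `|` V) - stage J U * stage J V).
  apply: bseqB; first exact: bseq_stage.
  by apply: bseqM; exact: bseq_stage.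
rewrite /law -ulimM//; try exact: bseq_stage.
rewrite -ulimB//; [|exact: bseq_stage|by apply: bseqM; exact: bseq_stage].
rewrite -ulim_norm//.
pose r J := S + 1 / 2 * (#|` U| * #|` V|)%:R * joint J [fset 0].
have rS : r J @[J --> \oo] --> S.
  rewrite -[X in _ --> X]addr0; apply: cvgD; first exact: cvg_cst.
  rewrite -[X in _ --> X](mulr0 (1 / 2 * (#|` U| * #|` V|)%:R)).
  by apply: cvgMl_tmp; exact: joint1_cvg.
rewrite -(cvg_ulim UG ooG rS); apply: ulim_le => //.
- exact: bseq_norm.
- apply: bseqD; first exact: bseq_cst.
  by apply: bseqZ; apply: bseq01; exact: joint1_01.
near=> J; apply: le_trans (stage_decorrelation J U V) _.
rewrite mulrDr /r mulrA lerD2r.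
apply: (@le_trans _ _ (1 / 2 * S)); last by lra.
rewrite ler_pM2l// ler_sum// => g _; rewrite ler_sum// => h _.
apply: return_rate_decr; near: J; exact: nbhs_infty_ge.
Unshelve. all: by end_near. Qed.

Lemma law_mixing (Phi : nat -> {fset int}) U V : Folner R Phi ->
  favg (Phi N) (fun x => `|law (U `|` fshift x V) - law U * law V|)
    @[N --> \oo] --> (0 : R).
Proof.
move=> FPhi; apply/cvgrPdist_le => eps eps0.
(* Each pair of [U] and [V] gets a share [eps / m]; the successor keeps [m] nonzero when one of the
   sets is empty. *)
pose m : R := (#|` U| * #|` V|).+1%:R.
have [J hJ] := @return_rate_folner Phi (eps / m) FPhi (divr_gt0 eps0 (ltr0Sn _ _)).
have : \forall N \near \oo, forall g, g \in U -> forall h, h \in V ->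
    favg (Phi N) (fun x => return_rate J (x + (h - g))) <= eps / m.
  (* The passage to lists allows an induction that intersects finitely many eventual statements. *)
  suff Hs : forall s s' : seq int, \forall N \near \oo, forall g, g \in s -> forall h, h \in s' ->
    favg (Phi N) (fun x => return_rate J (x + (h - g))) <= eps / m.
    exact: (Hs (enum_fset U) (enum_fset V)).
  move=> s s'; elim: s => [|g s IH]; first by apply: nearW.
  have Hg : \forall N \near \oo, forall h, h \in s' ->
      favg (Phi N) (fun x => return_rate J (x + (h - g))) <= eps / m.
    elim: s' {IH} => [|h s' IH']; first by apply: nearW.
    near=> N => h'; rewrite inE => /orP[/eqP ->|h's].
      by near: N; exact: hJ.
    by move: h' h's; near: N; exact: IH'.
  near=> N => g'; rewrite inE => /orP[/eqP ->|g's].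
    by near: N; exact: Hg.
  by move: g' g's; near: N; exact: IH.
apply: filterS => N hN; rewrite sub0r normrN ger0_norm; last exact: favg_ge0.
apply: (@le_trans _ _ (favg (Phi N) (fun x =>
    \sum_(g <- U) \sum_(h <- V) return_rate J (x + (h - g))))).
  apply: le_favg => x; rewrite -[law V](law_shift x) (le_trans (law_decorrelation J _ _))//.
  apply: ler_sum => g _; rewrite /fshift big_imfset/=; last by move=> ? ? _ _; exact: addIr.
  by apply: ler_sum => h _; rewrite addrCA addrA.
rewrite favg_sum.
apply: (@le_trans _ _ (\sum_(g <- U) \sum_(h <- V) eps / m)).
  rewrite big_seq [leRHS]big_seq; apply: ler_sum => g gU; rewrite favg_sum.
  by rewrite big_seq [leRHS]big_seq; apply: ler_sum => h hV; exact: hN.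
rewrite !big_const_seq !count_predT !iter_addr_0 -mulrnA -[_ *+ _]mulr_natr mulrAC.
by rewrite ler_pdivrMr ?ltr0Sn// ler_pM2l// ler_nat mulnC leqW.
Unshelve. all: by end_near. Qed.

(** The value is [exp (- 1 / 2)], but crude Bernoulli bounds suffice. With [q = joint J [fset 0]],
    the lower one uses [copies J * q <= 1 / 2]; for [q < 1 / 4] that product is at least 1/4, which
    gives [1 / (1 + 1 / 4) = 4 / 5]. *)
Lemma law1_itv : 1 / 2 <= law [fset 0] <= 4 / 5.
Proof.
have x01 := joint1_01.
have E J : stage J [fset 0] = (1 - joint J [fset 0]) ^+ copies J.
  by rewrite /stage -(hit1_joint J 0) subKr.
apply/andP; split.
  rewrite -[leLHS](ulim_cst UG ooG); apply: ulim_le => //; try exact: bseq_cst; try exact: bseq_stage.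
  apply: nearW => J; rewrite E; apply: le_trans (bernoulli_ge _ (x01 J)).
  have := copies_le J; lra.
rewrite -[leRHS](ulim_cst UG ooG); apply: ulim_le => //; try exact: bseq_cst; try exact: bseq_stage.
have : \forall J \near \oo, joint J [fset 0] < 1 / 4.
  have q4 : (0 : R) < 1 / 4 by lra.
  exact: (cvgr_lt _ joint1_cvg _ q4).
apply: filterS => J J4; have := bernoulli_le (copies J) (x01 J); rewrite -E.
have := copies_ge J; have /andP[s0 _] := stage01 J [fset 0].
move: (_%:R * _) (stage _ _) s0 => x y y0; nra.
Qed.

(** One copy changes by [joint J [fset 0] * (1 - return_rate J (a n))], and the number of copies
    cancels the density. The hypothesis is uniform in [J], so the bound survives the limit. *)
Lemma law_rigid (a : nat -> int) :
  (forall eps, 0 < eps -> \forall n \near \oo, forall J,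
    \sum_(j <- iota 0 J) e j * `|sin ((a n)%:~R * t j / 2)| <= eps) ->
  law [fset 0; a n] @[n --> \oo] --> law [fset 0].
Proof.
move=> ha; apply/cvgrPdist_le => eps eps0.
apply: filterS (ha _ eps0) => n hn.
rewrite /law -ulimB//; try exact: bseq_stage.
rewrite -ulim_norm; last by apply: bseqB; exact: bseq_stage.
rewrite -[leRHS](ulim_cst UG ooG); apply: ulim_le => //.
- by apply: bseq_norm; apply: bseqB; exact: bseq_stage.
- exact: bseq_cst.
apply: nearW => J; rewrite /stage.
rewrite (le_trans (ler_normX_B _ (dual_joint01 _ _) (dual_joint01 _ _)))//.
have -> : dual (joint J) [fset 0] - dual (joint J) [fset 0; a n] =
    joint J [fset 0] * (1 - return_rate J (a n)).
  by rewrite dual1 dual2 joint2 joint0 (joint1 J (a n)) subr0; ring.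
case/andP: (return_rate01 J (a n)) => r0 r1.
rewrite ger0_norm; last by rewrite mulr_ge0 ?subr_ge0// ltW// joint1_gt0.
rewrite mulrA (@le_trans _ _ (1 / 2 * (1 - return_rate J (a n))))//.
  by rewrite ler_wpM2r ?subr_ge0// copies_le.
have := return_rate_ge J (a n); have := hn J; lra.
Qed.

End Process.

Lemma exists_process (R : realType) (e t : nat -> R) (a : nat -> int) :
  (forall j, 0 <= e j <= 1) ->
  (forall M, exists J, M <= \sum_(j <- iota 0 J) e j) ->
  (forall i j, cos (t i + t j) != 1) ->
  (forall i j, i != j -> cos (t i - t j) != 1) ->
  (forall eps, 0 < eps -> \forall n \near \oo, forall J,
    \sum_(j <- iota 0 J) e j * `|sin ((a n)%:~R * t j / 2)| <= eps) ->
  exists v : {fset int} -> R,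
  [/\ completely_monotone v /\ v fset0 = 1, shift_invariant v, 0 < v [fset 0] < 1,
      forall U V Phi, Folner R Phi ->
        favg (Phi N) (fun x => `|v (U `|` fshift x V) - v U * v V|)
          @[N --> \oo] --> (0 : R) &
      v [fset 0; a n] @[n --> \oo] --> v [fset 0]].
Proof.
move=> e01 e_div tD tB ha; have [G [UG ooG]] := nat_ultrafilter.
exists (law e t G); split.
- by split; [exact: cm_law|exact: law0].
- exact: law_shift.
- have /andP[? ?] := law1_itv e01 e_div tD UG ooG; apply/andP; split; lra.
- by move=> U V Phi FPhi; exact: law_mixing.
- exact: law_rigid.
Qed.

(** * Powers of PV numbers *)

Section PowerSums.
Variable F : fieldType.

Lemma deriv_prod_XsubC (s : seq F) : uniq s ->
  (\prod_(z <- s) ('X - z%:P))^`() = \sum_(z <- s) \prod_(w <- rem z s) ('X - w%:P).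
Proof.
elim: s => [|a s IH] /=; first by rewrite !big_nil derivC.
move=> /andP[aNs us]; rewrite !big_cons derivM derivXsubC mul1r IH// eqxx.
congr (_ + _); rewrite mulr_sumr; apply: eq_big_seq => z zs.
have -> : (a == z) = false by apply: contraNF aNs => /eqP->.
by rewrite big_cons.
Qed.

(* With [p_z = p / (X - z)] one has [p' = \sum_z p_z], so [f p'] is congruent to
   [\sum_z f(z) p_z] modulo [p], and each [p_z] is monic of degree [deg p - 1]. *)
Lemma power_sum_int (s : seq F) (p f : {poly int}) : uniq s -> (0 < size s)%N ->
  p \is monic -> map_poly intr p = \prod_(z <- s) ('X - z%:P) ->
  exists k : int, \sum_(z <- s) (map_poly intr f).[z] = k%:~R.
Proof.
move=> us s0 pm; set P := \prod_(z <- s) _ => pP.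
set f' := map_poly intr f.
pose h := Pdiv.Ring.rmodp (f * p^`()) p; pose h' : {poly F} := map_poly intr h.
exists h`_(size s).-1.
pose E := \sum_(z <- s) f'.[z] *: \prod_(w <- rem z s) ('X - w%:P).
have sizeE : (size E < size P)%N.
  rewrite size_prod_XsubC ltnS /E; apply: leq_trans (size_sum _ _ _) _.
  apply/bigmax_leqP_seq => z zs _; apply: leq_trans (size_scale_leq _ _) _.
  by rewrite size_prod_XsubC size_rem// prednK.
have dvdE : P %| f' * P^`() - E.
  rewrite /P deriv_prod_XsubC// -/P mulr_sumr -sumrB.
  rewrite big_seq; apply: (big_ind (fun q => P %| q)) => [|? ? ? ?|z zs].
  - exact: dvdp0.
  - exact: dvdp_add.
  rewrite -mul_polyC -mulrBl {1}/P (perm_big _ (perm_to_rem zs)) big_cons/=.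
  by apply: dvdp_mul => //; rewrite dvdp_XsubCl /root hornerD hornerN hornerC subrr.
have fpE : f * p^`() = Pdiv.Ring.rdivp (f * p^`()) p * p + h by exact: Pdiv.RingMonic.rdivp_eq.
have fPE : f' * P^`() = map_poly intr (Pdiv.Ring.rdivp (f * p^`()) p) * P + h'.
  by rewrite -pP deriv_map -rmorphM/= [in LHS]fpE rmorphD rmorphM.
have sizeh : (size h' < size P)%N.
  apply: leq_ltn_trans (size_poly _ _) _.
  have -> : size P = size p.
    by rewrite -pP size_map_poly_id0// (eqP pm) oner_eq0.
  by rewrite Pdiv.Ring.ltn_rmodp monic_neq0.
have hE : h' = E.
  apply/eqP; rewrite -subr_eq0; apply: contraT => hE0.
  have : P %| h' - E.
    have -> : h' - E = (f' * P^`() - E) - map_poly intr (Pdiv.Ring.rdivp (f * p^`()) p) * P.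
      by rewrite fPE; ring.
    by rewrite dvdp_sub// dvdp_mull.
  move=> /(dvdp_leq hE0); rewrite leqNgt => /negP[].
  apply: leq_ltn_trans (size_polyD _ _) _.
  by rewrite size_polyN gtn_max sizeh.
have -> : (h`_(size s).-1)%:~R = h'`_(size s).-1 by rewrite coef_map.
rewrite hE /E coef_sum; apply: eq_big_seq => z zs; rewrite coefZ.
have /monicP : \prod_(w <- rem z s) ('X - w%:P) \is monic.
  exact: monic_prod_XsubC.
by rewrite lead_coefE size_prod_XsubC size_rem// => ->; rewrite mulr1.
Qed.

End PowerSums.

(** * Integral minimal polynomials and the distance of powers to the integers *)

Section MinimalPolynomial.
Variable R : realType.

Lemma exists_min_poly (a : R) : integralOver (intr : int -> R) a ->
  exists p : {poly int}, [/\ p \is monic, root (map_poly intr p) a &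
    irreducible_poly (map_poly (intr : int -> rat) p)].
Proof.
move=> [P Pm Pa].
pose vanish (n : nat) := `[< exists r : {poly rat},
  [/\ r != 0, root (map_poly ratr r) a & size r = n] >].
pose PQ := map_poly (intr : int -> rat) P.
have mapQ (q : {poly int}) :
    map_poly (ratr : rat -> R) (map_poly intr q) = map_poly intr q.
  by rewrite -map_poly_comp; apply: eq_map_poly => z /=; rewrite ratr_int.
have PQ0 : PQ != 0.
  by rewrite -size_poly_eq0 size_rat_int_poly size_poly_eq0 monic_neq0.
have exP : exists n, vanish n.
  by exists (size PQ); apply/asboolP; exists PQ; rewrite mapQ.
case: (ex_minnP exP) => n /asboolP[r [r0 ra rn]] nmin.
have size_min (q : {poly rat}) : q != 0 -> root (map_poly ratr q) a -> (n <= size q)%N.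
  by move=> q0 qa; apply: nmin; apply/asboolP; exists q.
have r1 : (1 < size r)%N.
  rewrite ltnNge; apply/negP => /size1_polyC rE; move: ra r0.
  by rewrite rE map_polyC/= rootC fmorph_eq0 polyC_eq0 => ->.
have irr : irreducible_poly r.
  split=> // d d1 dr; have [q rE] := dvdpP _ _ dr.
  have [q0 d0] : q != 0 /\ d != 0 by apply/andP; rewrite -negb_or -mulf_eq0 -rE.
  rewrite -dvdp_size_eqp// eqn_leq dvdp_leq//= rn.
  move: ra; rewrite rE rmorphM/= rootM => /orP[qa|da]; last exact: size_min.
  have := size_min _ q0 qa; rewrite -rn rE size_mul// => h.
  suff : (size d <= 1)%N.
    by rewrite leq_eqVlt (negbTE d1) ltnS leqn0 size_poly_eq0 (negbTE d0).
  by move: h; rewrite -subn1 leq_subLR addnC leq_add2r.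
have rP : r %| PQ.
  rewrite dvdp_eq; apply/eqP; rewrite {1}(divp_eq PQ r).
  suff -> : PQ %% r = 0 by rewrite addr0.
  apply/eqP; apply: contraT => m0.
  have : root (map_poly ratr (PQ %% r)) a.
    have -> : PQ %% r = PQ - PQ %/ r * r by rewrite {2}(divp_eq PQ r) addrC addKr.
    rewrite rmorphB rmorphM/= mapQ /root hornerD hornerN hornerM.
    by rewrite (eqP Pa) (eqP ra) mulr0 subrr.
  by move=> /(size_min _ m0); rewrite -rn leqNgt ltn_modp r0.
(* By Gauss's lemma the rational minimal polynomial [r] is proportional to an integer factor [p1] of
   the monic [P]. The leading coefficient [u] of [p1] divides 1, so [u%:P * p1] is monic. *)
have [p1 [c c0 rE] [q Pq]] := dvdpP_rat_int rP.
pose u := lead_coef p1.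
have uu : u * lead_coef q = 1 by rewrite /u -lead_coefM -Pq; exact/monicP.
have u2 : u * u = 1.
  have /eqP : (`|u| * `|lead_coef q|)%N = 1%N by rewrite -abszM uu.
  rewrite muln_eq1 => /andP[/eqP u1 _]; lia.
exists (u%:P * p1); split.
- by rewrite monicE lead_coefM lead_coefC u2.
- rewrite rmorphM/= rootM; apply/orP; right.
  by move: ra; rewrite rE map_polyZ/= mapQ rootZ// fmorph_eq0.
- have -> : map_poly (intr : int -> rat) (u%:P * p1) = (u%:~R / c) *: r.
    by rewrite rE scalerA divfK// rmorphM/= map_polyC/= mul_polyC.
  have k0 : u%:~R / c != 0 :> rat.
    rewrite mulf_neq0 ?invr_eq0// intr_eq0.
    by apply: contra_eqN u2 => /eqP ->; rewrite mul0r.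
  case: irr => irr1 irr2; split; first by rewrite size_scale.
  move=> d d1; rewrite dvdpZr// => dr.
  by apply: eqp_trans (irr2 d d1 dr) _; rewrite eqp_sym eqp_scale.
Qed.

Lemma irreducible_separable (p : {poly rat}) : irreducible_poly p -> separable_poly p.
Proof.
move=> irr; have p1 := irr.1; rewrite unlock irreducible_poly_coprime//.
have p0 : p != 0 by rewrite -size_poly_gt0; apply: leq_trans p1.
have p'0 : p^`() != 0.
  apply/eqP => /polyP/(_ (size p).-2).
  rewrite coef0 coef_deriv; have -> : (size p).-2.+1 = (size p).-1 by case: (size p) p1 => [|[]].
  move/eqP; rewrite mulrn_eq0 -lead_coefE lead_coef_eq0 (negbTE p0) orbF.
  by case: (size p) p1 => [|[]].
by apply/negP => /(dvdp_leq p'0); rewrite leqNgt lt_size_deriv.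
Qed.

(** The value 1/2 for the empty list serves an integer [alpha], which has no other conjugate. *)
Lemma seq_lt1_bound (s : seq R) : (forall z, z \in s -> z < 1) ->
  exists2 k : R, 0 < k < 1 & forall z, z \in s -> z <= k.
Proof.
elim: s => [|z s IH] sz; first by exists (1 / 2) => //; apply/andP; split; lra.
have [|k k01 sk] := IH; first by move=> w ws; apply: sz; rewrite inE ws orbT.
have z1 : z < 1 by apply: sz; rewrite inE eqxx.
exists (Num.max z k) => [|w].
  by case/andP: k01 => k0 k1; rewrite lt_max k0 orbT gt_max z1.
by rewrite inE le_max => /orP[/eqP ->|/sk ->]; rewrite ?lexx ?orbT.
Qed.

(** The sum of the [n]-th powers of all conjugates is an integer, and all terms but [a ^+ n] decay
    geometrically. *)
Lemma PV_dist_int (a : R) : PV_number a -> exists C k : R,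
  [/\ 0 <= C, 0 < k < 1 &
      forall n, exists m : int, `|a ^+ n - m%:~R| <= C * k ^+ n].
Proof.
move=> [a1 aint aconj]; have [p [pm pa irr]] := exists_min_poly aint.
pose pC : {poly R[i]} := map_poly intr p.
have pCm : pC \is monic by apply: monic_map.
have [s] := closed_field_poly_normal pC; rewrite (monicP pCm) scale1r => pCs.
have pCQ : pC = map_poly (ratr : rat -> R[i]) (map_poly intr p).
  by rewrite -map_poly_comp; apply: eq_map_poly => z /=; rewrite ratr_int.
(* The roots are simple, so removing [a] once leaves only conjugates different from [a]. *)
have us : uniq s.
  rewrite -separable_prod_XsubC -pCs pCQ separable_map; exact: irreducible_separable.
have pCa : root pC a%:C%C.
  have -> : pC = map_poly (real_complex R) (map_poly intr p).
    by rewrite -map_poly_comp; apply: eq_map_poly => z /=; rewrite rmorph_int.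
  by rewrite fmorph_root.
have as_ : a%:C%C \in s by rewrite -root_prod_XsubC -pCs.
have [|k k01 sk] := @seq_lt1_bound (map (@Normc.normc R) (rem a%:C%C s)).
  move=> _ /mapP[z + ->]; rewrite mem_rem_uniq// inE => /andP[za zs].
  have : `|z| < 1.
    apply: aconj; last exact/eqP.
    exists (map_poly intr p); split => //; rewrite -?pCQ//.
    - exact: monic_map.
    - by rewrite pCs root_prod_XsubC.
  by rewrite -[(`|z|)]/((Normc.normc z)%:C)%C -[1]/(1%:C)%C ltcR.
exists (size s)%:R, k; split => // n.
have s0 : (0 < size s)%N by case: (s) as_.
have [m] := power_sum_int 'X^n us s0 pm pCs.
rewrite (perm_big _ (perm_to_rem as_)) big_cons/= map_polyXn => sm.
exists m.
have : `|(a ^+ n - m%:~R)%:C%C| <= ((size s)%:R * k ^+ n)%:C%C :> R[i].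
  have -> : (a ^+ n - m%:~R)%:C%C = - \sum_(z <- rem a%:C%C s) ('X^n : {poly R[i]}).[z].
    rewrite rmorphB rmorphXn rmorph_int/= -sm hornerXn; ring.
  rewrite normrN (le_trans (ler_norm_sum _ _ _))//.
  apply: (@le_trans _ _ (\sum_(z <- rem a%:C%C s) (k ^+ n)%:C%C)).
    rewrite big_seq [leRHS]big_seq; apply: ler_sum => z zs.
    rewrite hornerXn normrX rmorphXn/= lerXn2r ?nnegrE//.
      by rewrite -[0]/(0%:C)%C lecR ltW//; case/andP: k01.
    rewrite -[(`|z|)]/((Normc.normc z)%:C)%C lecR; apply: sk; exact: map_f.
  rewrite big_const_seq count_predT iter_addr_0 -[_ *+ _]mulr_natl rmorphM rmorph_nat.
  rewrite ler_wpM2r ?ler_nat//; last by rewrite size_rem// leq_pred.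
  by rewrite -[0]/(0%:C)%C lecR exprn_ge0// ltW//; case/andP: k01.
by rewrite normc_def/= lecR expr0n addr0 sqrtr_sqr.
Qed.

Lemma nearest_int_dist (x : R) (m : int) : `|x - (nearest_int x)%:~R| <= `|x - m%:~R|.
Proof.
rewrite /nearest_int; set f := Num.floor _.
have /andP[] := floor_itv (x + 2^-1); rewrite -/f rmorphD/=.
move: f => f h1 h2.
have [->//|mf] := eqVneq m f.
have : m + 1 <= f \/ f + 1 <= m by lia.
by rewrite -!(ler_int R) !rmorphD/= => -[h|h]; do 2 case: ger0P => ?; lra.
Qed.

(** [C] and [k] are enlarged so that the same geometric bound also controls the powers of [a^-1],
    which occur when [n < m]. *)
Lemma PV_nearest_dist (a : R) : PV_number a -> exists C k : R,
  [/\ 1 <= C, 0 < k < 1, a^-1 <= k &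
      forall n, `|a ^+ n - (nearest_int (a ^+ n))%:~R| <= C * k ^+ n].
Proof.
move=> PVa; have [C [k [C0 /andP[k0 k1] hC]]] := PV_dist_int PVa.
have [a1 _ _] := PVa; have a0 : 0 < a by apply: lt_trans a1.
exists (C + 1), (Num.max k a^-1); split.
- by rewrite lerDr.
- by rewrite lt_max k0 gt_max k1 invf_lt1.
- by rewrite le_max lexx orbT.
move=> n; have [m hm] := hC n.
apply: le_trans (nearest_int_dist _ m) _; apply: le_trans hm _.
rewrite ler_pM ?exprn_ge0 ?(ltW k0) ?lerDl//.
by rewrite lerXn2r ?nnegrE ?(ltW k0) ?le_max ?lexx// (ltW k0).
Qed.

End MinimalPolynomial.

(** * Choice of the weights and of the rotation angles *)

Section PVRotations.
Variable R : realType.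

Lemma sin_le_norm (x : R) : `|sin x| <= `|x|.
Proof.
wlog x0 : x / 0 < x => [hw|].
  have [x0|x0|<-] := ltgtP 0 x; [exact: hw| |by rewrite sin0].
  by have := hw (- x); rewrite oppr_gt0 sinN !normrN; apply.
have [|c _] := @MVT R sin cos 0 x x0.
  by apply: continuous_subspaceT => y; exact: continuous_sin.
by rewrite sin0 !subr0 => ->; rewrite normrM ler_piMl// cos_max.
Qed.

Lemma sin_Dint_pi (y : R) (k : int) : `|sin (y + pi * k%:~R)| = `|sin y|.
Proof.
have H (n : nat) z : `|sin (z + pi *+ n : R)| = `|sin z|.
  by rewrite (alternatingn (@sinDpi R)) normrM normrX normrN1 expr1n mul1r.
case: k => n; first by rewrite -[(Posz n)%:~R]/(n%:R) mulr_natr H.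
by rewrite NegzE rmorphN/= mulrN mulr_natr -(H n.+1) subrK.
Qed.

Lemma sin_pi_le (x : R) (k : int) : `|sin (pi * x)| <= pi * `|x - k%:~R|.
Proof.
have -> : pi * x = pi * (x - k%:~R) + pi * k%:~R by ring.
rewrite sin_Dint_pi (le_trans (sin_le_norm _))// normrM ger0_norm//.
exact: pi_ge0.
Qed.

Lemma cos_neq1 (x : R) : 0 < `|x| < pi *+ 2 -> cos x != 1.
Proof.
move=> /andP[x0 x2]; rewrite -cos_norm; apply/negP => /eqP.
rewrite cos_half => h.
have : 0 < sin (`|x| / 2) by apply: sin_gt0_pi; apply/andP; split; lra.
move=> s0; have : 0 < sin (`|x| / 2) ^+ 2 by rewrite exprn_gt0.
lra.
Qed.

Lemma harmonic_sum_unbounded (M : R) : exists J, M <= \sum_(j <- iota 0 J) (harmonic j : R).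
Proof.
apply: contrapT => /forallNP hJ.
have [] := @dvg_harmonic R; apply: nondecreasing_is_cvgn.
  apply/nondecreasing_seqP => n; rewrite /series/= big_nat_recr//= lerDl.
  exact: harmonic_ge0.
exists M => _ [n _ <-]; have /negP := hJ n; rewrite -ltNge => /ltW.
by rewrite /series/= /index_iota subn0.
Qed.

Section TwoSided.
Variable k : R.
Hypothesis k01 : 0 < k < 1.

(** Subtraction is truncated, so one summand is 0 and the exponent is [|n - m|]. *)
Definition two_sided (n m : nat) : R := k ^+ (n - m + (m - n)).

Lemma two_sided_ge0 n m : 0 <= two_sided n m.
Proof. by rewrite exprn_ge0// ltW//; case/andP: k01. Qed.

Lemma sum_two_sided n m0 J :
  (\sum_(j <- iota 0 J) two_sided n (j + m0)) * (1 - k) <= 2.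
Proof.
have [k0 k1] := andP k01.
(* A telescoping bound: [g] stays in [0, 2] and each step increases it by at least
   [(1 - k) * two_sided n m]. *)
pose g m := if (m <= n)%N then k ^+ (n - m) else 2 - k ^+ (m - n).
have X01 i : 0 <= k ^+ i <= 1 by rewrite exprn_ge0 ?exprn_ile1// ltW.
have g02 m : 0 <= g m <= 2.
  rewrite /g; case: ifP => _; first by have := X01 (n - m)%N; lra.
  by have := X01 (m - n)%N; lra.
suff : (\sum_(j <- iota 0 J) two_sided n (j + m0)) * (1 - k) <= g (J + m0)%N - g m0.
  by have := g02 (J + m0)%N; have := g02 m0; lra.
elim: J => [|J IH]; first by rewrite big_nil mul0r add0n subrr.
rewrite -[in iota _ _]addn1 iotaD big_cat big_seq1 add0n mulrDl.
have : two_sided n (J + m0) * (1 - k) <= g (J.+1 + m0)%N - g (J + m0)%N.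
  rewrite /two_sided /g addSn; move: (J + m0)%N => m.
  have [mn|nm|->] := ltngtP m n.
  - have -> : (m - n = 0)%N by lia.
    have -> : (n - m = (n - m.+1).+1)%N by lia.
    rewrite addn0 exprS; have /andP[x0 _] := X01 (n - m.+1)%N.
    have := mulr_ge0 x0 (sqr_ge0 (1 - k)); nra.
  - have -> : (n - m = 0)%N by lia.
    have -> : (m.+1 - n = (m - n).+1)%N by lia.
    rewrite add0n exprS; lra.
  - rewrite subnn subSnn addn0 expr0 expr1; lra.
move: IH; lra.
Qed.

Lemma harmonic_two_sided m0 (eps : R) : 0 < eps -> \forall n \near \oo, forall J,
  \sum_(j <- iota 0 J) (harmonic j : R) * two_sided n (j + m0) <= eps.
Proof.
move=> eps0; have [k0 k1] := andP k01.
(* By [sum_two_sided] the indices with weight below [e'] contribute at most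
   [2 e' / (1 - k) = eps / 2]. *)
pose e' := eps * (1 - k) / 4.
have e'0 : 0 < e' by rewrite !mulr_gt0// subr_gt0.
have [j0 _ hj0] : \forall j \near \oo, (harmonic j : R) < e'.
  exact: (cvgr_lt _ (@cvg_harmonic R) _ e'0).
have : \forall n \near \oo, k ^+ n * j0%:R <= eps / 2.
  have kn : (k ^+ n * j0%:R) @[n --> \oo] --> 0 * (j0%:R : R).
    by apply: cvgMr_tmp; apply: cvg_expr; rewrite ger0_norm// ltW.
  rewrite mul0r in kn; apply: (cvgr_le _ kn); lra.
(* For such [n] every [j < j0] is at distance at least [n0] from [n] after the shift by [m0], so
   these finitely many terms are at most [k ^+ n0] each. *)
move=> [n0 _ hn0]; exists (n0 + (j0 + m0))%N => // n /= nn0 J.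
have hd : (\sum_(j <- iota 0 J) (j < j0)%:R : R) <= j0%:R.
  have : (\sum_(j <- iota 0 J) (j < j0)%:R : R) <= (minn J j0)%:R.
    elim: J => [|J IH]; first by rewrite big_nil min0n.
    rewrite -[in iota _ _]addn1 iotaD big_cat big_seq1 add0n/=.
    by apply: le_trans (lerD IH (lexx _)) _; rewrite -natrD ler_nat; case: ltnP; lia.
  by move=> /le_trans; apply; rewrite ler_nat geq_minr.
apply: (@le_trans _ _ (\sum_(j <- iota 0 J)
    (e' * two_sided n (j + m0) + (j < j0)%:R * k ^+ n0))).
  apply: ler_sum => j _; have [jj0|jj0] := ltnP j j0; last first.
    rewrite mul0r addr0 ler_wpM2r ?two_sided_ge0// ltW//; exact: hj0.
  rewrite mul1r; apply: ler_wpDl; first by rewrite mulr_ge0 ?two_sided_ge0 ?ltW.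
  rewrite -[leRHS]mul1r ler_pM ?two_sided_ge0 ?harmonic_ge0//.
    by rewrite /harmonic invf_le1 ?ler1n ?ltr0n.
  rewrite /two_sided ler_wiXn2l ?ltW//; lia.
rewrite big_split/= -mulr_sumr -mulr_suml.
have h1 := sum_two_sided n m0 J; have h2 := hn0 n0 (leqnn _).
have hk : 0 <= k ^+ n0 by rewrite exprn_ge0// ltW.
have : e' * (\sum_(j <- iota 0 J) two_sided n (j + m0)) <= eps / 2.
  rewrite /e'; nra.
move: hd; set S := \sum_(j <- iota 0 J) _; nra.
Qed.

End TwoSided.

Lemma PV_parameters (a : R) : PV_number a -> exists e t : nat -> R,
  [/\ forall j, 0 <= e j <= 1,
      forall M, exists J, M <= \sum_(j <- iota 0 J) e j,
      forall i j, cos (t i + t j) != 1,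
      forall i j, i != j -> cos (t i - t j) != 1 &
      forall eps, 0 < eps -> \forall n \near \oo, forall J,
        \sum_(j <- iota 0 J) e j * `|sin ((nearest_int (a ^+ n))%:~R * t j / 2)| <= eps].
Proof.
move=> PVa; have [C [k [C1 k01 ak hC]]] := PV_nearest_dist PVa.
have [a1 _ _] := PVa; have a0 : 0 < a by apply: lt_trans a1.
have [k0 k1] := andP k01.
have ai01 : 0 < a^-1 < 1 by rewrite invr_gt0 a0 invf_lt1.
have [ai0 ai1] := andP ai01.
(* The exponents start at [m0]: angles below [pi] have sums, and differences when distinct, that are
   nonzero and smaller than [2 pi] in absolute value. *)
have [m0 _ hm0] : \forall m \near \oo, a^-1 ^+ m < 1 / 2.
  apply: (cvgr_lt (0 : R)); last by lra.
  by apply: cvg_expr; rewrite gtr0_norm.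
pose th j := a^-1 ^+ (j + m0).
have th0 j : 0 < th j by rewrite exprn_gt0.
have th2 j : th j < 1 / 2 by apply: hm0; rewrite /= leq_addl.
have pi0 := pi_gt0 R.
have pi2 : 0 < pi *+ 2 :> R by rewrite mulr2n addr_gt0.
exists harmonic, (fun j => pi *+ 2 * th j); split.
- move=> j; rewrite harmonic_ge0 /harmonic invf_le1 ?ler1n ?ltr0n//.
- exact: harmonic_sum_unbounded.
- move=> i j; rewrite -mulrDr; apply: cos_neq1; move: (th2 i) (th2 j) (th0 i) (th0 j).
  move: (th i) (th j) => x y *; rewrite gtr0_norm ?mulr_gt0// ?addr_gt0//.
  rewrite gtr_pMr//; lra.
- move=> i j ij; rewrite -mulrBr; apply: cos_neq1.
  rewrite normrM (gtr0_norm pi2)// pmulr_rgt0// gtr_pMr//.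
  have -> : `|th i - th j| < 1.
    have := th2 i; have := th2 j; have := th0 i; have := th0 j.
    by case: (ger0P (th i - th j)); lra.
  rewrite andbT.
  rewrite normr_gt0 subr_eq0; move: ij; have [ij|ij|//] := ltngtP i j => _.
    by rewrite gt_eqF// /th ltr_iXn2l// ltn_add2r.
  by rewrite lt_eqF// /th ltr_iXn2l// ltn_add2r.
move=> eps eps0.
have D0 : 0 < eps / (2 * pi * C).
  by rewrite divr_gt0// !mulr_gt0//; apply: lt_le_trans C1.
apply: filterS (harmonic_two_sided k01 m0 D0) => n hn J.
have key m : `|sin (pi * ((nearest_int (a ^+ n))%:~R * a^-1 ^+ m))| <=
    2 * pi * C * two_sided k n m.
  rewrite [2 * pi]mulrC -!mulrA.
  have C0 : 0 <= C by apply: le_trans C1.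
  have kX i : 0 <= k ^+ i by rewrite exprn_ge0// ltW.
  have aiX i : 0 <= a^-1 ^+ i <= k ^+ i.
    by rewrite exprn_ge0 ?lerXn2r ?nnegrE// ltW.
  have kXle i j : (j <= i)%N -> k ^+ i <= k ^+ j by move=> ji; rewrite ler_wiXn2l// ltW.
  have split1 (z : R) : `|(nearest_int (a ^+ n))%:~R * a^-1 ^+ m - z| <=
      C * k ^+ n * a^-1 ^+ m + `|a ^+ n * a^-1 ^+ m - z|.
    have -> : (nearest_int (a ^+ n))%:~R * a^-1 ^+ m - z =
      ((nearest_int (a ^+ n))%:~R - a ^+ n) * a^-1 ^+ m + (a ^+ n * a^-1 ^+ m - z) by ring.
    rewrite (le_trans (ler_normD _ _))// lerD2r normrM.
    rewrite [X in _ * X]ger0_norm; last by case/andP: (aiX m).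
    by rewrite distrC ler_wpM2r//; case/andP: (aiX m).
  (* For [m <= n] the argument is near [pi * a ^+ (n - m)], itself near a multiple of [pi]; for
     [n < m] it is near [pi * a^-1 ^+ (m - n)], which is small. *)
  have [mn|nm] := leqP m n.
    apply: le_trans (sin_pi_le _ (nearest_int (a ^+ (n - m)))) _.
    rewrite ler_pM2l// (le_trans (split1 _))//.
    have -> : a ^+ n * a^-1 ^+ m = a ^+ (n - m).
      by rewrite -{1}(subnK mn) exprD exprVn mulfK// expf_neq0// gt_eqF.
    have := hC (n - m)%N.
    have : C * k ^+ n * a^-1 ^+ m <= C * k ^+ (n - m).
      rewrite -mulrA ler_wpM2l// (@le_trans _ _ (k ^+ n))//.
        by rewrite ler_piMr// exprn_ile1// ltW.
      by apply: kXle; exact: leq_subr.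
    have -> : two_sided k n m = k ^+ (n - m).
      by rewrite /two_sided (eqP mn) addn0.
    lra.
  apply: le_trans (sin_pi_le _ 0) _.
  rewrite ler_pM2l// (le_trans (split1 _))// subr0.
  have -> : two_sided k n m = k ^+ (m - n).
    by rewrite /two_sided (eqP (ltnW nm)) add0n.
  have -> : a ^+ n * a^-1 ^+ m = a^-1 ^+ (m - n).
    rewrite -{1}(subnK (ltnW nm)) exprD mulrCA -exprMn mulfV ?gt_eqF//.
    by rewrite expr1n mulr1.
  rewrite ger0_norm; last by case/andP: (aiX (m - n)%N).
  have : C * k ^+ n * a^-1 ^+ m <= C * k ^+ (m - n).
    rewrite -mulrA ler_wpM2l// (@le_trans _ _ (1 * k ^+ m))//.
      have /andP[? ?] := aiX m.
      by apply: ler_pM => //; rewrite exprn_ile1// ltW.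
    by rewrite mul1r kXle// leq_subr.
  have : a^-1 ^+ (m - n) <= C * k ^+ (m - n).
    rewrite -[leLHS]mul1r ler_pM//; by case/andP: (aiX (m - n)%N).
  lra.
apply: (@le_trans _ _ (\sum_(j <- iota 0 J)
    2 * pi * C * ((harmonic j : R) * two_sided k n (j + m0)))).
  apply: ler_sum => j _; rewrite [leRHS]mulrCA ler_wpM2l ?harmonic_ge0//.
  rewrite (_ : _ * (_ * th j) / 2 = pi * ((nearest_int (a ^+ n))%:~R * th j)).
    exact: key.
  by field.
rewrite -mulr_sumr -ler_pdivlMl ?mulr_gt0 ?(lt_le_trans _ C1)// mulrC.
exact: hn.
Qed.

End PVRotations.

(** * Coding a process by the unit interval *)

Definition image_space d (U : measurableType d) (T : Type) (f : U -> T)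
  (D : set U) (mD : measurable D) := T.

Section ImageSpace.
Context d (U : measurableType d) (T : pointedType) (f : U -> T) (D : set U).
Local Open Scope classical_set_scope.

Variable mD : measurable D.

(** The largest sigma-algebra that makes [f] measurable on [D]. With this choice the image of a
    complete measure is complete. *)
Definition image_measurable : set (set T) := [set A | measurable (D `&` f @^-1` A)].

Let image_measurable0 : image_measurable set0.
Proof. by rewrite /image_measurable/= preimage_set0 setI0. Qed.

Let image_measurableC A : image_measurable A -> image_measurable (~` A).
Proof.
rewrite /image_measurable/= preimage_setC => mA.
have -> : D `&` ~` (f @^-1` A) = D `\` (D `&` f @^-1` A).
  by rewrite setDIr setDv set0U setDE.
exact: measurableD.
Qed.

Let image_measurable_bigcup (F : (set T)^nat) :
  (forall i, image_measurable (F i)) -> image_measurable (\bigcup_i (F i)).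
Proof.
rewrite /image_measurable/= preimage_bigcup setI_bigcupr => mF.
exact: bigcupT_measurable.
Qed.

Definition image_display : (U -> T) -> set U -> measure_display.
Proof. exact. Qed.

HB.instance Definition _ := Pointed.on (image_space f mD).
HB.instance Definition _ := @isMeasurable.Build (image_display f D)
  (image_space f mD) image_measurable image_measurable0 image_measurableC
  image_measurable_bigcup.

Context (R : realType) (mu : {measure set U -> \bar R}).

Definition image_measure (A : set (image_space f mD)) : \bar R := mu (D `&` f @^-1` A).

Let image_measure0 : image_measure set0 = 0%E.
Proof. by rewrite /image_measure preimage_set0 setI0 measure0. Qed.

Let image_measure_ge0 A : (0 <= image_measure A)%E.
Proof. exact: measure_ge0. Qed.

Let image_measure_sigma_additive : semi_sigma_additive image_measure.
Proof.
move=> F mF tF mUF; rewrite /image_measure preimage_bigcup setI_bigcupr.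
apply: measure_semi_sigma_additive.
- exact: mF.
- apply/trivIsetP => i j _ _ ij; rewrite setIACA setIid -preimage_setI.
  by move/trivIsetP : tF => ->//; rewrite preimage_set0 setI0.
- by rewrite -setI_bigcupr -preimage_bigcup.
Qed.

HB.instance Definition _ := isMeasure.Build _ _ _ image_measure
  image_measure0 image_measure_ge0 image_measure_sigma_additive.

End ImageSpace.
Arguments image_measure {d U T} f {D} mD {R} mu A.

Lemma image_measure_complete d (U : measurableType d) (T : pointedType) (f : U -> T)
    (D : set U) (mD : measurable D) (R : realType) (mu : {measure set U -> \bar R}) :
  measure_is_complete mu -> measure_is_complete (image_measure f mD mu).
Proof.
move=> cmu N [A [mA A0 NA]]; apply: cmu; exists (D `&` f @^-1` A)%classic; split => //.
by move=> x [Dx Nfx]; split => //; exact: NA.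
Qed.

Section CodedInterval.
Variable (R : realType) (T : pointedType).
Local Open Scope classical_set_scope.

Definition leb_space := caratheodory_type (@wlength R idfun)^*%mu.

(** Half-open intervals are cut into disjoint intervals of the same kind. *)
Definition unit_itv : set leb_space := `[(0 : R), 1[.

Lemma borel_measurable_leb (A : set R) : measurable A -> measurable (A : set leb_space).
Proof. by move=> mA; apply: sub_caratheodory. Qed.

Lemma measurable_unit_itv : measurable unit_itv.
Proof. by apply: borel_measurable_leb; exact: measurable_itv. Qed.

Lemma completed_lebesgue_itvco (a b : R) : a <= b ->
  @completed_lebesgue_measure R `[a, b[ = (b - a)%:E.
Proof.
move=> ab; transitivity (@lebesgue_measure R `[a, b[); first by [].
rewrite lebesgue_measure_itv/= lte_fin; case: ltP => // ba.
by have -> : a = b; [apply/le_anti/andP|rewrite subrr].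
Qed.

Variable f : leb_space -> T.

Definition coded_space := image_space f measurable_unit_itv.
Definition coded_measure : set coded_space -> \bar R :=
  image_measure f measurable_unit_itv (@completed_lebesgue_measure R).

HB.instance Definition _ := Measurable.on coded_space.
HB.instance Definition _ := Measure.on coded_measure.

Lemma coded_measure_setT : coded_measure setT = 1%E.
Proof.
rewrite /coded_measure /image_measure preimage_setT setIT.
by rewrite [LHS](@completed_lebesgue_itvco 0 1) ?subr0.
Qed.

HB.instance Definition _ :=
  Measure_isProbability.Build _ _ _ coded_measure coded_measure_setT.

Lemma coded_Lebesgue_space : {in unit_itv &, injective f} ->
  nonatomic_Lebesgue_space (coded_measure : probability coded_space R).
Proof.
move=> finj; split.
  exact/image_measure_complete/completed_lebesgue_measure_is_complete.
have fK : {in unit_itv, cancel f (pinv unit_itv f)} by exact: pinvKV.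
exists (f @` unit_itv), unit_itv, (pinv unit_itv f).
(* On the range of [f], images under its inverse are preimages under [f]; the definitions of the
   sigma-algebra and of the measure then say that this inverse is an isomorphism. *)
have imE (A : set T) : A `<=` f @` unit_itv ->
    pinv unit_itv f @` A = unit_itv `&` f @^-1` A.
  move=> Af; apply/seteqP; split=> [_ [z Az <-]|x [Dx Afx]].
    have [x Dx xz] := Af _ Az.
    by rewrite -xz fK ?inE//; split => //=; rewrite xz.
  by exists (f x) => //; rewrite fK ?inE.
have preim : unit_itv `&` f @^-1` (f @` unit_itv) = unit_itv.
  by apply/seteqP; split=> [x []//|x Dx]; split => //; exists x.
split.
- split.
    change (measurable (unit_itv `&` f @^-1` (f @` unit_itv))).
    by rewrite preim; exact: measurable_unit_itv.
  rewrite -[LHS]/(completed_lebesgue_measure (unit_itv `&` f @^-1` (f @` unit_itv))) preim.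
  by rewrite [LHS](@completed_lebesgue_itvco 0 1) ?subr0.
- split; first exact: measurable_unit_itv.
    by apply: subset_itvl; rewrite bnd_simp.
  by rewrite [LHS](@completed_lebesgue_itvco 0 1) ?subr0.
- split=> [_ [x Dx <-]|_ _ /set_mem[x Dx <-] /set_mem[y Dy <-]|x Dx].
  + by rewrite fK ?inE.
  + by rewrite !fK ?inE// => ->.
  + by exists (f x); [exists x|rewrite fK ?inE].
- by move=> A /imE ->.
- by move=> A /imE ->.
Qed.

End CodedInterval.
Arguments coded_measure {R T} f _.

Section IntegerEnumeration.

Definition int_index (g : int) : nat :=
  match g with Posz n => n.*2 | Negz n => n.*2.+1 end.

Definition int_enum (n : nat) : int := if odd n then Negz n./2 else Posz n./2.

Lemma int_indexK : cancel int_index int_enum.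
Proof.
case=> n; rewrite /int_enum /= ?odd_double ?doubleK//.
by rewrite /= uphalf_double.
Qed.

Lemma int_enumK : cancel int_enum int_index.
Proof.
move=> n; rewrite /int_enum; have := odd_double_half n.
by case: (odd n) => /= <-; rewrite ?add1n ?add0n//= ?doubleK// uphalf_double.
Qed.

End IntegerEnumeration.

(** * Successive cutting of the unit interval *)

Section Coding.
Variables (R : realType) (v : {fset int} -> R).
Hypotheses (cv : completely_monotone v) (v0 : v fset0 = 1).

(* The cylinder of the configurations that are 1 on [ones] and 0 on the
   singletons in [zeros] is coded by an interval with left end point [lend]. *)
Record cylinder := Cylinder
  { lend : R; ones : {fset int}; zeros : seq {fset int} }.

Definition mass (c : cylinder) : R := nabs (zeros c) v (ones c).

Definition split_step (c : cylinder) (n : nat) (b : bool) :=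
  let c1 := Cylinder (lend c) (int_enum n |` ones c) (zeros c) in
  if b then c1
  else Cylinder (lend c + mass c1) (ones c) ([fset int_enum n] :: zeros c).

Fixpoint split_along (b : nat -> bool) (n : nat) : cylinder :=
  if n is m.+1 then split_step (split_along b m) m (b m) else Cylinder 0 fset0 [::].

Definition bit_of (x : R) (c : cylinder) (n : nat) : bool :=
  x < lend c + mass (split_step c n true).

Fixpoint split_at (x : R) (n : nat) : cylinder :=
  if n is m.+1 then split_step (split_at x m) m (bit_of x (split_at x m) m)
  else Cylinder 0 fset0 [::].

(** For fair independent coordinates these would be the complemented binary digits of [x], as the
    coordinate 1 is on the left. *)
Definition digit (x : R) (n : nat) := bit_of x (split_at x n) n.

Lemma split_atE x n : split_at x n = split_along (digit x) n.
Proof. by elim: n => //= n <-. Qed.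

Lemma eq_split_along b b' n : (forall i, (i < n)%N -> b i = b' i) -> split_along b n = split_along b' n.
Proof.
elim: n => //= n IH bb'; rewrite IH ?bb'// => i ilt; apply: bb'; exact: ltnW.
Qed.

Lemma mass_ge0 c : 0 <= mass c.
Proof. exact: cv. Qed.

Lemma mass_step c n : mass (split_step c n true) + mass (split_step c n false) = mass c.
Proof. by rewrite /split_step /mass /= nabs_nab addrC subrK. Qed.

Definition rend c := lend c + mass c.

Lemma lend_step c n b : lend c <= lend (split_step c n b).
Proof. by case: b => //=; rewrite lerDl mass_ge0. Qed.

Lemma rend_step c n b : rend (split_step c n b) <= rend c.
Proof.
rewrite /rend -(mass_step c n); case: b => /=.
  by rewrite lerD2l lerDl mass_ge0.
by rewrite addrA.
Qed.

Lemma mem_step x c n b :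
  (lend (split_step c n b) <= x < rend (split_step c n b)) =
  (lend c <= x < rend c) && (bit_of x c n == b).
Proof.
rewrite /rend /bit_of -(mass_step c n).
have := mass_ge0 (split_step c n true); have := mass_ge0 (split_step c n false).
case: b => /=; set m1 := mass (Cylinder _ (_ |` _) _); set m0 := mass (Cylinder (_ + _) _ _) => m00 m10.
  by case: ltP => /=; case: leP => //= ? ?; rewrite ?andbT ?andbF//; lra.
by case: (ltP x (lend c + m1)) => /= ?; case: leP => //= ?; rewrite ?andbF ?andbT ?addrA//; lra.
Qed.

Lemma split_along_digit x b n : 0 <= x < 1 ->
  (lend (split_along b n) <= x < rend (split_along b n)) <-> (forall i, (i < n)%N -> digit x i = b i).
Proof.
move=> x01; elim: n => [|n IH].
  by rewrite /rend /= add0r /mass /= v0; split.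
rewrite /= mem_step; split.
  move=> /andP[/IH h bn] i; rewrite ltnS leq_eqVlt => /orP[/eqP->|]; last exact: h.
  by rewrite /digit split_atE (eq_split_along h); apply/eqP.
move=> h; have h' i : (i < n)%N -> digit x i = b i by move=> ilt; apply: h; exact: ltnW.
by rewrite (IH.2 h')/= -(h n (ltnSn n)) /digit split_atE (eq_split_along h').
Qed.

Lemma lend_mono b n m : (n <= m)%N -> lend (split_along b n) <= lend (split_along b m).
Proof.
move=> /subnK <-; elim: (m - n)%N => //= k IH; exact: le_trans (lend_step _ _ _).
Qed.

Lemma rend_mono b n m : (n <= m)%N -> rend (split_along b m) <= rend (split_along b n).
Proof.
move=> /subnK <-; elim: (m - n)%N => //= k IH; exact: le_trans (rend_step _ _ _) _.
Qed.

Lemma mem_ones b n g : (g \in ones (split_along b n)) = (int_index g < n)%N && b (int_index g).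
Proof.
elim: n g => [|n IH] g /=; first by rewrite inE.
rewrite ltnS leq_eqVlt /split_step; have [->|gn] := eqVneq g (int_enum n).
  rewrite int_enumK eqxx /=; case: (b n) => /=; first by rewrite in_fset1U eqxx.
  by rewrite IH int_enumK ltnn.
have -> : (int_index g == n) = false.
  by apply: contra_neqF gn => /eqP <-; rewrite int_indexK.
by case: (b n) => /=; rewrite ?in_fset1U ?(negbTE gn) /= IH.
Qed.

Lemma mem_zeros b n g : (int_index g < n)%N -> ~~ b (int_index g) ->
  [fset g] \in zeros (split_along b n).
Proof.
elim: n => //= n IH; rewrite ltnS leq_eqVlt => /orP[/eqP <-|gn] bg; rewrite /split_step.
  by rewrite (negbTE bg)/= int_indexK inE eqxx.
by case: (b n) => /=; rewrite ?inE IH ?orbT.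
Qed.

End Coding.

(** * The law of the coded process *)

Section CodedProcess.
Variables (R : realType) (v : {fset int} -> R).
Hypotheses (cv : completely_monotone v) (v0 : v fset0 = 1).
Local Open Scope classical_set_scope.

Notation config := (int -> bool).

Definition unfold_config (x : leb_space R) : config := fun g => digit v x (int_index g).

Definition process_space := coded_space unfold_config.
HB.instance Definition _ := Measurable.on process_space.
Definition process_law : probability process_space R := coded_measure unfold_config.

Implicit Types (y z : config) (U : {fset int}).

Definition agree n y z := forall i, (i < n)%N -> y (int_enum i) = z (int_enum i).

Definition cyl z n : set config := [set y | agree n y z].

Definition interval_of z n := split_along v (z \o int_enum) n.

Definition upd z k b : config := fun g => if int_index g == k then b else z g.

Lemma upd_enum z k b i : upd z k b (int_enum i) = if i == k then b else z (int_enum i).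
Proof. by rewrite /upd int_enumK. Qed.

Lemma unfold_config_cyl z n : @unit_itv R `&` unfold_config @^-1` cyl z n =
  `[lend (interval_of z n), rend v (interval_of z n)[.
Proof.
have E x i : unfold_config x (int_enum i) = digit v x i by rewrite /unfold_config int_enumK.
apply/seteqP; split=> x /=; rewrite /unit_itv/= !in_itv/=.
  by move=> [x01 h]; apply/split_along_digit => // i /h; rewrite E.
move=> xlr.
have x01 : 0 <= x < 1.
  have /andP[xl xr] := xlr; apply/andP; split.
    by apply: le_trans xl; exact: (lend_mono cv (z \o int_enum) (leq0n n)).
  apply: lt_le_trans xr _; apply: le_trans (rend_mono cv (z \o int_enum) (leq0n n)) _.
  by rewrite /rend /mass/= v0 add0r.
by split => // i ilt; rewrite E; move: i ilt; apply/split_along_digit.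
Qed.

Lemma lend_le_rend z n : lend (interval_of z n) <= rend v (interval_of z n).
Proof. by rewrite lerDl mass_ge0. Qed.

Lemma measurable_cyl z n : measurable (cyl z n : set process_space).
Proof.
change (measurable (@unit_itv R `&` unfold_config @^-1` cyl z n)); rewrite unfold_config_cyl.
by apply: borel_measurable_leb; exact: measurable_itv.
Qed.

Lemma process_law_cyl z n : process_law (cyl z n) = (mass v (interval_of z n))%:E.
Proof.
rewrite -[LHS]/(completed_lebesgue_measure (@unit_itv R `&` unfold_config @^-1` cyl z n)).
rewrite unfold_config_cyl [LHS](completed_lebesgue_itvco (lend_le_rend z n)).
by rewrite /rend addrC addKr.
Qed.

Lemma cylS z k : cyl z k = cyl (upd z k true) k.+1 `|` cyl (upd z k false) k.+1.
Proof.
have E y b : y (int_enum k) = b -> agree k y z -> agree k.+1 y (upd z k b).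
  move=> yk yz i; rewrite ltnS leq_eqVlt upd_enum; have [->//|_ /=] := eqVneq i k.
  exact: yz.
have E' y b : agree k.+1 y (upd z k b) -> agree k y z.
  by move=> yz i ik; rewrite yz ?upd_enum ?(ltn_eqF ik)// ltnW.
apply/seteqP; split=> [y yz|y [/E'//|/E'//]].
by case yk : (y (int_enum k)); [left|right]; exact: E.
Qed.

Lemma cyl_disjoint z k : cyl (upd z k true) k.+1 `&` cyl (upd z k false) k.+1 = set0.
Proof.
rewrite -subset0 => y [/(_ k (ltnSn k))]; rewrite upd_enum eqxx => yk.
by move=> /(_ k (ltnSn k)); rewrite upd_enum eqxx yk.
Qed.

Lemma interval_of_upd z k b :
  interval_of (upd z k b) k.+1 = split_step v (interval_of z k) k b.
Proof.
rewrite /interval_of /= upd_enum eqxx; congr split_step; apply: eq_split_along => i ik /=.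
by rewrite upd_enum (ltn_eqF ik).
Qed.

(** Backward induction on the binary tree of cylinders, from the leaves at depth [n] to the root. *)
Lemma cyl_ind n (P : config -> nat -> Prop) : (forall z, P z n) ->
  (forall z k, P (upd z k true) k.+1 -> P (upd z k false) k.+1 -> P z k) ->
  forall z, P z 0%N.
Proof.
move=> Pn PS; suff H k z : (k <= n)%N -> P z (n - k)%N by move=> z; rewrite -(subnn n); exact: H.
elim: k z => [|k IH] z kn; first by rewrite subn0.
have E : (n - k = (n - k.+1).+1)%N by rewrite subnSK.
by apply: PS; rewrite -E; apply: IH; exact: ltnW.
Qed.

Definition depends_on n (S : set config) := forall y z, agree n y z -> S y -> S z.

Lemma cyl0 z : cyl z 0 = setT.
Proof. by apply/seteqP; split. Qed.

Lemma depends_on_sigma (H : set (set config)) n S : sigma_algebra setT H ->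
  (forall z k, H (cyl z k)) -> depends_on n S -> H S.
Proof.
move=> [H0 HC HU] Hcyl Sn.
suff : forall z, H (cyl z 0 `&` S).
  by move=> /(_ (fun=> true)); rewrite cyl0 setTI.
apply: (@cyl_ind n (fun z k => H (cyl z k `&` S))) => [z|z k H1 H2].
  have [Sz|Sz] := pselect (S z).
    have -> // : cyl z n `&` S = cyl z n.
    by apply/seteqP; split=> [y []//|y yz]; split => //; apply: Sn Sz => i /yz.
  have -> // : cyl z n `&` S = set0.
  by rewrite -subset0 => y [yz /(Sn _ _ yz)].
rewrite cylS setIUl -bigcup2E; apply: HU => -[|[|i]] //.
Qed.

Definition all_ones U : set config := [set z | forall g, g \in U -> z g].

Definition all_ones_sets : set (set config) := range all_ones.

(** The product sigma-algebra, which does not depend on [v]. The complete one of [process_space]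
    contains it; results are proved here by generation and then transferred modulo null sets. *)
Definition config_space := g_sigma_algebraType all_ones_sets.

Lemma measurable_coordinate g b : @measurable _ config_space [set z | z g = b].
Proof.
have m1 : @measurable _ config_space [set z | z g = true].
  apply: sub_sigma_algebra; exists [fset g]%fset => //.
  by apply/seteqP; split=> z /=; [apply; rewrite inE|move=> zg h; rewrite inE => /eqP ->].
case: b => //; have -> : [set z | z g = false] = ~` [set z : config_space | z g = true].
  by apply/seteqP; split=> z /=; case: (z g).
exact: measurableC.
Qed.

Lemma config_measurable_cyl z n : @measurable _ config_space (cyl z n).
Proof.
elim: n => [|n IH]; first by rewrite cyl0; exact: measurableT.
have -> : cyl z n.+1 = cyl z n `&` [set y | y (int_enum n) = z (int_enum n)].
  apply/seteqP; split=> [y yz|y [yz yn] i].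
    by split=> [i ilt|]; apply: yz => //; exact: ltnW.
  by rewrite ltnS leq_eqVlt => /orP[/eqP->|/yz].
by apply: measurableI => //; exact: measurable_coordinate.
Qed.

Lemma config_measurable_depends n S : depends_on n S -> @measurable _ config_space S.
Proof.
apply: depends_on_sigma; [exact: sigma_algebra_measurable|exact: config_measurable_cyl].
Qed.

Lemma depends_on_all_ones U : exists n,
  depends_on n (all_ones U) /\ forall g, g \in U -> (int_index g < n)%N.
Proof.
pose n := (\max_(g <- U) int_index g).+1.
have lt_n g : g \in U -> (int_index g < n)%N; last first.
  exists n; split => // y z yz yU g gU.
  by rewrite -[g]int_indexK -yz ?int_indexK ?yU// lt_n.
move=> gU; rewrite ltnS; exact: (@leq_bigmax_seq _ (enum_fset U) xpredT int_index g).
Qed.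

Lemma config_measurable_sub : @measurable _ config_space `<=` @measurable _ process_space.
Proof.
apply: smallest_sub; first exact: sigma_algebra_measurable.
move=> _ [U _ <-]; have [n [hn _]] := depends_on_all_ones U.
apply: depends_on_sigma hn; [exact: sigma_algebra_measurable|exact: measurable_cyl].
Qed.

Lemma process_law_all_ones U : process_law (all_ones U) = (v U)%:E.
Proof.
have [n [hn idx]] := depends_on_all_ones U.
have mU : measurable (all_ones U : set process_space).
  apply: config_measurable_sub; exact: config_measurable_depends hn.
(* At depth [n] all coordinates in [U] are decided: either they are all among the ones, or one is a
   zero and [nabs_vanish] makes the mass 0. The identity is additive, so it climbs to the root. *)
pose P z k := process_law (cyl z k `&` all_ones U) =
  (nabs (zeros (interval_of z k)) v (U `|` ones (interval_of z k))%fset)%:E.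
suff : P (fun=> true) 0%N by rewrite /P cyl0 setTI /= fsetU0.
apply: (@cyl_ind n) => [z|z k]; rewrite /P.
  have [zU|/existsNP[g /not_implyP[gU /negP zg]]] := pselect (all_ones U z).
    have -> : cyl z n `&` all_ones U = cyl z n.
      by apply/seteqP; split=> [y []//|y yz]; split => //; apply: hn zU => i /yz.
    have /fsetUidPr -> : (U `<=` ones (interval_of z n))%fset.
      apply/fsubsetP => g gU; rewrite mem_ones idx//= int_indexK; exact: zU.
    exact: process_law_cyl.
  rewrite (nabs_vanish (A := [fset g]%fset)).
  - rewrite (_ : _ `&` _ = set0) ?measure0// -subset0 => y [yz yU].
    have := yU g gU; rewrite -[g]int_indexK yz ?idx//.
    by rewrite int_indexK (negbTE zg).
  - by apply: mem_zeros; rewrite ?idx//= int_indexK.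
  - by rewrite fsub1set inE gU.
rewrite !interval_of_upd (cylS z k) setIUl => H1 H2.
have mc b : measurable (cyl (upd z k b) k.+1 `&` all_ones U : set process_space).
  by apply: measurableI => //; exact: measurable_cyl.
transitivity (process_law (cyl (upd z k true) k.+1 `&` all_ones U) +
              process_law (cyl (upd z k false) k.+1 `&` all_ones U))%E.
  apply: measureU; [exact: (mc true)|exact: (mc false)|].
  by rewrite setIACA setIid cyl_disjoint set0I.
by rewrite H1 H2 -EFinD/= (fsetUCA U) nabs_nab; congr EFin; ring.
Qed.

End CodedProcess.

(** * Shift dynamics *)

Section ShiftDynamics.
Variables (R : realType) (v : {fset int} -> R).
Hypotheses (cv : completely_monotone v) (v0 : v fset0 = 1).
Local Open Scope classical_set_scope.

Notation config := (int -> bool).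
Notation mu := (process_law v).
Notation cmeasurable := (@measurable _ config_space).

Definition pr (A : set config) : R := fine (mu A).

Let sub_meas (A : set config) : cmeasurable A -> measurable (A : set (process_space v)).
Proof. exact: config_measurable_sub. Qed.

Lemma prE (A : set config) : measurable (A : set (process_space v)) -> mu A = (pr A)%:E.
Proof. by move=> mA; rewrite fineK// fin_num_measure. Qed.

Lemma setID_distr (A B C : set config) : A `&` (B `\` C) = (A `&` B) `\` (A `&` C).
Proof.
apply/seteqP; split=> [z [Az [Bz nC]]|z [[Az Bz] nAC]]; first by split => // -[].
by split => //; split => // Cz; apply: nAC.
Qed.

Lemma pr_ge0 (A : set config) : 0 <= pr A.
Proof. exact/fine_ge0/measure_ge0. Qed.

Lemma prD (A B : set config) : measurable (A : set (process_space v)) ->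
  measurable (B : set (process_space v)) -> B `<=` A -> pr (A `\` B) = pr A - pr B.
Proof.
move=> mA mB BA; apply: EFin_inj; rewrite EFinB -!prE//; last exact: measurableD.
rewrite measureD//; first by rewrite setIidr.
by rewrite ltey_eq fin_num_measure.
Qed.

Lemma le_pr (A B : set config) : measurable (A : set (process_space v)) ->
  measurable (B : set (process_space v)) -> A `<=` B -> pr A <= pr B.
Proof. by move=> mA mB AB; rewrite -lee_fin -!prE// le_measure ?inE. Qed.

Lemma prT : pr setT = 1.
Proof. by rewrite /pr probability_setT. Qed.

Lemma pr_le1 (A : set config) : measurable (A : set (process_space v)) -> pr A <= 1.
Proof. by move=> mA; rewrite -prT le_pr//; exact: measurableT. Qed.

Lemma pr_all_ones U : pr (all_ones U) = v U.
Proof. by rewrite /pr process_law_all_ones. Qed.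

Lemma pr_nondecreasing (F : (set config)^nat) :
  (forall i, measurable (F i : set (process_space v))) -> nondecreasing_seq F ->
  pr (F i) @[i --> \oo] --> pr (\bigcup_i F i).
Proof.
move=> mF ndF; have mU : measurable (\bigcup_i F i : set (process_space v)).
  exact: bigcupT_measurable.
have : mu (F i) @[i --> \oo] --> (pr (\bigcup_i F i))%:E.
  by rewrite -prE//; exact: nondecreasing_cvg_mu.
by move=> /fine_cvgP[].
Qed.

(** Dynkin's theorem, as the sets [all_ones U] are closed under intersection. *)
Lemma config_pi_lambda (H : set (set config)) : (forall U, H (all_ones U)) ->
  (forall A B, cmeasurable A -> cmeasurable B -> B `<=` A -> H A -> H B -> H (A `\` B)) ->
  (forall F : (set config)^nat, (forall i, cmeasurable (F i)) -> nondecreasing_seq F ->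
    (forall i, H (F i)) -> H (\bigcup_i F i)) ->
  forall A, cmeasurable A -> H A.
Proof.
move=> H1 HD HU A mA; pose H' := [set A | cmeasurable A /\ H A].
suff : <<s all_ones_sets >> `<=` H' by move=> /(_ A mA)[].
apply: (lambda_system_subset (G := all_ones_sets)).
- move=> _ _ [U _ <-] [V _ <-]; exists (U `|` V)%fset => //.
  apply/seteqP; split=> [z zUV|z [zU zV] g].
    by split=> g gU; apply: zUV; rewrite inE gU ?orbT.
  by rewrite inE => /orP[/zU|/zV].
- split => //.
  + split; first exact: measurableT.
    have -> : setT = all_ones fset0 by apply/seteqP; split=> // z _ g; rewrite inE.
    exact: H1.
  + by move=> B C CB [mB HB] [mC HC]; split; [exact: measurableD|exact: HD].
  + move=> F ndF mHF; split; first by apply: bigcupT_measurable => i; case: (mHF i).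
    by apply: HU => // i; case: (mHF i).
- move=> _ [U _ <-]; split => //; apply: sub_sigma_algebra; by exists U.
- by [].
Qed.

Definition tr (g : int) (z : config) : config := fun h => z (h - g).

Lemma tr0 : tr 0 = id.
Proof. by apply/funext => z; apply/funext => h; rewrite /tr subr0. Qed.

Lemma trD g h : tr (g + h) = tr g \o tr h.
Proof.
by apply/funext => z; apply/funext => k; rewrite /tr /= opprD addrA.
Qed.

Lemma trK g : cancel (tr g) (tr (- g)).
Proof. by move=> z; rewrite -[LHS]/((tr (- g) \o tr g) z) -trD addNr tr0. Qed.

Lemma image_tr g A : tr g @` A = tr (- g) @^-1` A.
Proof.
apply/seteqP; split=> [_ [z Az <-]|z Az]; first by rewrite /= trK.
by exists (tr (- g) z) => //; rewrite -{1}[g]opprK trK.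
Qed.

Lemma preimage_tr_all_ones g U : tr g @^-1` all_ones U = all_ones (fshift (- g) U).
Proof.
apply/seteqP; split=> z zU h.
  by rewrite mem_fshift opprK => /zU; rewrite /tr addrK.
by move=> hU; apply: zU; rewrite mem_fshift opprK subrK.
Qed.

Lemma preimage_tr_setD g A B : tr g @^-1` (A `\` B) = tr g @^-1` A `\` tr g @^-1` B.
Proof. by []. Qed.

Lemma cmeasurable_all_ones U : cmeasurable (all_ones U).
Proof. by apply: sub_sigma_algebra; exists U. Qed.

Lemma cmeasurable_tr g A : cmeasurable A -> cmeasurable (tr g @^-1` A).
Proof.
move: A; apply: config_pi_lambda => [U|A B mA mB _ hA hB|F mF _ hF].
- by rewrite preimage_tr_all_ones; exact: cmeasurable_all_ones.
- by rewrite preimage_tr_setD; exact: measurableD.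
- by rewrite preimage_bigcup; exact: bigcupT_measurable.
Qed.

Hypothesis vS : shift_invariant v.

Lemma pr_tr g A : cmeasurable A -> pr (tr g @^-1` A) = pr A.
Proof.
move: A; apply: config_pi_lambda => [U|A B mA mB BA hA hB|F mF ndF hF].
- by rewrite preimage_tr_all_ones !pr_all_ones vS.
- have BA' : tr g @^-1` B `<=` tr g @^-1` A by move=> z /BA.
  have := prD (sub_meas (cmeasurable_tr g mA)) (sub_meas (cmeasurable_tr g mB)) BA'.
  by rewrite hA hB -(prD (sub_meas mA) (sub_meas mB) BA).
- have h1 := pr_nondecreasing (fun i => sub_meas (mF i)) ndF.
  have ndG : nondecreasing_seq (fun i => tr g @^-1` F i).
    by move=> i j /ndF/subsetPset ij; apply/subsetPset => z /ij.
  have h2 := pr_nondecreasing (fun i => sub_meas (cmeasurable_tr g (mF i))) ndG.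
  rewrite -preimage_bigcup in h2.
  apply: (cvg_unique _ h2) => //; rewrite (_ : (fun i => _) = fun i => pr (F i))//.
  by apply/funext.
Qed.

(** [c] stands for a covariance with one event fixed, so that the same closure argument serves both
    arguments. The bound by [pr A] is uniform in [g], which allows the passage to increasing
    unions. *)
Lemma mixing_closure (Phi : nat -> {fset int}) (c : set config -> int -> R) :
  Folner R Phi ->
  (forall A B g, cmeasurable A -> cmeasurable B -> B `<=` A ->
    c (A `\` B) g = c A g - c B g) ->
  (forall A g, cmeasurable A -> `|c A g| <= pr A) ->
  (forall U, favg (Phi N) (fun g => `|c (all_ones U) g|) @[N --> \oo] --> (0 : R)) ->
  forall A, cmeasurable A -> favg (Phi N) (fun g => `|c A g|) @[N --> \oo] --> (0 : R).
Proof.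
move=> FPhi cD cle cU; apply: config_pi_lambda => // [A B mA mB BA hA hB|F mF ndF hF].
  apply: (@squeeze_cvgr _ _ _ _ (fun=> 0) (fun N => favg (Phi N) (fun g => `|c A g|) +
    favg (Phi N) (fun g => `|c B g|))); [|exact: cvg_cst|]; last first.
    by rewrite -[X in _ --> X]addr0; exact: cvgD.
  apply: nearW => N; rewrite favg_ge0//= -favgD; apply: le_favg => g.
  by rewrite cD//; exact: ler_normB.
have mU : cmeasurable (\bigcup_i F i) by exact: bigcupT_measurable.
apply/cvgrPdist_le => e e0; have e2 : 0 < e / 2 by rewrite divr_gt0.
have := pr_nondecreasing (fun i => sub_meas (mF i)) ndF.
move=> /cvgrPdist_le/(_ _ e2)[i _ /(_ i (leqnn i))/= hi].
have FiF : F i `<=` \bigcup_i F i by exact: bigcup_sup.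
have := hF i; move=> /cvgrPdist_le/(_ _ e2); apply: filterS => N.
rewrite !sub0r !normrN !ger0_norm ?favg_ge0// => hN.
rewrite [e]splitr; apply: le_trans (lerD hN (lexx (e / 2))).
rewrite -[e / 2](favg_cst _ (FPhi.1 N)) -favgD; apply: le_favg => g.
have -> : c (\bigcup_i F i) g = c (F i) g + c (\bigcup_i F i `\` F i) g.
  by rewrite cD// addrC subrK.
rewrite (le_trans (ler_normD _ _))// lerD2l (le_trans (cle _ _ _))//.
  exact: measurableD.
rewrite prD//; [|exact: sub_meas|exact: sub_meas].
by rewrite (le_trans (ler_norm _)).
Qed.

Hypothesis vmix : forall U V Phi, Folner R Phi ->
  favg (Phi N) (fun x => `|v (U `|` fshift x V)%fset - v U * v V|) @[N --> \oo] --> (0 : R).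

Lemma config_mixing (Phi : nat -> {fset int}) A B : Folner R Phi ->
  cmeasurable A -> cmeasurable B ->
  favg (Phi N) (fun g => `|pr (A `&` tr g @` B) - pr A * pr B|) @[N --> \oo] --> (0 : R).
Proof.
move=> FPhi mA; move: B.
have mtr g C : cmeasurable C -> cmeasurable (tr g @` C).
  by rewrite image_tr; exact: cmeasurable_tr.
have bound x y a : 0 <= x <= a -> 0 <= y <= a -> `|x - y| <= a :> R.
  by move=> /andP[? ?] /andP[? ?]; rewrite ler_norml; apply/andP; split; lra.
have cmI C E : cmeasurable C -> cmeasurable E -> measurable (C `&` E : set (process_space v)).
  by move=> mC mE; apply: sub_meas; exact: measurableI.
have prM C E : cmeasurable C -> cmeasurable E -> 0 <= pr C * pr E <= pr C.
  move=> mC mE; rewrite mulr_ge0 ?pr_ge0//= ler_piMr ?pr_ge0//; exact/pr_le1/sub_meas.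
apply: (@mixing_closure _ (fun B g => pr (A `&` tr g @` B) - pr A * pr B)) => //.
- move=> B C g mB mC CB; rewrite image_tr preimage_tr_setD -!image_tr setID_distr.
  have sub : A `&` tr g @` C `<=` A `&` tr g @` B.
    by move=> z [Az [w Cw wz]]; split => //; exists w => //; exact: CB.
  rewrite (prD (cmI _ _ mA (mtr g _ mB)) (cmI _ _ mA (mtr g _ mC)) sub).
  by rewrite (prD (sub_meas mB) (sub_meas mC) CB); ring.
- move=> B g mB; apply: bound.
    rewrite pr_ge0/= -(pr_tr (- g) mB) -image_tr.
    by apply: le_pr; [exact: (cmI _ _ mA (mtr g _ mB))|exact: (sub_meas (mtr g _ mB))|exact: subIsetr].
  by rewrite mulrC prM.
(* The second argument is now a generator [all_ones V]; the same closure extends the claim in the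
   first. *)
move=> V; move: A mA.
apply: (@mixing_closure _ (fun A g => pr (A `&` tr g @` all_ones V) - pr A * pr (all_ones V))) => //.
- move=> B C g mB mC CB; rewrite setIC setID_distr !(setIC (tr g @` _)).
  have mV := cmeasurable_all_ones V.
  have sub : C `&` tr g @` all_ones V `<=` B `&` tr g @` all_ones V.
    by move=> z [Cz ?]; split => //; exact: CB.
  rewrite (prD (cmI _ _ mB (mtr g _ mV)) (cmI _ _ mC (mtr g _ mV)) sub).
  by rewrite (prD (sub_meas mB) (sub_meas mC) CB); ring.
- move=> B g mB; apply: bound.
    rewrite pr_ge0/=; apply: le_pr; [|exact: sub_meas|exact: subIsetl].
    exact: (cmI _ _ mB (mtr g _ (cmeasurable_all_ones V))).
  by apply: prM => //; exact: cmeasurable_all_ones.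
move=> U; rewrite !pr_all_ones.
rewrite (_ : (fun N => _) = fun N => favg (Phi N)
  (fun x => `|v (U `|` fshift x V)%fset - v U * v V|)); first exact: vmix.
apply/funext => N; congr favg; apply/funext => g.
have -> : all_ones U `&` tr g @` all_ones V = all_ones (U `|` fshift g V)%fset.
  rewrite image_tr preimage_tr_all_ones opprK.
  apply/seteqP; split=> [z [zU zV] h|z zUV].
    by rewrite inE => /orP[/zU|/zV].
  by split=> h hU; apply: zUV; rewrite inE hU ?orbT.
by rewrite pr_all_ones.
Qed.

Hypothesis v_nontrivial : 0 < v [fset 0] < 1.

Lemma cmeasurable_set1 z : cmeasurable [set z].
Proof.
have -> : [set z] = \bigcap_n cyl z n.
  apply/seteqP; split=> [_ -> n _ //|y yz]; apply/funext => g.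
  by rewrite -[g]int_indexK (yz (int_index g).+1).
by apply: bigcapT_measurable => n; exact: config_measurable_cyl.
Qed.

(** The translate of a singleton is itself or disjoint from it, so its covariance with itself is
    [p - p * p] or [- (p * p)]. Mixing forces one of these to be 0, and [p = 1] is excluded because
    neither value at the coordinate 0 is almost sure. *)
Lemma pr_set1 z : pr [set z] = 0.
Proof.
have mz := cmeasurable_set1 z; set p := pr [set z].
have p01 : 0 <= p <= 1 by rewrite pr_ge0 pr_le1//; exact: sub_meas.
have mixz g : Num.min (p - p * p) (p * p) <= `|pr ([set z] `&` tr g @` [set z]) - p * p|.
  have [gz|gz] := pselect (tr g z = z).
    have -> : [set z] `&` tr g @` [set z] = [set z].
      by apply/seteqP; split=> [y []//|_ ->]; split => //; exists z.
    by rewrite (le_trans _ (ler_norm _))// ge_min lexx.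
  have -> : [set z] `&` tr g @` [set z] = set0.
    by rewrite -subset0 => y [-> [_ -> /gz]].
  by rewrite /pr measure0 sub0r normrN (le_trans _ (ler_norm _))// ge_min lexx orbT.
have hm := config_mixing (Folner_fitv R) mz mz.
have : Num.min (p - p * p) (p * p) <= 0.
  apply: cvgr_to_ge hm _; apply: nearW => N.
  rewrite -[leLHS](favg_cst _ ((Folner_fitv R).1 N)); exact: le_favg.
have m1 := cmeasurable_all_ones [fset 0].
have p1 : p < 1.
  have [z1|z1] := pselect (all_ones [fset 0] z).
    apply: (@le_lt_trans _ _ (v [fset 0])); last by case/andP: v_nontrivial.
    rewrite -pr_all_ones; apply: le_pr; [exact: sub_meas|exact: sub_meas|].
    by move=> _ ->.
  have : p <= 1 - v [fset 0].
    have mD : cmeasurable (setT `\` all_ones [fset 0]).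
      by apply: measurableD => //; exact: measurableT.
    rewrite -prT -pr_all_ones -prD//; last exact: sub_meas.
    by apply: le_pr; [exact: sub_meas|exact: sub_meas|move=> _ ->].
  by case/andP: v_nontrivial; lra.
rewrite ge_min => /orP[h|h].
  have : 0 <= p * (1 - p) by case/andP: p01 => ? ?; rewrite mulr_ge0// subr_ge0 ltW.
  have [//|p0] := eqVneq p 0.
  have : 0 < p * (1 - p).
    by case/andP: p01 => ? ?; rewrite mulr_gt0 ?subr_gt0// lt_neqAle eq_sym p0.
  nra.
by apply/eqP; rewrite -sqrf_eq0 expr2 eq_le h mulr_ge0//; case/andP: p01.
Qed.

(** The cylinders around [z] decrease to the null set [[set z]]. The coding intervals therefore
    shrink, which makes the coding injective. *)
Lemma mass_cvg0 z : mass v (interval_of v z n) @[n --> \oo] --> (0 : R).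
Proof.
have E n : mass v (interval_of v z n) = pr (cyl z n).
  by rewrite /pr process_law_cyl.
rewrite (_ : (fun _ => _) = fun n => pr (cyl z n)); last exact/funext.
have : mu (cyl z n) @[n --> \oo] --> (pr (\bigcap_n cyl z n))%:E.
  have mU : cmeasurable (\bigcap_n cyl z n).
    by apply: bigcapT_measurable => n; exact: config_measurable_cyl.
  rewrite -prE; last exact: sub_meas.
  apply: nonincreasing_cvg_mu.
  - by rewrite ltey_eq fin_num_measure//; apply: sub_meas; exact: config_measurable_cyl.
  - by move=> n; apply: sub_meas; exact: config_measurable_cyl.
  - exact: sub_meas.
  - move=> n m nm; apply/subsetPset => y yz i ilt; apply: yz; exact: leq_trans nm.
move=> /fine_cvgP[_]; rewrite (_ : \bigcap_n _ = [set z]) ?pr_set1//.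
apply/seteqP; split=> [y yz|_ -> n _ //]; apply/funext => g.
by rewrite -[g]int_indexK (yz (int_index g).+1).
Qed.

Lemma unfold_config_inj : {in @unit_itv R &, injective (unfold_config v)}.
Proof.
have key x y : @unit_itv R x -> @unit_itv R y -> unfold_config v x = unfold_config v y -> x <= y.
  move=> Dx Dy xy; rewrite leNgt; apply/negP => yx.
  have := mass_cvg0 (unfold_config v x); move=> /cvgrPdist_lt/(_ (x - y)).
  rewrite subr_gt0 yx => /(_ isT)[n _ /(_ n (leqnn n))/=].
  set I := interval_of v _ n; rewrite sub0r normrN ger0_norm ?mass_ge0//.
  have mem w : @unit_itv R w -> unfold_config v w = unfold_config v x -> lend I <= w < rend v I.
    move=> Dw wx; have : (@unit_itv R `&` unfold_config v @^-1` cyl (unfold_config v x) n) w.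
      by split => // i _; rewrite wx.
    by rewrite unfold_config_cyl//= in_itv.
  have := mem x Dx erefl; have := mem y Dy (esym xy).
  by rewrite /rend => /andP[? ?] /andP[? ?]; lra.
move=> x y /set_mem Dx /set_mem Dy xy; apply/eqP.
by rewrite eq_le (key x y)// (key y x).
Qed.

End ShiftDynamics.

(** * Measurable sets of the process modulo null sets *)

Section Completion.
Variables (R : realType) (v : {fset int} -> R).
Hypotheses (cv : completely_monotone v) (v0 : v fset0 = 1).
Local Open Scope classical_set_scope.

Notation config := (int -> bool).
Notation mu := (process_law v).
Notation cmeasurable := (@measurable _ config_space).
Notation D := (@unit_itv R).
Notation Phi := (unfold_config v).

Hypothesis mass0 : forall z, mass v (interval_of v z n) @[n --> \oo] --> (0 : R).

Lemma mem_interval_of x n : D x ->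
  lend (interval_of v (Phi x) n) <= x < rend v (interval_of v (Phi x) n).
Proof.
move=> Dx; have : (D `&` Phi @^-1` cyl (Phi x) n) x by [].
by rewrite unfold_config_cyl//= in_itv.
Qed.

Lemma interval_of_agree n y z : agree n y z -> interval_of v y n = interval_of v z n.
Proof. by move=> yz; apply: eq_split_along => i /yz. Qed.

Lemma cmeasurable_interval_of n (P : cylinder R -> Prop) :
  cmeasurable [set z | P (interval_of v z n)].
Proof.
by apply: (@config_measurable_depends n) => y z /interval_of_agree /= ->.
Qed.

Lemma borel_trace (B : set R) : measurable B ->
  exists2 C, cmeasurable C & D `&` B = D `&` Phi @^-1` C.
Proof.
pose H := [set B : set R | exists2 C, cmeasurable C & D `&` B = D `&` Phi @^-1` C].
have HP (A : set R) C : D `&` A = D `&` Phi @^-1` C -> forall x, D x -> A x <-> C (Phi x).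
  move=> /seteqP[h1 h2] x Dx; split=> [Ax|Cx].
    by have [] := h1 x (conj Dx Ax).
  by have [] := h2 x (conj Dx Cx).
have PH (A : set R) C : (forall x, D x -> A x <-> C (Phi x)) -> D `&` A = D `&` Phi @^-1` C.
  by move=> h; apply/seteqP; split=> x [Dx Ax]; split => //; apply/h.
suff : @measurable _ (measurableTypeR R) `<=` H by move=> + mB; exact.
have -> : @measurable _ (measurableTypeR R) = <<s @measurable_realfun.RGenInftyO.G R >>.
  exact: measurable_realfun.RGenInftyO.measurableE.
apply: smallest_sub; first split.
- by exists set0 => //; apply: PH.
- move=> A [C mC AC]; exists (~` C); first exact: measurableC.
  by apply: PH => x Dx; have := HP _ _ AC x Dx; rewrite /setD/= /setC/=; tauto.
- move=> F HF; have /choice[C hC] : forall i, exists C, cmeasurable C /\ D `&` F i = D `&` Phi @^-1` C.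
    by move=> i; have [C] := HF i; exists C.
  exists (\bigcup_i C i); first by apply: bigcupT_measurable => i; case: (hC i).
  apply: PH => x Dx; split=> -[i _ h]; exists i => //.
    by apply/(HP _ _ (hC i).2 x Dx).
  by apply/(HP _ _ (hC i).2 x Dx).
(* A point is less than [x] exactly when one of its shrinking, right-open intervals ends at or
   before [x]; this depends on finitely many coordinates at each depth. *)
move=> _ [x ->]; exists (\bigcup_n [set z | rend v (interval_of v z n) <= x]).
  apply: bigcupT_measurable => n; exact: (cmeasurable_interval_of n (fun c => rend v c <= x)).
apply: PH => y Dy; split=> [|[n _ /=]]; rewrite /= in_itv/=; last first.
  by apply: lt_le_trans; case/andP: (mem_interval_of n Dy).
move=> yx; have := mass0 (Phi y); move=> /cvgrPdist_lt/(_ (x - y)).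
rewrite subr_gt0 yx => /(_ isT)[n _ /(_ n (leqnn n))/=].
rewrite sub0r normrN ger0_norm ?mass_ge0// => h; exists n => //=.
by have := mem_interval_of n Dy; rewrite /rend => /andP[? ?]; lra.
Qed.

(* The configurations whose intervals have eventually constant right end points
   are those that are not coded by a point of [[0, 1[]. *)
Definition uncoded : set config := \bigcup_n \bigcap_m
  [set z | rend v (interval_of v z (n + m)) = rend v (interval_of v z n)].

Lemma cmeasurable_uncoded : cmeasurable uncoded.
Proof.
apply: bigcupT_measurable => n; apply: bigcapT_measurable => m.
apply: (@config_measurable_depends (n + m)) => y z yz /=.
rewrite (interval_of_agree yz) (@interval_of_agree n y z)// => i ilt.
by apply: yz; apply: leq_trans ilt _; exact: leq_addr.
Qed.

Lemma Phi_coded x : D x -> ~ uncoded (Phi x).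
Proof.
move=> Dx [n _ hn].
have xr : x < rend v (interval_of v (Phi x) n) by case/andP: (mem_interval_of n Dx).
have := mass0 (Phi x); move=> /cvgrPdist_lt/(_ (rend v (interval_of v (Phi x) n) - x)).
rewrite subr_gt0 xr => /(_ isT)[m _ /(_ (n + m)%N (leq_addl _ _))/=].
rewrite sub0r normrN ger0_norm ?mass_ge0// -(hn m)//.
by have := mem_interval_of (n + m) Dx; rewrite /rend => /andP[? ?]; lra.
Qed.

(** The candidate is the infimum of the right end points. They keep decreasing, so it is below all
    of them and lies in every interval. *)
Lemma coded_Phi z : ~ uncoded z -> exists2 x, D x & Phi x = z.
Proof.
move=> nz; pose l n := lend (interval_of v z n); pose r n := rend v (interval_of v z n).
have lr m n : l m <= r n.
  apply: (@le_trans _ _ (l (maxn m n))); first by apply: lend_mono => //; exact: leq_maxl.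
  apply: (@le_trans _ _ (r (maxn m n))); first exact: lend_le_rend.
  by apply: rend_mono => //; exact: leq_maxr.
pose x := inf (range r).
have lx m : l m <= x.
  by apply: lb_le_inf; [exists (r 0%N), 0%N|move=> _ [n _ <-]].
have xr' n : x <= r n.
  by apply: ge_inf; [exists (l 0%N) => _ [m _ <-]|exists n].
have xr n : x < r n.
  have : ~ (\bigcap_m [set z | rend v (interval_of v z (n + m)) =
      rend v (interval_of v z n)]) z by move=> h; apply: nz; exists n.
  move/existsNP => [m] /not_implyP[_ /eqP rm].
  apply: le_lt_trans (xr' (n + m)%N) _; rewrite lt_neqAle rm/=.
  by apply: rend_mono => //; exact: leq_addr.
have Dx : D x.
  rewrite /unit_itv/= in_itv/= (lx 0%N)/=; apply: lt_le_trans (xr 0%N) _.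
  by rewrite /r /rend /mass /= v0 add0r.
exists x => //; apply/funext => g.
have : (D `&` Phi @^-1` cyl z (int_index g).+1) x.
  rewrite unfold_config_cyl//= in_itv/=; apply/andP; split; [exact: lx|exact: xr].
by move=> [_ /= /(_ (int_index g) (ltnSn _))]; rewrite int_indexK.
Qed.

Lemma mu_uncoded : mu uncoded = 0%E.
Proof.
rewrite -[LHS]/(completed_lebesgue_measure (D `&` Phi @^-1` uncoded)).
rewrite (_ : _ `&` _ = set0) ?measure0// -subset0 => x [Dx]; exact: Phi_coded.
Qed.

(** A Lebesgue set is a Borel set up to a subset of a Borel null set, and [borel_trace] translates
    both into configurations. Outside the range of the coding [A] is arbitrary, whence the null set
    [uncoded]. *)
Lemma process_sandwich (A : set (process_space v)) : measurable A ->
  exists C N, [/\ cmeasurable C, cmeasurable N, mu N = 0%E,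
    A `\` C `<=` N & C `\` A `<=` N].
Proof.
move=> mA.
have : (wlength idfun)^*%mu.-cara.-measurable (D `&` Phi @^-1` A) by exact: mA.
rewrite -completed_caratheodory_measurable g_sigma_completed_algebra_genE.
move=> [B mB [N' [B' [mB' B'0 N'B']] BN]].
have [C1 mC1 C1E] := borel_trace mB; have [C2 mC2 C2E] := borel_trace mB'.
exists C1, (C2 `|` uncoded); split => //.
- by apply: measurableU => //; exact: cmeasurable_uncoded.
- apply/eqP; rewrite eq_le measure_ge0 andbT.
  have m2 : measurable (C2 : set (process_space v)) by exact: config_measurable_sub.
  have mU : measurable (uncoded : set (process_space v)).
    by apply: config_measurable_sub => //; exact: cmeasurable_uncoded.
  apply: (@le_trans _ _ (mu C2 + mu uncoded)%E); first exact: measureU2.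
  rewrite mu_uncoded adde0 -[leLHS]/(completed_lebesgue_measure (D `&` Phi @^-1` C2)).
  rewrite -C2E -B'0; apply: le_outer_measure; exact: subIsetr.
- move=> z [Az nC1]; have [|/coded_Phi[x Dx xz]] := pselect (uncoded z); first by right.
  left; have : (D `&` Phi @^-1` A) x by split => //=; rewrite xz.
  rewrite -BN => -[Bx|N'x].
    have : (D `&` B) x by [].
    by rewrite C1E => -[_ /=]; rewrite xz.
  have : (D `&` B') x by split => //; exact: N'B'.
  by rewrite C2E => -[_ /=]; rewrite xz.
- move=> z [C1z nA]; have [|/coded_Phi[x Dx xz]] := pselect (uncoded z); first by right.
  have : (D `&` Phi @^-1` C1) x by split => //=; rewrite xz.
  rewrite -C1E => -[_ Bx].
  have : (D `&` Phi @^-1` A) x by rewrite -BN; left.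
  by move=> [_ /=]; rewrite xz.
Qed.

End Completion.

(** * Rigidity in L2 *)

Section RigidityL2.
Local Open Scope classical_set_scope.
Local Open Scope ereal_scope.
Context d (X : measurableType d) (R : realType) (mu : probability X R).
Variable T : nat -> X -> X.
Hypotheses (mT : forall n, measurable_fun setT (T n))
  (Tmu : forall n A, measurable A -> mu (T n @^-1` A) = mu A).

(** This form passes to sums and to smaller sequences without finiteness conditions; for nonnegative
    terms it is convergence to 0. *)
Definition vanishing (u : nat -> \bar R) :=
  forall e : R, (0 < e)%R -> \forall n \near \oo, u n <= e%:E.

Hypothesis rigid : forall A, measurable A ->
  vanishing (fun n => mu (A `\` T n @^-1` A)).

Lemma vanishingP u : (forall n, 0 <= u n) -> vanishing u <-> u @ \oo --> 0.
Proof.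
move=> u0; split=> [vu|/fine_cvgP[ufin /cvgrPdist_le u1] e e0].
  apply/fine_cvgP; split.
    by apply: filterS (vu _ ltr01) => n un; rewrite ge0_fin_numE// (le_lt_trans un)// ltry.
  apply/cvgrPdist_le => e e0; apply: filterS (vu _ e0) => n un.
  have ufin : u n \is a fin_num by rewrite ge0_fin_numE// (le_lt_trans un)// ltry.
  by rewrite sub0r normrN ger0_norm ?fine_ge0// -lee_fin fineK.
near=> n; have ufn : u n \is a fin_num by near: n.
rewrite -(fineK ufn) lee_fin; have : (`|0 - fine (u n)| <= e)%R by near: n; exact: u1.
by rewrite sub0r normrN ger0_norm// fine_ge0.
Unshelve. all: by end_near. Qed.

Lemma vanishingD u w : vanishing u -> vanishing w -> vanishing (fun n => u n + w n).
Proof.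
move=> vu vw e e0; have e2 : (0 < e / 2)%R by rewrite divr_gt0.
near=> n; rewrite [e]splitr EFinD leeD//; near: n; [exact: vu|exact: vw].
Unshelve. all: by end_near. Qed.

Lemma vanishingZ (c : R) u : (0 <= c)%R -> vanishing u -> vanishing (fun n => c%:E * u n).
Proof.
move=> c0 vu e e0; have e2 : (0 < e / (c + 1))%R by rewrite divr_gt0// ltr_wpDl.
apply: filterS (vu _ e2) => n hn.
apply: (@le_trans _ _ (c%:E * (e / (c + 1))%:E)); first by rewrite lee_wpmul2l// lee_fin.
have h : (c / (c + 1) <= 1)%R by rewrite ler_pdivrMr ?mul1r ?ltr_wpDl// lerDl.
by rewrite -EFinM lee_fin mulrCA; apply: ler_piMr h; exact: ltW.
Qed.

Lemma vanishing_le u w : (forall n, u n <= w n) -> vanishing w -> vanishing u.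
Proof. by move=> uw vw e e0; apply: filterS (vw e e0) => n; exact: le_trans. Qed.

Lemma vanishing_sum (I : Type) (s : seq I) (F : I -> nat -> \bar R) :
  (forall i, vanishing (F i)) -> vanishing (fun n => \sum_(i <- s) F i n).
Proof.
move=> vF; elim: s => [|i s IH].
  by move=> e e0; apply: nearW => n; rewrite big_nil lee_fin ltW.
by apply: vanishing_le (vanishingD (vF i) IH) => n; rewrite big_cons.
Qed.

Lemma integral_invariant n (g : X -> \bar R) : measurable_fun setT g ->
  (forall x, 0 <= g x) -> \int[mu]_x g (T n x) = \int[mu]_x g x.
Proof.
move=> mg g0; have := ge0_integral_pushforward (mT n) mu measurableT mg.
rewrite preimage_setT => <-; last by move=> *; exact: g0.
by apply: eq_measure_integral => A mA _; exact: Tmu.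
Qed.

Definition sqdist (f g : X -> R) : \bar R := \int[mu]_x ((f x - g x) ^+ 2)%:E.

Lemma sq_ge0 (f g : X -> R) x : 0 <= ((f x - g x) ^+ 2)%:E.
Proof. by rewrite lee_fin sqr_ge0. Qed.

Lemma measurable_sq (f g : X -> R) : measurable_fun setT f -> measurable_fun setT g ->
  measurable_fun setT (fun x => ((f x - g x) ^+ 2)%:E).
Proof.
move=> mf mg; apply/measurable_EFinP; apply: measurable_funX.
exact: measurable_funB.
Qed.

Lemma sqdist_trans (f g h : X -> R) : measurable_fun setT f -> measurable_fun setT g ->
  measurable_fun setT h -> sqdist f h <= 2%:E * (sqdist f g + sqdist g h).
Proof.
move=> mf mg mh; rewrite -ge0_integralD//; try exact: measurable_sq; try by move=> *; exact: sq_ge0.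
rewrite -ge0_integralZl//; last by move=> *; rewrite adde_ge0// sq_ge0.
  2: by apply: emeasurable_funD; exact: measurable_sq.
apply: ge0_le_integral => //; try by move=> *; rewrite ?mule_ge0 ?adde_ge0 ?lee_fin ?sqr_ge0.
- exact: measurable_sq.
- apply: measurable_funeM; apply: emeasurable_funD; exact: measurable_sq.
move=> x _; rewrite -EFinD -EFinM lee_fin.
have := sqr_ge0 (f x - g x - (g x - h x)); nra.
Qed.

Lemma sqdist_invariant n (f g : X -> R) : measurable_fun setT f -> measurable_fun setT g ->
  sqdist (f \o T n) (g \o T n) = sqdist f g.
Proof.
move=> mf mg; apply: (@integral_invariant n (fun x => ((f x - g x) ^+ 2)%:E)).
  exact: measurable_sq.
exact: sq_ge0.
Qed.

Lemma sqdistC f g : sqdist f g = sqdist g f.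
Proof. by apply: eq_integral => x _; rewrite -sqrrN opprB. Qed.

Let rigid_fun (f : X -> R) := vanishing (fun n => sqdist (f \o T n) f).

Lemma measurable_comp_T n (f : X -> R) : measurable_fun setT f -> measurable_fun setT (f \o T n).
Proof. by move=> mf; exact: measurableT_comp. Qed.

Lemma rigid_fun_approx (f : X -> R) (s : nat -> X -> R) : measurable_fun setT f ->
  (forall k, measurable_fun setT (s k)) -> (forall k, rigid_fun (s k)) ->
  vanishing (fun k => sqdist f (s k)) -> rigid_fun f.
Proof.
(* Two uses of [sqdist_trans], each with a factor 2, give [2 (1 + 2 (1 + 1)) = 10] shares. *)
move=> mf ms rs vs e e0; have e10 : (0 < e / 10)%R by rewrite divr_gt0.
have [k _ /(_ k (leqnn k))/= hk] := vs _ e10.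
apply: filterS (rs k _ e10) => n hn.
have mfT := measurable_comp_T n mf; have msT := measurable_comp_T n (ms k).
apply: (le_trans (sqdist_trans mfT msT mf)).
apply: (@le_trans _ _ (2%:E * ((e / 10)%:E + 2%:E * ((e / 10)%:E + (e / 10)%:E)))).
  rewrite lee_wpmul2l// leeD//; first by rewrite sqdist_invariant.
  apply: (le_trans (sqdist_trans msT (ms k) mf)).
  by rewrite lee_wpmul2l// leeD// sqdistC.
rewrite -[leLHS]/((2 * (e / 10 + 2 * (e / 10 + e / 10)))%:E) lee_fin; lra.
Qed.

Lemma rigid_funB (f g : X -> R) : measurable_fun setT f -> measurable_fun setT g ->
  rigid_fun f -> rigid_fun g -> rigid_fun (fun x => f x - g x)%R.
Proof.
move=> mf mg rf rg; apply: vanishing_le (vanishingZ (ler0n R 2) (vanishingD rf rg)) => n.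
have mfT := measurable_comp_T n mf; have mgT := measurable_comp_T n mg.
rewrite -ge0_integralD//; try exact: measurable_sq; try by move=> *; exact: sq_ge0.
rewrite -ge0_integralZl//; last by move=> *; rewrite adde_ge0// sq_ge0.
  2: by apply: emeasurable_funD; exact: measurable_sq.
apply: ge0_le_integral => //; try by move=> *; rewrite ?mule_ge0 ?adde_ge0 ?lee_fin ?sqr_ge0.
- apply: (@measurable_sq ((fun x => f x - g x)%R \o T n) (fun x => f x - g x)%R).
    by apply: measurable_comp_T; exact: measurable_funB.
  exact: measurable_funB.
- apply: measurable_funeM; apply: emeasurable_funD; exact: measurable_sq.
move=> x _; rewrite -EFinD -EFinM lee_fin /=.
move: (f (T n x)) (f x) (g (T n x)) (g x) => a b p q.
have := sqr_ge0 (a - b + (p - q)); nra.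
Qed.

Import HBNNSimple.

(** Where [s (T n x)] differs from [s x], the point has left its level set. Hence the squared
    difference is at most [(2 * M) ^+ 2] times the sum of the indicators of the left parts of the
    finitely many level sets. *)
Lemma rigid_nnsfun (s : {nnsfun X >-> R}) : rigid_fun s.
Proof.
have ms : measurable_fun setT s by [].
have fs : finite_set (range s) by exact: fimfunP.
pose vals := enum_fset (fset_set (range s)).
have valsP x : s x \in vals.
  have : s x \in fset_set (range s) by rewrite in_fset_set// inE; exists x.
  by [].
have [M [M0 sM]] : exists M : R, (0 <= M)%R /\ forall c, c \in vals -> (`|c| <= M)%R.
  elim: vals {valsP} => [|c l [M [M0 IH]]]; first by exists 0%R.
  exists (`|c| + M)%R; split; first by rewrite addr_ge0.
  move=> c'; rewrite inE => /orP[/eqP->|/IH h]; first by rewrite lerDl.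
  by rewrite (le_trans h)// lerDr.
pose A c := s @^-1` [set c].
have mA c : measurable (A c) by exact: measurable_funPTI.
pose B n c := A c `\` T n @^-1` A c.
have mB n c : measurable (B n c).
  by apply: measurableD => //; rewrite -[_ @^-1` _]setTI; exact: mT.
have mI n c : measurable_fun setT (fun x => (\1_(B n c) x : R)%:E).
  by apply/measurable_EFinP; exact: measurable_indic.
apply: vanishing_le (vanishingZ (sqr_ge0 (2 * M)%R)
  (vanishing_sum vals (fun c => rigid (mA c)))) => n.
have -> : \sum_(c <- vals) mu (A c `\` T n @^-1` A c) =
    \int[mu]_x (\sum_(c <- vals) (\1_(B n c) x : R)%:E).
  rewrite ge0_integral_sum//; apply: eq_bigr => c _.
  by rewrite integral_indic ?setIT.
have mS : measurable_fun setT (fun x => \sum_(c <- vals) (\1_(B n c) x : R)%:E).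
  exact: (emeasurable_sum vals (mI n)).
have S0 x : 0 <= \sum_(c <- vals) (\1_(B n c) x : R)%:E.
  by apply: sume_ge0 => c _; rewrite lee_fin.
rewrite -ge0_integralZl ?lee_fin ?sqr_ge0//.
apply: ge0_le_integral => //; try by move=> *; rewrite ?mule_ge0 ?lee_fin ?sqr_ge0 ?S0.
- by apply: measurable_sq => //; exact: measurable_comp_T.
- exact: measurable_funeM.
move=> x _ /=; rewrite sumEFin -EFinM lee_fin.
have S0' : (0 <= \sum_(c <- vals) \1_(B n c) x :> R)%R by apply: sumr_ge0.
have [->|sx] := eqVneq (s (T n x)) (s x).
  by rewrite subrr expr0n mulr_ge0 ?sqr_ge0.
have S1 : (1 <= \sum_(c <- vals) \1_(B n c) x :> R)%R.
  rewrite (bigD1_seq (s x)) ?fset_uniq//= {1}indicE mem_set ?lerDl ?sumr_ge0//.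
  by split => //; rewrite /A/=; apply/eqP.
apply: (@le_trans _ _ ((2 * M) ^+ 2)%R); last by rewrite ler_peMr ?sqr_ge0.
rewrite -[leLHS]real_normK ?num_real// lerXn2r ?nnegrE ?mulr_ge0//.
rewrite (le_trans (ler_normB _ _))// mulrDl mul1r.
by rewrite lerD// sM.
Qed.

(** The simple approximations from below converge in L2 by dominated convergence, with dominating
    function the square of [h]. *)
Lemma rigid_nonneg (h : X -> R) : measurable_fun setT h -> (forall x, 0 <= h x)%R ->
  \int[mu]_x ((h x) ^+ 2)%:E < +oo -> rigid_fun h.
Proof.
move=> mh h0 hfin.
have mEh : measurable_fun setT (EFin \o h) by exact/measurable_EFinP.
pose s := nnsfun_approx measurableT mEh.
apply: (rigid_fun_approx (s := fun k => s k)) => //; first by move=> k; exact: rigid_nnsfun.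
have sh k x : (0 <= s k x <= h x)%R.
  apply/andP; split => //; rewrite -lee_fin.
  rewrite /s nnsfun_approxE; apply: le_approx => //.
  by move=> y _; rewrite lee_fin.
have mh2 : measurable_fun setT (fun x => ((h x) ^+ 2)%:E).
  by apply/measurable_EFinP; exact: measurable_funX.
have ih : mu.-integrable setT (fun x => ((h x) ^+ 2)%:E).
  apply/integrableP; split => //.
  by under eq_integral => x _ do rewrite gee0_abs ?lee_fin ?sqr_ge0//.
have [] := @dominated_convergence _ _ _ mu setT measurableT
  (fun k x => ((h x - s k x) ^+ 2)%:E) (cst 0) (fun x => ((h x) ^+ 2)%:E) _ _ _ ih _.
- by move=> k; exact: measurable_sq.
- exact: measurable_cst.
- apply: aeW => x _; have := @cvg_nnsfun_approx _ _ _ _ measurableT _ mEh _ x I.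
  move=> /(_ (fun y _ => h0 y)) /fine_cvgP[_ hx].
  apply: cvg_EFin; first by apply: nearW.
  rewrite (_ : _ \o _ = fun k => (h x - s k x) * (h x - s k x))%R; last first.
    by apply/funext => k /=; rewrite expr2.
  have hs : (h x - s k x)%R @[k --> \oo] --> 0%R.
    by rewrite -(subrr (h x)); apply: cvgB; [exact: cvg_cst|exact: hx].
  by rewrite -[X in _ --> X](mulr0 0%R); exact: cvgM.
- apply: aeW => x k _; rewrite gee0_abs ?sq_ge0// lee_fin lerXn2r ?nnegrE ?subr_ge0//.
  + by case/andP: (sh k x).
  + by rewrite gerBl; case/andP: (sh k x).
move=> _ _; rewrite integral_cst// mul0e => h1.
by apply/vanishingP => // k; apply: integral_ge0 => x _; exact: sq_ge0.
Qed.

Lemma rigid_Lfun2 (h : X -> R) : h \in Lfun mu 2%:E -> rigid_fun h.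
Proof.
move=> hL; have /integrableP[mh2 h2] := Lfun2_integrable_sqr hL.
have mh : measurable_fun setT h.
  by move: hL; rewrite inE => /andP[]; rewrite inE.
have part (g : X -> R) : measurable_fun setT g -> (forall x, 0 <= g x)%R ->
    (forall x, g x <= `|h x|)%R -> rigid_fun g.
  move=> mg g0 gh; apply: rigid_nonneg => //; apply: le_lt_trans h2.
  apply: ge0_le_integral => //; try by move=> *; rewrite lee_fin sqr_ge0.
  - by apply/measurable_EFinP; exact: measurable_funX.
  - by apply: measurableT_comp.
  - move=> x _ /=; rewrite ger0_norm ?sqr_ge0// lee_fin.
    by rewrite -(real_normK (num_real (h x))) lerXn2r ?nnegrE.
have -> : h = (fun x => Num.max (h x) 0 - Num.max (- h x) 0)%R.
  by apply/funext => x; case: (leP (h x) 0%R) => hx; case: leP => ?; lra.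
apply: rigid_funB.
- exact: measurable_maxr.
- by apply: measurable_maxr => //; exact: measurableT_comp.
- apply: part; first exact: measurable_maxr.
    by move=> x; rewrite le_max lexx orbT.
  by move=> x; rewrite ge_max ler_norm/=.
- apply: part; first by apply: measurable_maxr => //; exact: measurableT_comp.
    by move=> x; rewrite le_max lexx orbT.
  by move=> x; rewrite ge_max -normrN ler_norm/=.
Qed.

Lemma rigid_complex (f : X -> R[i]) :
  (fun x => complex.Re (f x)) \in Lfun mu 2%:E ->
  (fun x => complex.Im (f x)) \in Lfun mu 2%:E ->
  'N[mu]_2%:E[(fun x => (Normc.normc (f (T n x) - f x))%:E)]
    @[n --> \oo] --> 0.
Proof.
move=> fre fim; have hre := rigid_Lfun2 fre; have him := rigid_Lfun2 fim.
have mre : measurable_fun setT (fun x => complex.Re (f x)).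
  by move: fre; rewrite inE => /andP[]; rewrite inE.
have mim : measurable_fun setT (fun x => complex.Im (f x)).
  by move: fim; rewrite inE => /andP[]; rewrite inE.
apply/vanishingP => [n|e e0]; first exact: Lnorm_ge0.
apply: filterS (vanishingD hre him (exprn_gt0 2 e0)) => n hn.
rewrite unlock.
have -> : \int[mu]_x `|(Normc.normc (f (T n x) - f x))%:E| `^ 2 =
    sqdist ((fun x => complex.Re (f x)) \o T n) (fun x => complex.Re (f x)) +
    sqdist ((fun x => complex.Im (f x)) \o T n) (fun x => complex.Im (f x)).
  rewrite -ge0_integralD//; try by move=> x _; rewrite lee_fin sqr_ge0.
  - apply: eq_integral => x _ /=; rewrite -EFinD; congr EFin.
    rewrite (@powR_mulrn _ _ 2) ?normr_ge0// real_normK ?num_real//.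
    case: (f (T n x)) => p q; case: (f x) => r s /=.
    by rewrite sqr_sqrtr// addr_ge0 ?sqr_ge0.
  - by apply: measurable_sq => //; exact: measurable_comp_T.
  - by apply: measurable_sq => //; exact: measurable_comp_T.
apply: (@le_trans _ _ ((e ^+ 2)%R%:E `^ 2^-1%R)); last first.
  by rewrite poweR_EFin powR12_sqrt ?sqr_ge0// sqrtr_sqr gtr0_norm.
apply: gt0_ler_poweR; rewrite ?in_itv/= ?leey ?andbT ?lee_fin ?sqr_ge0//.
by apply: adde_ge0; apply: integral_ge0 => x _; rewrite lee_fin sqr_ge0.
Qed.

End RigidityL2.

(** * The measure-preserving system *)

Section ProcessSystem.
Variables (R : realType) (v : {fset int} -> R).
Hypotheses (cv : completely_monotone v) (v0 : v fset0 = 1) (vS : shift_invariant v).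
Hypothesis v_nontrivial : 0 < v [fset 0] < 1.
Local Open Scope classical_set_scope.
Hypothesis vmix : forall U V Phi, Folner R Phi ->
  favg (Phi N) (fun x => `|v (U `|` fshift x V)%fset - v U * v V|) @[N --> \oo] --> (0 : R).

Notation config := (int -> bool).
Notation mu := (process_law v).
Notation cmeasurable := (@measurable _ config_space).
Notation pmeasurable := (@measurable _ (process_space v)).

Let sub_meas (A : set config) : cmeasurable A -> pmeasurable A.
Proof. exact: config_measurable_sub. Qed.

Lemma process_Lebesgue_space : nonatomic_Lebesgue_space mu.
Proof.
exact: (coded_Lebesgue_space (unfold_config_inj cv v0 vS vmix v_nontrivial)).
Qed.

Lemma process_negligible (A N : set config) :
  pmeasurable N -> mu N = 0%E -> A `<=` N -> pmeasurable A.
Proof. by move=> mN N0 AN; apply: process_Lebesgue_space.1; exists N. Qed.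

Lemma measurable_mod_null (A C N : set config) : pmeasurable C -> pmeasurable N ->
  mu N = 0%E -> A `\` C `<=` N -> C `\` A `<=` N -> pmeasurable A /\ mu A = mu C.
Proof.
move=> mC mN N0 AC CA.
have mAC := process_negligible mN N0 AC; have mCA := process_negligible mN N0 CA.
have mA : pmeasurable A.
  have -> : A = (C `\` (C `\` A)) `|` (A `\` C).
    apply/seteqP; split=> [z Az|z [[Cz nCA]|[]//]].
      by have [Cz|nC] := pselect (C z); [left; split => // -[]|right].
    by apply: contrapT => nA; exact: nCA.
  by apply: measurableU => //; exact: measurableD.
split => //; have null B : pmeasurable B -> B `<=` N -> pr v B = 0.
  move=> mB BN; apply/le_anti/andP; split; last exact: pr_ge0.
  by rewrite (le_trans (le_pr mB mN BN))// /pr N0.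
have eA : pr v A = pr v (A `&` C) + pr v (A `\` C).
  have -> : A `\` C = A `\` (A `&` C) by rewrite setDIr setDv set0U.
  rewrite (prD mA (measurableI _ _ mA mC) (@subIsetl _ _ _)).
  by rewrite addrC subrK.
have eC : pr v C = pr v (A `&` C) + pr v (C `\` A).
  have -> : C `\` A = C `\` (A `&` C) by rewrite setDIr setDv setU0.
  rewrite (prD mC (measurableI _ _ mA mC) (@subIsetr _ _ _)).
  by rewrite addrC subrK.
by rewrite (prE mA) (prE mC) eA eC (null _ mAC AC) (null _ mCA CA).
Qed.

Lemma process_mod_null (A : set config) : pmeasurable A -> exists C N,
  [/\ cmeasurable C, cmeasurable N, mu N = 0%E, A `\` C `<=` N & C `\` A `<=` N].
Proof.
exact: (process_sandwich cv v0 (mass_cvg0 cv v0 vS vmix v_nontrivial)).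
Qed.

(** Measurability for the complete sigma-algebra is not automatic: it holds because translation maps
    the exceptional null set, chosen in the product sigma-algebra, to a null set. *)
Lemma process_tr g (A : set config) : pmeasurable A ->
  pmeasurable (tr g @^-1` A) /\ mu (tr g @^-1` A) = mu A.
Proof.
move=> mA; have [C [N [mC mN N0 AC CA]]] := process_mod_null mA.
have mtN := sub_meas (cmeasurable_tr g mN); have mtC := sub_meas (cmeasurable_tr g mC).
have trN0 : mu (tr g @^-1` N) = 0%E by rewrite (prE mtN) (pr_tr cv v0 vS g mN) /pr N0.
have [|||||mtA ->] := @measurable_mod_null (tr g @^-1` A) (tr g @^-1` C) (tr g @^-1` N).
- exact: mtC.
- exact: mtN.
- exact: trN0.
- by move=> z /AC.
- by move=> z /CA.
split; first exact: mtA.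
rewrite (prE mtC) (pr_tr cv v0 vS g mC) -(prE (sub_meas mC)).
by have [] := measurable_mod_null (sub_meas mC) (sub_meas mN) N0 AC CA.
Qed.

Lemma process_action : measure_preserving_action mu tr.
Proof.
split=> [|g h|g _ A mA|g A mA]; [exact: tr0|exact: trD| |].
  by rewrite setTI; exact: (process_tr g mA).1.
exact: (process_tr g mA).2.
Qed.

Lemma process_weakly_mixing : weakly_mixing mu tr.
Proof.
move=> A B mA mB Phi FPhi.
have [CA [NA [mCA mNA NA0 ACA CAA]]] := process_mod_null mA.
have [CB [NB [mCB mNB NB0 BCB CBB]]] := process_mod_null mB.
have := config_mixing cv v0 vS vmix FPhi mCA mCB.
rewrite (_ : (fun N => _) = fun N => #|` Phi N|%:R^-1 * \sum_(g <- Phi N)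
  `|fine (mu (A `&` (tr g @` B))) - fine (mu A) * fine (mu B)|)//.
apply/funext => N; rewrite /favg; congr (_ * _); apply: eq_bigr => g _.
have [_ eA] := measurable_mod_null (sub_meas mCA) (sub_meas mNA) NA0 ACA CAA.
have [_ eB] := measurable_mod_null (sub_meas mCB) (sub_meas mNB) NB0 BCB CBB.
have mtr C : cmeasurable C -> cmeasurable (tr g @` C).
  by rewrite image_tr; exact: cmeasurable_tr.
have NB0' : mu (tr g @` NB) = 0%E.
  by rewrite image_tr (process_tr _ (sub_meas mNB)).2.
have [|||||_ ->] := @measurable_mod_null (A `&` tr g @` B) (CA `&` tr g @` CB)
  (NA `|` tr g @` NB).
- by apply: sub_meas; apply: measurableI => //; exact: mtr.
- by apply: sub_meas; apply: measurableU => //; exact: mtr.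
- by rewrite -[RHS]NA0; exact: measureU0 (sub_meas mNA) (sub_meas (mtr _ mNB)) NB0'.
- move=> z [[Az trBz] nC]; have [CAz|nCA] := pselect (CA z); last by left; exact: ACA.
  right; move: trBz nC; rewrite !image_tr /= => trBz nC.
  by apply: BCB; split => // trC; apply: nC.
- move=> z [[CAz trCBz] nAB]; have [Az|nA] := pselect (A z); last by left; exact: CAA.
  right; move: trCBz nAB; rewrite !image_tr /= => trCBz nAB.
  by apply: CBB; split => // trB; apply: nAB.
by rewrite /pr eA eB.
Qed.

Variable a : nat -> int.
Hypothesis v_rigid : v [fset 0; a n] @[n --> \oo] --> v [fset 0].

Notation moved A n := (A `\` tr (a n) @^-1` A).

Lemma cmeasurable_moved A n : cmeasurable A -> cmeasurable (moved A n).
Proof. by move=> mA; apply: measurableD => //; exact: cmeasurable_tr. Qed.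

Lemma pr_setDC (A B : set config) : cmeasurable A -> cmeasurable B -> pr v A = pr v B ->
  pr v (A `\` B) = pr v (B `\` A).
Proof.
move=> mA mB AB; have mI := measurableI _ _ mA mB.
have -> : A `\` B = A `\` (A `&` B) by rewrite setDIr setDv set0U.
have -> : B `\` A = B `\` (A `&` B) by rewrite setDIr setDv setU0.
rewrite (prD (sub_meas mA) (sub_meas mI)); last exact: subIsetl.
by rewrite (prD (sub_meas mB) (sub_meas mI)) ?AB//; exact: subIsetr.
Qed.

Lemma pr_sub2 (A B C : set config) : cmeasurable A -> cmeasurable B -> cmeasurable C ->
  A `<=` B `|` C -> pr v A <= pr v B + pr v C.
Proof.
move=> mA mB mC ABC; rewrite -lee_fin EFinD.
rewrite -(prE (sub_meas mA)) -(prE (sub_meas mB)) -(prE (sub_meas mC)).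
apply: le_trans (measureU2 mu (sub_meas mB) (sub_meas mC)).
by apply: le_measure => //; rewrite inE; apply: sub_meas => //; exact: measurableU.
Qed.

Lemma rigid_config (A : set config) : cmeasurable A ->
  pr v (moved A n) @[n --> \oo] --> (0 : R).
Proof.
have squeeze (u w : nat -> R) : (forall n, 0 <= u n <= w n) ->
    w n @[n --> \oo] --> (0 : R) -> u n @[n --> \oo] --> (0 : R).
  move=> uw; apply: (@squeeze_cvgr _ _ _ _ (fun=> 0)); last exact: cvg_cst.
  exact: nearW.
have add (u w : nat -> R) : u n @[n --> \oo] --> (0 : R) -> w n @[n --> \oo] --> (0 : R) ->
    (u n + w n) @[n --> \oo] --> (0 : R).
  by move=> hu hw; rewrite -[X in _ --> X]addr0; exact: cvgD.
move: A; apply: config_pi_lambda => [U|A B mA mB BA hA hB|F mF ndF hF].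
- move: U; apply: fset_ind => [|g U _ IH].
    rewrite (_ : (fun n => _) = fun=> 0); first exact: cvg_cst.
    apply/funext => n; rewrite (_ : _ `\` _ = set0) ?/pr ?measure0//.
    by rewrite -subset0 => z [_ nz]; apply: nz => h; rewrite inE.
  have m1 := cmeasurable_all_ones [fset g]; have mU := cmeasurable_all_ones U.
  apply: (squeeze _ (fun n => pr v (moved (all_ones [fset g]) n) +
      pr v (moved (all_ones U) n))) => [n|].
    rewrite pr_ge0/=; apply: pr_sub2; try exact: cmeasurable_moved.
      by apply: cmeasurable_moved; exact: cmeasurable_all_ones.
    move=> z [zgU nz].
    have zg : all_ones [fset g] z by move=> h hg; apply: zgU; rewrite inE hg.
    have zU : all_ones U z by move=> h hU; apply: zgU; rewrite inE hU orbT.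
    have [tz|tz] := pselect ((tr (a n) @^-1` all_ones [fset g]) z); last by left.
    right; split => // tzU; apply: nz => h; rewrite inE => /orP[/tz//|/tzU//].
  apply: (add _ _ _ IH).
  (* The moved part consists of the configurations that are 1 at [g] but not at [g - a n]; shift
     invariance brings this pair to [0] and [a n]. *)
  have E n : pr v (moved (all_ones [fset g]) n) = v [fset 0] - v [fset 0; a n].
    have -> : moved (all_ones [fset g]) n =
        all_ones [fset g] `\` all_ones [fset g; g - a n].
      rewrite preimage_tr_all_ones fshift1.
      apply/seteqP; split=> z [zg nz]; split => // h.
        by apply: nz => k kg; apply: h; rewrite inE kg orbT.
      apply: nz => k; rewrite inE => /orP[/zg//|/h//].
    rewrite (prD (sub_meas (cmeasurable_all_ones _)) (sub_meas (cmeasurable_all_ones _))).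
      rewrite !pr_all_ones// -(vS (- g) [fset g]) -(vS (a n - g) [fset g; _]).
      rewrite fshiftU !fshift1 subrr fsetUC; congr (_ - v (_ `|` _))%fset; congr fset1; ring.
    by move=> z h k kg; apply: h; rewrite inE kg.
  rewrite (_ : (fun n => _) = fun n => v [fset 0] - v [fset 0; a n]); last exact/funext.
  by rewrite -(subrr (v [fset 0])); apply: cvgB => //; exact: cvg_cst.
(* A point that leaves the difference either leaves [A] or enters [B]; by invariance, entering [B]
   is as likely as leaving it. *)
- apply: (squeeze _ _ _ (add _ _ hA hB)) => n; rewrite pr_ge0/=.
  have mt := cmeasurable_tr (a n) mB.
  rewrite (pr_setDC mB mt); last by rewrite pr_tr.
  have mAB : cmeasurable (A `\` B) by exact: measurableD.
  have mtB : cmeasurable (tr (a n) @^-1` B `\` B) by exact: measurableD.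
  apply: (pr_sub2 (cmeasurable_moved n mAB) (cmeasurable_moved n mA) mtB).
  move=> z [[Az nB] nz]; have [tAz|] := pselect ((tr (a n) @^-1` A) z); last by left.
  by right; split => //; apply: contrapT => ntB; exact: nz.
- have mU : cmeasurable (\bigcup_i F i) by exact: bigcupT_measurable.
  apply/cvgrPdist_le => e e0; have e2 : 0 < e / 2 by rewrite divr_gt0.
  have := pr_nondecreasing (fun i => sub_meas (mF i)) ndF.
  move=> /cvgrPdist_le/(_ _ e2)[i _ /(_ i (leqnn i))/= hi].
  have FiF : F i `<=` \bigcup_i F i by exact: bigcup_sup.
  have := hF i; move=> /cvgrPdist_le/(_ _ e2); apply: filterS => n.
  rewrite !sub0r !normrN !ger0_norm ?pr_ge0// => hn.
  rewrite [e]splitr; apply: le_trans (lerD (le_trans (ler_norm _) hi) hn).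
  rewrite -(prD (sub_meas mU) (sub_meas (mF i)) FiF).
  have mUF : cmeasurable (\bigcup_i F i `\` F i) by exact: measurableD.
  apply: (pr_sub2 (cmeasurable_moved n mU) mUF (cmeasurable_moved n (mF i))).
  move=> z [Uz nz]; have [Fz|nF] := pselect (F i z); last by left.
  by right; split => // tF; apply: nz; exact: FiF.
Qed.

Lemma process_rigid : rigidity_sequence_for mu tr a.
Proof.
move=> f fre fim; apply: (@rigid_complex _ _ _ mu (fun n => tr (a n))) => //.
- by move=> n; case: process_action.
- by move=> n A mA; exact: (process_tr _ mA).2.
move=> A mA; have [C [N [mC mN N0 AC CA]]] := process_mod_null mA.
move=> e e0; have := rigid_config mC; move=> /cvgrPdist_le/(_ _ e0).
apply: filterS => n; rewrite sub0r normrN ger0_norm ?pr_ge0// => hn.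
have trN0 : mu (tr (a n) @^-1` N) = 0%E by rewrite (process_tr _ (sub_meas mN)).2.
have mtN := cmeasurable_tr (a n) mN.
have [|||||_ ->] := @measurable_mod_null (moved A n) (moved C n) (N `|` tr (a n) @^-1` N).
- exact: (sub_meas (cmeasurable_moved n mC)).
- by apply: (@sub_meas (_ `|` _)); exact: measurableU.
- by rewrite -[RHS]N0; exact: measureU0 (sub_meas mN) (sub_meas mtN) trN0.
- move=> z [[Az ntA] nz]; have [Cz|nC] := pselect (C z); last by left; exact: AC.
  by right; apply: CA; split => //; apply: contrapT => ntC; exact: nz.
- move=> z [[Cz ntC] nz]; have [Az|nA] := pselect (A z); last by left; exact: CA.
  by right; apply: AC; split => //; apply: contrapT => ntA; exact: nz.
by rewrite (prE (sub_meas (cmeasurable_moved _ mC))) lee_fin.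
Qed.

Lemma process_rigidity_sequence : rigidity_sequence R a.
Proof.
exists _, (process_space v), mu, tr; split.
- by split; [exact: process_Lebesgue_space|exact: process_action].
- exact: process_weakly_mixing.
- exact: process_rigid.
Qed.

End ProcessSystem.

Theorem proposition4p1 (R : realType) (alpha : R) (halpha : PV_number alpha) :
  rigidity_sequence R (fun n : nat => nearest_int (alpha ^+ n)).
Proof.
have [e [t ht]] := PV_parameters halpha.
have [|||||v [[cv v0] vS v01 vmix vrig]] :=
  @exists_process R e t (fun n => nearest_int (alpha ^+ n)); try by case: ht.
exact: process_rigidity_sequence cv v0 vS v01 vmix _ vrig.
Qed.
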